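(* Let $\Omega$ be a convex domain in $\mathbb{R}^d$, let $F\in C^2(\bar\Omega)$, and let $d\gamma=e^{-F}dx$ be a probability measure on $\Omega$. Let $\theta\in(0,1)$ be such that $\lambda_1(m,\theta)>0$, and let $(m,p)\in\mathsf{E}_\theta$ with $p\in(1,2)$ and $1<m<p+1$. Then there exists a positive constant $\kappa$, which depends on $\mathcal{E}_{m,p}(0)$, such that any smooth solution $v$ of $$v_t=\Delta_g v^m\quad\text{in }\Omega\times\mathbb{R}^+,\qquad\nabla v\cdot n=0\quad\text{on }\partial\Omega\times\mathbb{R}^+,$$ with $\int_\Omega v\,d\gamma=1$ satisfies, for any $t>0$, $$\mathcal{I}_{m,p}(t)\le\frac{\mathcal{I}_{m,p}(0)}{\left[1+\frac\kappa3\,\sqrt[3]{\mathcal{I}_{m,p}(0)}\;t\right]^3},\qquad \mathcal{E}_{m,p}(t)\le\frac{3\,\big[\mathcal{I}_{m,p}(0)\big]^{8/3}}{2\,\kappa\left[1+\frac\kappa3\,\sqrt[3]{\mathcal{I}_{m,p}(0)}\;t\right]^2}.$$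
   Context: Here $g=e^{-F}$, $\Delta_g v:=\Delta v-\mathrm{D}F\cdot\mathrm{D}v$, and $n$ is the unit outgoing normal to $\partial\Omega$, which is assumed to be of class $C^1$ (no boundary condition if $\Omega=\mathbb{R}^d$). With $\beta:=(p/2+m-1)^{-1}$ and $s$ defined by $v=s^\beta$, set $$\mathcal{E}_{m,p}(t):=\frac1{m+p-2}\int_\Omega\big[v^{m+p-1}-1\big]\,d\gamma,\qquad \mathcal{I}_{m,p}(t):=c(m,p)\int_\Omega|\mathrm{D}s|^2\,d\gamma,\qquad c(m,p)=\frac{4m(m+p-1)}{(2m+p-2)^2},$$ with $v=v(\cdot,t)$. Let $V(x):=\inf_{\xi\in S^{d-1}}(\mathrm{D}^2F(x)\xi,\xi)$ and, for $\theta\in(0,1)$, $$\lambda_1(m,\theta):=\inf_{w\in H^1(\Omega,d\gamma)\setminus\{0\}}\frac{\int_\Omega\big((1-\theta)|\mathrm{D}w|^2+V|w|^2\big)\,d\gamma}{\int_\Omega|w|^2\,d\gamma},$$ where $H^1(\Omega,d\gamma)$ is the space of $w\in W^{1,1}_{\rm loc}(\Omega)\cap L^2(\Omega,d\gamma)$ with $\|\mathrm{D}w\|_{L^2(\Omega,d\gamma)}<\infty$. (The quantity does not actually depend on $m$.) $\mathsf{E}_\theta$ is the set of $(m,p)$ such that $$(p+2m-4)^2+\big[5m^2+2(2p-7)m+(p-3)^2\big]\theta<0.$$ Standing convention: questions of regularity and well-posedness are not addressed; solutions are assumed to be positive, smooth (up to the boundary), and to behave adequately under integrations by parts, i.e.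 they have enough regularity and integrability at infinity that all integrations by parts with respect to $d\gamma$ involving $v$, its powers and their derivatives, and all differentiations in $t$ under the integral sign, are justified, and all integral quantities involved are well defined. *)

(* Defs.v *)
From HB Require Import structures.
From mathcomp Require Import all_boot all_order all_algebra.
From mathcomp Require Import all_classical all_reals all_analysis.

Set Implicit Arguments.
Unset Strict Implicit.
Unset Printing Implicit Defensive.

Import Order.TTheory GRing.Theory Num.Theory.
Import numFieldNormedType.Exports.

Local Open Scope classical_set_scope.
Local Open Scope ring_scope.

(* The sigma-algebra on row vectors generated by the coordinates (for R^d it is
   the Borel sigma-algebra); same construction as for tuples in the library. *)
Definition rV_display : measure_display -> measure_display.
Proof. exact. Qed.

Section measurable_rV.
Context {d} {T : measurableType d} {n : nat}.

Definition rV_coord (i : 'I_n) (x : 'rV[T]_n) : T := x ord0 i.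

Let rV_set0 : g_sigma_preimage rV_coord set0.
Proof. exact: sigma_algebra0. Qed.

Let rV_setC A : g_sigma_preimage rV_coord A -> g_sigma_preimage rV_coord (~` A).
Proof. exact: sigma_algebraC. Qed.

Let rV_bigcup (F : _^nat) : (forall i, g_sigma_preimage rV_coord (F i)) ->
  g_sigma_preimage rV_coord (\bigcup_i (F i)).
Proof. exact: sigma_algebra_bigcup. Qed.

HB.instance Definition _ := @isMeasurable.Build (rV_display d)
  'rV[T]_n (g_sigma_preimage rV_coord) rV_set0 rV_setC rV_bigcup.

Lemma measurable_rV_coord (i : 'I_n) :
  measurable_fun [set: 'rV[T]_n] (rV_coord i).
Proof.
move=> _ Y mY; rewrite setTI; apply: sub_sigma_algebra => /=.
rewrite -bigcup_seq/=; exists i => /=; first by rewrite mem_index_enum.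
by exists Y => //; rewrite setTI.
Qed.

End measurable_rV.

Lemma measurable_fun_rVP d1 d2 (T1 : measurableType d1) (T2 : measurableType d2)
    n (f : T1 -> 'rV[T2]_n) :
  (forall i, measurable_fun [set: T1] (fun x => f x ord0 i)) ->
  measurable_fun [set: T1] f.
Proof.
move=> mf; rewrite -[measurable_fun _ _]/(forall _, _) => mT.
have : g_sigma_preimage (fun i => rV_coord i \o f) `<=` measurable.
  apply: smallest_sub; first exact: sigma_algebra_measurable.
  case: n => [|n] in f mf *; first by rewrite big_ord0.
  rewrite -bigcup_mkord_ord; apply: bigcup_sub => i Ii.
  by move=> A [B mB <-]; exact: mf.
rewrite g_sigma_preimage_comp => sub A mA.
by apply: sub; exists A.
Qed.

Section lebesgue_rV_step.
Context {R : realType} {n : nat}.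

Definition rV_cons (p : R * 'rV[R]_n) : 'rV[R]_n.+1 :=
  \row_i (if unlift ord0 i is Some j then p.2 ord0 j else p.1).

Definition rV_uncons (x : 'rV[R]_n.+1) : R * 'rV[R]_n :=
  (x ord0 ord0, \row_i x ord0 (lift ord0 i)).

Lemma rV_consE0 p : rV_cons p ord0 ord0 = p.1.
Proof. by rewrite mxE unlift_none. Qed.

Lemma rV_consES p i : rV_cons p ord0 (lift ord0 i) = p.2 ord0 i.
Proof. by rewrite mxE liftK. Qed.

Lemma rV_consK : cancel rV_cons rV_uncons.
Proof.
move=> p; rewrite /rV_uncons rV_consE0 [RHS]surjective_pairing; congr pair.
by apply/rowP => i; rewrite mxE rV_consES.
Qed.

Lemma measurable_rV_cons :
  measurable_fun [set: (R * 'rV[R]_n)%type] rV_cons.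
Proof.
apply: measurable_fun_rVP => i; case: (unliftP ord0 i) => [j|] ->.
  under eq_fun do rewrite rV_consES.
  exact: (measurableT_comp (measurable_rV_coord j) measurable_snd).
by under eq_fun do rewrite rV_consE0; exact: measurable_fst.
Qed.

Lemma measurable_rV_uncons : measurable_fun [set: 'rV[R]_n.+1] rV_uncons.
Proof.
apply: measurable_fun_pair; first exact: measurable_rV_coord.
apply: measurable_fun_rVP => i.
under eq_fun do rewrite mxE.
exact: measurable_rV_coord.
Qed.

Lemma rV_unconsK : cancel rV_uncons rV_cons.
Proof.
move=> x; apply/rowP => i; case: (unliftP ord0 i) => [j|] ->.
  by rewrite rV_consES mxE.
by rewrite rV_consE0.
Qed.

Variable mu : {sigma_finite_measure set 'rV[R]_n -> \bar R}.

Let leb1 : {sigma_finite_measure set _ -> \bar R} := @lebesgue_measure R.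

Definition lebesgue_rV_succ : set 'rV[R]_n.+1 -> \bar R :=
  pushforward (leb1 \x mu)%E rV_cons.

HB.instance Definition _ := Measure.copy lebesgue_rV_succ
  (measure_function_pushforward__canonical__measure_function_Measure
    (leb1 \x mu)%E measurable_rV_cons).

Let sigma_finite_lebesgue_rV_succ : sigma_finite setT lebesgue_rV_succ.
Proof.
have /sigma_finiteP[F [TF ndF Foo]] := sigma_finiteT leb1.
have /sigma_finiteP[G [TG ndG Goo]] := sigma_finiteT mu.
exists (fun k => rV_uncons @^-1` (F k `*` G k)).
  rewrite -preimage_bigcup (_ : \bigcup_i _ = setT) ?preimage_setT//.
  rewrite -subTset => -[x y] _.
  have [k _ Fkx] : (\bigcup_k F k) x by rewrite -TF.
  have [l _ Gly] : (\bigcup_k G k) y by rewrite -TG.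
  exists (maxn k l) => //; split.
    by move: x Fkx; exact/subsetPset/ndF/leq_maxl.
  by move: y Gly; exact/subsetPset/ndG/leq_maxr.
move=> k; have [mF Fk] := Foo k; have [mG Gk] := Goo k; split.
  rewrite -[X in measurable X]setTI; apply: measurable_rV_uncons => //.
  exact: measurableX.
rewrite /lebesgue_rV_succ /pushforward -comp_preimage.
rewrite (_ : rV_uncons \o rV_cons = id) ?preimage_id; last first.
  by apply/funext => p; exact: rV_consK.
by rewrite product_measure1E// lte_mul_pinfty// ge0_fin_numE.
Qed.

HB.instance Definition _ := @Measure_isSigmaFinite.Build _ _ _
  lebesgue_rV_succ sigma_finite_lebesgue_rV_succ.

End lebesgue_rV_step.

(* Lebesgue measure on R^n. *)
Fixpoint lebesgue_rV {R : realType} (n : nat) :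
    {sigma_finite_measure set 'rV[R]_n -> \bar R} :=
  if n is k.+1 then lebesgue_rV_succ (lebesgue_rV k) else \d_(0 : 'rV[R]_0).

(* Iterated directional derivative along v_1, ..., v_k. *)
Definition iter_derive {R : realType} {V : normedModType R} (vs : seq V)
    (f : V -> R) : V -> R :=
  foldr (fun v g => 'D_v g) f vs.

(* Boundary value of a function on U: its limit at x from inside U. *)
Definition trace {R : realType} {V : normedModType R} (U : set V) (f : V -> R)
    (x : V) : R := lim (f @ within U (nbhs x)).

(* f is of class C^k on the open set U. *)
Definition Ck_on {R : realType} {V : normedModType R} (U : set V) (k : nat)
    (f : V -> R) : Prop :=
  forall vs : seq V, (size vs <= k)%N -> forall x, U x ->
    {for x, continuous (iter_derive vs f)} /\
    ((size vs < k)%N -> forall v, derivable (iter_derive vs f) x v).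

(* f is of class C^k on U, and each of its derivatives of order <= k extends
   continuously to A, where U `<=` A `<=` closure U; the values of f outside U
   play no role.  For A = closure U this is the space C^k(closure U). *)
Definition Ck_upto {R : realType} {V : normedModType R} (U A : set V) (k : nat)
    (f : V -> R) : Prop :=
  Ck_on U k f /\
  forall vs : seq V, (size vs <= k)%N -> forall x, A x ->
    cvg (iter_derive vs f @ within U (nbhs x)).

Section euclidean.
Context {R : realType} {d : nat}.
Implicit Types (x y xi nu : 'rV[R]_d) (u F : 'rV[R]_d -> R) (Om : set 'rV[R]_d)
  (X : 'rV[R]_d -> 'rV[R]_d).

(* The library norm of row vectors is the sup norm, hence these. *)
Definition dot x y : R := \sum_i x 0 i * y 0 i.

Definition enorm x : R := Num.sqrt (dot x x).

Definition partial (i : 'I_d) u : 'rV[R]_d -> R := 'D_(delta_mx 0 i) u.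

Definition grad u x : 'rV[R]_d := \row_i partial i u x.

Definition hess u x : 'M[R]_d := \matrix_(i, j) partial i (partial j u) x.

(* (D^2 u(x) xi, xi) *)
Definition hess_form u x xi : R := dot (xi *m hess u x) xi.

Definition hess_norm2 u x : R := \sum_i \sum_j hess u x i j ^+ 2.

(* Delta_g u = Delta u - DF . Du *)
Definition lapg F u x : R :=
  \sum_i partial i (partial i u) x - dot (grad F x) (grad u x).

(* div X - DF . X, i.e. e^F div (e^{-F} X) *)
Definition divg F X x : R :=
  \sum_i partial i (fun y => X y 0 i) x - dot (grad F x) (X x).

Definition boundary Om : set 'rV[R]_d := closure Om `\` Om.

(* rho is a C^1 defining function of the open set Om near its boundary point
   x. *)
Definition local_defining Om x (rho : 'rV[R]_d -> R) : Prop :=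
  exists U : set 'rV[R]_d, [/\ open U, U x, Ck_on U 1 rho,
    forall y, U y -> grad rho y != 0 & forall y, U y -> (Om y <-> rho y < 0)].

Definition C1_boundary Om : Prop :=
  forall x, boundary Om x -> exists rho, local_defining Om x rho.

Definition outer_normal Om x nu : Prop :=
  exists2 rho, local_defining Om x rho &
    nu = (enorm (grad rho x))^-1 *: grad rho x.

(* Value at the boundary point x of X . nu, X being defined in Om. *)
Definition normal_trace Om X x nu : R :=
  \sum_i trace Om (fun y => X y 0 i) x * nu 0 i.

End euclidean.

Section weighted.
Context {R : realType} {d : nat}.
Implicit Types (x xi nu : 'rV[R]_d) (u F w : 'rV[R]_d -> R)
  (Om : set 'rV[R]_d) (X G : 'rV[R]_d -> 'rV[R]_d).

Local Notation dx := (@lebesgue_rV R d).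

(* Integral over Om, and integrability on Om, with respect to
   d gamma = e^{-F} dx. *)
Definition gint Om F u : R := \int[dx]_(x in Om) (u x * expR (- F x)).

Definition gintegrable Om F u : Prop :=
  dx.-integrable Om (fun x => (u x * expR (- F x))%:E).

(* Gauss-Green formula on Om with respect to gamma: it is stated through the
   sign of the flux, so that no surface measure on the boundary is needed;
   applied to X and - X it gives \int divg X = 0 for tangential X.  It holds on
   every convex domain with C^1 boundary, by cutting off and using that X and
   divg X are in L^1; it is the part of "integrations by parts are justified"
   which does not concern the integrability of the solution. *)
Definition gauss_green Om F : Prop :=
  forall X, (forall i, Ck_upto Om (closure Om) 1 (fun x => X x 0 i)) ->
    gintegrable Om F (fun x => enorm (X x)) -> gintegrable Om F (divg F X) ->
    (forall x nu, boundary Om x -> outer_normal Om x nu ->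
       0 <= normal_trace Om X x nu) ->
    0 <= gint Om F (divg F X).

Definition test_function Om (phi : 'rV[R]_d -> R) : Prop :=
  (forall k, Ck_on setT k phi) /\
  exists K : set 'rV[R]_d, [/\ compact K, K `<=` Om &
    forall x, ~ K x -> phi x = 0].

Definition L1loc Om u : Prop :=
  measurable_fun Om u /\
  forall K : set 'rV[R]_d, compact K -> K `<=` Om ->
    dx.-integrable K (EFin \o u).

(* w lies in W^{1,1}_loc(Om), with weak gradient G. *)
Definition W11loc Om w G : Prop :=
  [/\ L1loc Om w, forall i, L1loc Om (fun x => G x 0 i) &
    forall phi, test_function Om phi -> forall i,
      \int[dx]_(x in Om) (w x * partial i phi x) =
      - \int[dx]_(x in Om) (G x 0 i * phi x)].

(* w lies in H^1(Om, d gamma), with weak gradient G. *)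
Definition H1 Om F w G : Prop :=
  [/\ W11loc Om w G, gintegrable Om F (fun x => w x ^+ 2) &
    gintegrable Om F (fun x => dot (G x) (G x))].

Definition Vmin F x : R :=
  inf [set hess_form F x xi | xi in [set xi | dot xi xi = 1]].

(* The quotient minimised in lambda1.  Its numerator takes values in \bar R
   since V w^2 need not be integrable; the infimum is over those w for which
   it is well defined, i.e. not of the form +oo - oo. *)
Definition rayleigh_num F (theta : R) w G x : \bar R :=
  (((1 - theta) * dot (G x) (G x) + Vmin F x * w x ^+ 2) * expR (- F x))%:E.

Definition lambda1 Om F (theta : R) : \bar R :=
  ereal_inf [set q : \bar R | exists w G,
    [/\ H1 Om F w G, 0 < gint Om F (fun x => w x ^+ 2),
      (\int[dx]_(x in Om) ((rayleigh_num F theta w G)^\+ x) < +oo)%E \/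
      (\int[dx]_(x in Om) ((rayleigh_num F theta w G)^\- x) < +oo)%E &
      q = (\int[dx]_(x in Om) rayleigh_num F theta w G x *
           ((gint Om F (fun x => w x ^+ 2))^-1)%:E)%E]].

End weighted.

Definition E_theta {R : realType} (theta m p : R) : Prop :=
  (p + 2 * m - 4) ^+ 2 +
  (5 * m ^+ 2 + 2 * (2 * p - 7) * m + (p - 3) ^+ 2) * theta < 0.

Section solutions.
Context {R : realType} {d : nat} (Om : set 'rV[R]_d) (F : 'rV[R]_d -> R)
  (m p : R).
Implicit Types v f : 'rV[R]_d -> R -> R.

(* A positive classical solution of v_t = Delta_g v^m with homogeneous Neumann
   boundary condition; it is smooth up to the spatial boundary for t > 0, and
   C^1 in x with continuity at t = 0. *)
Record solution v : Prop := {
  sol_smooth : forall k, Ck_upto (Om `*` [set t : R | 0 < t])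
    (closure Om `*` [set t : R | 0 < t]) k (fun z : 'rV[R]_d * R => v z.1 z.2);
  sol_derivable0 : forall (x : 'rV[R]_d) i, Om x ->
    derivable (v ^~ 0) x (delta_mx 0 i);
  sol_continuous0 : {within Om `*` [set t : R | 0 <= t],
    continuous (fun z : 'rV[R]_d * R => v z.1 z.2)};
  sol_continuous0_partial : forall i, {within Om `*` [set t : R | 0 <= t],
    continuous (fun z => partial i (v ^~ z.2) z.1)};
  sol_pos : forall (x : 'rV[R]_d) (t : R), Om x -> 0 <= t -> 0 < v x t;
  sol_pos_closure : forall (x : 'rV[R]_d) (t : R), closure Om x -> 0 < t ->
    0 < trace Om (v ^~ t) x;
  sol_eq : forall (x : 'rV[R]_d) (t : R), Om x -> 0 < t ->
    (v x)^`()%classic t = lapg F (fun y => v y t `^ m) x;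
  sol_neumann : forall (x nu : 'rV[R]_d) (t : R), boundary Om x ->
    outer_normal Om x nu -> 0 < t -> normal_trace Om (grad (v ^~ t)) x nu = 0
}.

Definition beta : R := (p / 2 + m - 1)^-1.

(* s is defined by v = s^beta. *)
Definition s_of v x t : R := v x t `^ beta^-1.

Definition entropy v t : R :=
  (m + p - 2)^-1 * gint Om F (fun x => v x t `^ (m + p - 1) - 1).

Definition grad_s2 v x t : R :=
  dot (grad (s_of v ^~ t) x) (grad (s_of v ^~ t) x).

Definition fisher v t : R :=
  4 * m * (m + p - 1) / (2 * m + p - 2) ^+ 2 *
  gint Om F (fun x => grad_s2 v x t).

(* d/dt \int f d gamma = \int f_t d gamma for t > 0, all terms being well
   defined. *)
Definition derivable_under_gint f : Prop :=
  forall t : R, 0 < t ->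
    [/\ gintegrable Om F (f ^~ t),
      gintegrable Om F (fun x => (f x)^`()%classic t) &
      is_derive t 1 (fun r => gint Om F (f ^~ r))
        (gint Om F (fun x => (f x)^`()%classic t))].

(* "The solution behaves adequately under integrations by parts": the
   quantities that occur in the computation of the time derivatives of the
   entropy, of \int s^2 d gamma (= \int v^(2m+p-2) d gamma) and of the Fisher
   information are well defined, and one may differentiate under the
   integral. *)
Record adequate v : Prop := {
  adq_entropy0 : gintegrable Om F (fun x => v x 0 `^ (m + p - 1));
  adq_fisher0 : gintegrable Om F (fun x => grad_s2 v x 0);
  adq_entropy_cvg0 : entropy v @ 0^'+ --> entropy v 0;
  adq_fisher_cvg0 : fisher v @ 0^'+ --> fisher v 0;
  adq_power : forall q, q = m + p - 1 \/ q = 2 * m + p - 2 ->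
    derivable_under_gint (fun x t => v x t `^ q) /\
    forall t : R, 0 < t -> let X := fun x =>
        v x t `^ (q - 1) *: grad (fun y => v y t `^ m) x in
      gintegrable Om F (fun x => enorm (X x)) /\ gintegrable Om F (divg F X);
  adq_fisher : derivable_under_gint (grad_s2 v);
  adq_second_order : forall t : R, 0 < t ->
    let s := s_of v ^~ t in let wt x := v x t `^ (m - 1) in
    [/\ gintegrable Om F (fun x => wt x * dot (grad s x) (grad s x)),
      gintegrable Om F (fun x => wt x * hess_norm2 s x),
      gintegrable Om F (fun x => wt x * lapg F s x ^+ 2),
      gintegrable Om F (fun x => wt x * hess_form F x (grad s x)) &
      gintegrable Om F
        (fun x => wt x * (dot (grad s x) (grad s x) / s x) ^+ 2)]
}.

End solutions.

(* Main.v *)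
(* Write v = s ^ beta and wt = s ^ k = v ^ (m - 1).  Then s_t = m wt (Delta_g s + alpha |Ds|^2 / s),
   so that I' is, up to a factor, - (A + alpha B) with A = int wt (Delta_g s)^2 and
   B = int wt |Ds|^2 / s Delta_g s.  Integrating the divergences
   of wt (Delta_g s Ds - D^2 s Ds) and of wt |Ds|^2 / s Ds gives the Bochner inequality (the
   boundary term has a sign because Om is convex) and the identity B + 2 C + (k - 1) L = 0,
   where L = int wt |Ds|^4 / s^2 and C = int wt / s (D^2 s Ds, Ds).  Testing lambda1 with
   w = s ^ (k / 2) |Ds| controls int wt (D^2 F Ds, Ds), and what is left is a quadratic form in
   (D^2 s, |Ds|^2 / s) whose discriminant is negative exactly on E_theta.  Hence
   A + alpha B >= lambda K + delta L with K = int wt |Ds|^2, and Young's inequality together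
   with the bound on the entropy turns K + L into I ^ (4 / 3).  The estimate on E follows from
   E' = - I by integrating from t to infinity; E tends to 0 because a function s with small
   gradient is close to a constant on an exhaustion of Om by compact convex sets. *)
Require Import Defs.
From mathcomp Require Import all_boot all_order all_algebra.
From mathcomp Require Import all_classical all_reals all_analysis.
From mathcomp Require Import ring lra.
From mathcomp Require Import measurable_realfun.
Set Implicit Arguments.
Unset Strict Implicit.
Unset Printing Implicit Defensive.
Import Order.TTheory GRing.Theory Num.Theory.
Import numFieldNormedType.Exports.
Local Open Scope classical_set_scope.
Local Open Scope ring_scope.

(** * Functions smooth up to the boundary *)

Section directional.
Context {R : realType} {V : normedModType R}.
Implicit Types (U A : set V) (f g : V -> R) (x v w : V).

(** The exponents 1/3 and 4/3 come from the weight: bounding |Ds|^2 by wt |Ds|^2 and wt |Ds|^4 / s^2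
    costs a factor s^2 wt^-3 = v^(p+1-m), and 1 < m < p + 1 keeps it below 1 + v^(m+p-1), whose
    integral the initial entropy controls. Hence a rate that depends on the solution only through
    that entropy. Two obstacles shape the proof. The boundary is only C^1, so there is no second
    fundamental form: the sign of the Bochner flux is read off supporting hyperplanes and
    first-order expansions of Ds up to the boundary. And |Ds| is not differentiable where Ds = 0, so
    the test function for lambda1 is a limit of regularised ones, whose weak gradients rest on the
    weighted Gauss-Green formula. Small gradients make s nearly constant but do not say which
    constant. The mass does: E_theta forces m + p <= 3, so by concavity the integral of
    v^((m+p-1)/2) is at most 1, and this one-sided bound is enough to make the entropy arbitrarily
    small. *)

Lemma is_derive_line f x v r df :
  is_derive (r *: v + x) v f df <->
  is_derive r 1 (fun h : R => f (h *: v + x)) df.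
Proof.
have E : (fun h : R => h^-1 *: (f (h *: v + (r *: v + x)) - f (r *: v + x))) =
         (fun h : R => h^-1 *: ((fun k : R => f (k *: v + x)) (h *: 1 + r)
                             - (fun k : R => f (k *: v + x)) r)).
  by apply/funext => h; rewrite addrA -scalerDl scaler1.
by split=> -[df1 df2]; split; move: df1 df2; rewrite /derivable /derive;
  rewrite -[X in cvg X]/(_ @ _) /= ?E // -?E.
Qed.

Lemma is_derive_comp1 (g : R -> R) f x v dg df :
  is_derive (f x) 1 g dg -> is_derive x v f df ->
  is_derive x v (g \o f) (dg * df).
Proof.
move=> hg hf; have x0 : x = 0 *: v + x by rewrite scale0r add0r.
rewrite x0; apply/is_derive_line.
apply: (@is_derive1_comp _ g (fun h => f (h *: v + x)) 0 dg df).
  by rewrite scale0r add0r.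
by apply/is_derive_line; rewrite -x0.
Qed.

Lemma open_near U x : open U -> U x -> \near x, U x.
Proof. by move=> oU Ux; exact: open_nbhs_nbhs. Qed.

Lemma derive_ext_on U f g v : open U -> {in U, f =1 g} ->
  {in U, 'D_v f =1 'D_v g}.
Proof.
move=> oU fg x; rewrite inE => Ux; apply: near_eq_derive.
by near=> y; apply: fg; rewrite inE; near: y; exact: open_near.
Unshelve. all: by end_near. Qed.

Lemma line_mvt f x v : (forall r : R, 0 <= r <= 1 -> derivable f (r *: v + x) v) ->
  exists2 r : R, 0 < r < 1 & f (v + x) - f x = 'D_v f (r *: v + x).
Proof.
move=> df; set F := fun h : R => f (h *: v + x).
have dF (r : R) : 0 <= r <= 1 -> is_derive r 1 F ('D_v f (r *: v + x)).
  by move=> hr; apply/is_derive_line; apply: derivableP; exact: df.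
have [|//||r] := @MVT R F (fun r => 'D_v f (r *: v + x)) 0 1.
- exact: ltr01.
- by move=> r; rewrite in_itv/= => /andP[r0 r1]; apply: dF; rewrite !ltW.
- apply: derivable_within_continuous => r; rewrite in_itv/= => hr.
  by have [] := dF _ hr.
rewrite in_itv/= => hr; rewrite /F scale1r scale0r add0r subr0 mulr1 => E.
by exists r.
Qed.

End directional.

Section smooth_upto.
Context {R : realType} {V : normedModType R}.
Implicit Types (U A : set V) (f g : V -> R) (x v w : V).

(* Recursive form of Ck_upto, the derivation of order one being performed
   first. *)
Fixpoint smooth_upto U A k f : Prop :=
  [/\ forall x, U x -> {for x, continuous f},
      forall x, A x -> cvg (f @ within U (nbhs x)) &
      if k is k'.+1 then
        forall v, (forall x, U x -> derivable f x v) /\ smooth_upto U A k' ('D_v f)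
      else True].

Lemma iter_derive_rcons vs v f :
  iter_derive (rcons vs v) f = iter_derive vs ('D_v f).
Proof. by rewrite /iter_derive foldr_rcons. Qed.

(** [iter_derive] applies the last direction of the list first, so the recursion peels the list from
    the right, through [rcons]. *)
Lemma Ck_uptoP U A k f : Ck_upto U A k f <-> smooth_upto U A k f.
Proof.
elim: k f => [|k IH] f; split.
- move=> [h1 h2]; split=> //.
    by move=> x Ux; have [] := h1 [::] isT x Ux.
  exact: (h2 [::]).
- move=> [h1 h2 _]; split => -[|//] _ x Ux; last exact: h2.
  by split => //; exact: h1.
- move=> [h1 h2]; split.
  + by move=> x Ux; have [] := h1 [::] isT x Ux.
  + exact: (h2 [::]).
  + move=> v; split.
      by move=> x Ux; have [_] := h1 [::] isT x Ux; exact.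
    apply/IH; split=> vs hvs x Ux.
      have := h1 (rcons vs v); rewrite size_rcons ltnS iter_derive_rcons.
      by move=> /(_ hvs x Ux).
    have := h2 (rcons vs v); rewrite size_rcons ltnS iter_derive_rcons.
    exact.
- move=> [h1 h2 h3]; split=> vs; case/lastP: vs => [|vs v].
  + by move=> _ x Ux; split; [exact: h1|move=> _ v; exact: (h3 v).1].
  + rewrite size_rcons ltnS iter_derive_rcons => hvs x Ux.
    by have /IH[+ _] := (h3 v).2; exact.
  + by move=> _ x Ax; exact: h2.
  + rewrite size_rcons ltnS iter_derive_rcons => hvs x Ux.
    by have /IH[_ +] := (h3 v).2; exact.
Qed.

Lemma smooth_cont U A k f x : smooth_upto U A k f -> U x -> {for x, continuous f}.
Proof. by case: k => [|k] [h _ _]; exact: h. Qed.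

Lemma smooth_trace U A k f x : smooth_upto U A k f -> A x ->
  f @ within U (nbhs x) --> trace U f x.
Proof. by case: k => [|k] [_ h _]; exact: h. Qed.

Lemma smooth_derivable U A k f x v : smooth_upto U A k.+1 f -> U x -> derivable f x v.
Proof. by case=> _ _ /(_ v)[h _] /h. Qed.

Lemma smooth_derive U A k f v : smooth_upto U A k.+1 f -> smooth_upto U A k ('D_v f).
Proof. by case=> _ _ /(_ v)[]. Qed.

Lemma smoothW U A k l f : (l <= k)%N -> smooth_upto U A k f -> smooth_upto U A l f.
Proof.
elim: l k f => [|l IH] [|k] f //; rewrite ?ltnS; first by move=> _ [].
move=> lk [h1 h2 h3]; split => // v; split; first exact: (h3 v).1.
by apply: IH lk _; exact: (h3 v).2.
Qed.

Lemma continuous_ext_on U f g x : open U -> {in U, f =1 g} -> U x ->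
  {for x, continuous f} -> {for x, continuous g}.
Proof.
move=> oU fg Ux; rewrite /prop_for /continuous_at -fg ?inE//.
apply: cvg_trans; apply: near_eq_cvg.
by near=> y; apply: fg; rewrite inE; near: y; exact: open_near.
Unshelve. all: by end_near. Qed.

Lemma smooth_ext U A k f g : open U -> {in U, f =1 g} ->
  smooth_upto U A k f -> smooth_upto U A k g.
Proof.
move=> oU.
have cvgE (f' g' : V -> R) x : {in U, f' =1 g'} ->
    cvg (f' @ within U (nbhs x)) -> cvg (g' @ within U (nbhs x)).
  move=> fg /cvg_ex[l hl]; apply/cvg_ex; exists l.
  by apply: cvg_trans hl; apply: fmap_within_eq => y /fg.
elim: k f g => [|k IH] f g fg [h1 h2 h3]; split=> //;
  try by [move=> x Ux; apply: continuous_ext_on fg _ (h1 x Ux)|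
          move=> x Ax; apply: cvgE fg (h2 x Ax)].
move=> v; have [d1 d2] := h3 v; split; last first.
  by apply: IH d2; exact: derive_ext_on.
move=> x Ux; apply: near_eq_derivable (d1 x Ux).
by near=> y; apply: fg; rewrite inE; near: y; exact: open_near.
Unshelve. all: by end_near. Qed.

Lemma smooth_cst U A k (c : R) : open U -> smooth_upto U A k (cst c).
Proof.
move=> oU; elim: k c => [|k IH] c; split=> //.
- by move=> x _; exact: cvg_cst.
- by move=> x _; exact: is_cvg_cst.
- by move=> x _; exact: cvg_cst.
- by move=> x _; exact: is_cvg_cst.
- move=> v; split; first by move=> x _; exact: derivable_cst.
  by apply: smooth_ext (IH 0) => // x _; rewrite derive_cst.
Qed.

Lemma smoothD U A k f g : open U -> smooth_upto U A k f -> smooth_upto U A k g ->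
  smooth_upto U A k (fun x => f x + g x).
Proof.
move=> oU; elim: k f g => [|k IH] f g [f1 f2 f3] [g1 g2 g3]; split => //;
  try by [move=> x Hx; apply: cvgD; [exact: f1|exact: g1]|
          move=> x Hx; apply: is_cvgD; [exact: f2|exact: g2]].
move=> v; have [df1 df2] := f3 v; have [dg1 dg2] := g3 v; split.
  by move=> x Ux; apply: derivableD; [exact: df1|exact: dg1].
apply: smooth_ext (IH _ _ df2 dg2) => // x; rewrite inE => Ux.
by rewrite -deriveD//; [exact: df1|exact: dg1].
Qed.

Lemma smoothM U A k f g : open U -> smooth_upto U A k f -> smooth_upto U A k g ->
  smooth_upto U A k (fun x => f x * g x).
Proof.
move=> oU; elim: k f g => [|k IH] f g sf sg; have [f1 f2 f3] := sf; have [g1 g2 g3] := sg.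
  split => //; try by [move=> x Hx; apply: cvgM; [exact: f1|exact: g1]|
          move=> x Hx; apply: is_cvgM; [exact: f2|exact: g2]].
split => //; try by [move=> x Hx; apply: cvgM; [exact: f1|exact: g1]|
          move=> x Hx; apply: is_cvgM; [exact: f2|exact: g2]].
move=> v; have [df1 df2] := f3 v; have [dg1 dg2] := g3 v; split.
  by move=> x Ux; apply: derivableM; [exact: df1|exact: dg1].
have := smoothD oU (IH _ _ (smoothW (leqnSn k) sf) dg2) (IH _ _ (smoothW (leqnSn k) sg) df2).
apply: smooth_ext => // x; rewrite inE => Ux.
by rewrite deriveM//; [exact: df1|exact: dg1].
Qed.

Lemma smoothZ U A k c f : open U -> smooth_upto U A k f ->
  smooth_upto U A k (fun x => c * f x).
Proof. by move=> oU sf; apply: smoothM => //; exact: smooth_cst. Qed.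

Lemma smoothN U A k f : open U -> smooth_upto U A k f ->
  smooth_upto U A k (fun x => - f x).
Proof.
move=> oU /(smoothZ (-1) oU); apply: smooth_ext => // x _.
by rewrite mulN1r.
Qed.

Lemma smoothB U A k f g : open U -> smooth_upto U A k f -> smooth_upto U A k g ->
  smooth_upto U A k (fun x => f x - g x).
Proof. by move=> oU sf sg; apply: smoothD => //; exact: smoothN. Qed.

Lemma smooth_sum U A k (I : Type) (r : seq I) (f : I -> V -> R) : open U ->
  (forall i, smooth_upto U A k (f i)) ->
  smooth_upto U A k (fun x => \sum_(i <- r) f i x).
Proof.
move=> oU sf; elim: r => [|i r IH].
  by under eq_fun do rewrite big_nil; exact: smooth_cst.
by under eq_fun do rewrite big_cons; exact: smoothD.
Qed.

(* The closure of G under derivation makes the induction on k go through. *)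
Lemma smooth_comp U A k (G : set (R -> R)) (D : set R) f :
  open U ->
  (forall g : R -> R, G g -> exists2 g', G g' & forall y, D y -> is_derive y 1 g (g' y)) ->
  smooth_upto U A k f -> (forall x, U x -> D (f x)) ->
  (forall x, A x -> D (trace U f x)) ->
  forall g : R -> R, G g -> smooth_upto U A k (g \o f).
Proof.
move=> oU Gd sf fD trD.
have Gc (g : R -> R) y : G g -> D y -> {for y, continuous g}.
  move=> /Gd[g' _ dg] Dy; have [dg1 _] := dg _ Dy.
  by apply: differentiable_continuous; apply/derivable1_diffP.
elim: k f sf fD trD => [|k IH] f sf fD trD g Gg.
  have [f1 f2 _] := sf; split => // x Hx.
    by apply: continuous_comp; [exact: f1|apply: Gc => //; exact: fD].
  apply/cvg_ex; exists (g (trace U f x)).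
  by apply: continuous_cvg; [apply: Gc => //; exact: trD|exact: f2].
have [f1 f2 f3] := sf; split.
- move=> x Hx.
  by apply: continuous_comp; [exact: f1|apply: Gc => //; exact: fD].
- move=> x Hx; apply/cvg_ex; exists (g (trace U f x)).
  by apply: continuous_cvg; [apply: Gc => //; exact: trD|exact: f2].
- move=> v; have [g' Gg' dg] := Gd _ Gg.
  have dgf x : U x -> is_derive x v (g \o f) (g' (f x) * 'D_v f x).
    move=> Ux; apply: is_derive_comp1; first by apply: dg; exact: fD.
    by apply: derivableP; exact: (f3 v).1.
  split; first by move=> x /dgf[].
  have := smoothM oU (IH _ (smoothW (leqnSn k) sf) fD trD g' Gg') (f3 v).2.
  by apply: smooth_ext => // x; rewrite inE => Ux; have [_ ->] := dgf _ Ux.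
Qed.

(** The functions c y^b form a family closed under derivation on y > 0. Positivity of the traces
    keeps the boundary limits inside the region where powers are continuous. *)
Lemma smooth_powR U A k f (a : R) : open U -> smooth_upto U A k f ->
  (forall x, U x -> 0 < f x) -> (forall x, A x -> 0 < trace U f x) ->
  smooth_upto U A k (fun x => f x `^ a).
Proof.
move=> oU sf f0 t0.
pose G := [set g : R -> R | exists c b : R, g = (fun y => c * y `^ b)].
have H := @smooth_comp U A k G [set y | 0 < y] f oU _ sf f0 t0.
apply: (smooth_ext oU _ (H _ (fun y => 1 * y `^ a) _)).
- by move=> x _ /=; rewrite mul1r.
- move=> _ [c [b ->]]; exists (fun y => c * b * y `^ (b - 1)).
    by exists (c * b), (b - 1).
  move=> y /= y0; apply: (@is_derive_eq _ _ _ _ _ _ _ (c *: (b * y `^ (b - 1)))).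
    by apply: is_deriveZ; exact: is_derive1_powR.
  by rewrite /GRing.scale/= mulrA.
- by exists 1, a.
Qed.

Lemma smooth_expR U A k f : open U -> smooth_upto U A k f ->
  smooth_upto U A k (fun x => expR (f x)).
Proof.
move=> oU sf; apply: (@smooth_comp U A k [set expR] setT f oU) => //.
by move=> _ ->; exists expR => // y _; exact: is_derive_expR.
Qed.

End smooth_upto.

(** * Linearity in the direction and symmetry of second derivatives *)

Section derivations.
Context {R : realType} {V : normedModType R}.
Implicit Types (U A : set V) (f g : V -> R) (x v w : V).

Lemma is_derive_shiftl f x v w df :
  is_derive (w + x) v f df -> is_derive x v (fun y => f (w + y)) df.
Proof.
have E : (fun h : R => h^-1 *: (f (h *: v + (w + x)) - f (w + x))) =
         (fun h : R => h^-1 *: ((fun y => f (w + y)) (h *: v + x) - f (w + x))).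
  by apply/funext => h; rewrite addrCA.
by move=> [df1 df2]; split; move: df1 df2; rewrite /derivable /derive /=
  -[X in cvg X]/(_ @ _) E // => _ <-.
Qed.

Lemma is_deriveZdir f x v c df :
  is_derive x v f df -> is_derive x (c *: v) f (c * df).
Proof.
move=> hf; have x0 : x = 0 *: (c *: v) + x by rewrite scale0r add0r.
rewrite [X in is_derive X]x0; apply/(is_derive_line f x (c *: v) 0 (c * df)).
have -> : (fun h : R => f (h *: (c *: v) + x)) =
          (fun h : R => f (h *: v + x)) \o (fun h : R => h * c).
  by apply/funext => h /=; rewrite scalerA.
rewrite mulrC; apply: is_derive1_comp.
  rewrite mul0r; apply/(is_derive_line f x v 0 df).
  by rewrite scale0r add0r.
apply: (@is_derive_eq _ _ _ _ _ _ _ (0 *: (0 : R) + c *: (1 : R))).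
  exact: is_deriveM.
by rewrite scaler0 add0r /GRing.scale/= mulr1.
Qed.

Lemma deriveZdir f x v c : derivable f x v -> 'D_(c *: v) f x = c * 'D_v f x.
Proof. by move=> /derivableP/(@is_deriveZdir _ _ _ c)[_ ->]. Qed.

Lemma near_ball_norm U x : (\near x, U x) ->
  exists2 e : R, 0 < e & forall y, `|y| < e -> U (y + x).
Proof.
move=> /nbhs_normP[e /= e0 He]; exists e => // y ye; apply: He.
by rewrite /= opprD addrC subrK normrN.
Qed.

Lemma near_ball_norm3 (P Q S : set V) x : nbhs x P -> nbhs x Q -> nbhs x S ->
  exists2 e : R, 0 < e & forall y, `|y| < e -> [/\ P (y + x), Q (y + x) & S (y + x)].
Proof.
move=> nP nQ nS; have [e e0 He] := @near_ball_norm (P `&` (Q `&` S)) x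
  (filterI nP (filterI nQ nS)).
by exists e => // y /He[? [? ?]].
Qed.

(** Supplies one step h for which the whole parallelogram spanned by h v and h w fits in a ball of
    radius e. *)
Lemma scaler_bound (e : R) v w : 0 < e ->
  exists2 h : R, 0 < h & forall r r' : R, 0 <= r <= 1 -> 0 <= r' <= 1 ->
    `|r *: (h *: v) + r' *: (h *: w)| < e.
Proof.
move=> e0; set M := `|v| + `|w| + 1.
have M0 : 0 < M by rewrite ltr_wpDl// addr_ge0.
have h0 : 0 < e / (2 * M) by rewrite divr_gt0// mulr_gt0.
exists (e / (2 * M)) => // r r' /andP[r0 r1] /andP[r'0 r'1].
have eE : e = 2 * M * (e / (2 * M)) by rewrite mulrC divfK// mulf_neq0// gt_eqF.
move: h0 eE; move: (e / (2 * M)) => h h0 eE.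
apply: (le_lt_trans (ler_normD _ _)); rewrite !normrZ.
rewrite (ger0_norm r0) (ger0_norm r'0) (@ger0_norm _ h (ltW h0)).
have a1 : r * (h * `|v|) <= h * `|v| by rewrite ler_piMl// mulr_ge0// ltW.
have a2 : r' * (h * `|w|) <= h * `|w| by rewrite ler_piMl// mulr_ge0// ltW.
apply: (le_lt_trans (lerD a1 a2)); rewrite eE -mulrDr mulrC ltr_pM2r//.
by rewrite /M; have := normr_ge0 v; have := normr_ge0 w; lra.
Qed.

Lemma eq_dist_le (l1 l2 : R) :
  (forall e : R, 0 < e -> `|l1 - l2| <= e) -> l1 = l2.
Proof.
move=> H; apply/eqP; rewrite -subr_eq0 -normr_le0; apply/ler_addgt0Pl => e e0.
by rewrite addr0; exact: H.
Qed.

Lemma dist_through (a b c c' k : R) : c = c' ->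
  `|a - c| <= k / 2 -> `|b - c'| <= k / 2 -> `|a - b| <= k.
Proof.
move=> <- h1 h2; rewrite [leRHS]splitr.
by apply: le_trans (lerD h1 h2); rewrite -(distrC c b) ler_distD.
Qed.

(** The increment along h (v + w) is split into a leg along h v and then one along h w. The mean
    value theorem on each leg gives derivatives at nearby points, and these are continuous at x. *)
Lemma deriveDdir U A f x v w : open U -> smooth_upto U A 1 f -> U x ->
  'D_(v + w) f x = 'D_v f x + 'D_w f x.
Proof.
move=> oU sf Ux.
have [dv cv] : (forall y, U y -> derivable f y v) /\ {for x, continuous ('D_v f)}.
  by split=> [y Uy|]; [exact: smooth_derivable sf Uy|apply: smooth_cont (smooth_derive _ sf) Ux].
have [dw cw] : (forall y, U y -> derivable f y w) /\ {for x, continuous ('D_w f)}.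
  by split=> [y Uy|]; [exact: smooth_derivable sf Uy|apply: smooth_cont (smooth_derive _ sf) Ux].
have dvw : derivable f x (v + w) by exact: smooth_derivable sf Ux.
apply: (@cvg_lim _ _ _ (0^') _ (fun h : R => h^-1 *: (f (h *: (v + w) + x) - f x))) => //.
apply/cvgrPdist_le => e e0.
have e20 : 0 < e / 2 by rewrite divr_gt0.
have [d d0 Hd] : exists2 d : R, 0 < d & forall y, `|y| < d ->
    [/\ U (y + x), `|'D_v f x - 'D_v f (y + x)| <= e / 2 &
       `|'D_w f x - 'D_w f (y + x)| <= e / 2].
  have /(_ (nbhs_filter x)) n2 := (cvgrPdist_le _ _).1 cv _ e20.
  have /(_ (nbhs_filter x)) n3 := (cvgrPdist_le _ _).1 cw _ e20.
  exact: near_ball_norm3 (open_near oU Ux) n2 n3.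
have M0 : 0 < `|v| + `|w| + 1 by rewrite ltr_wpDl// addr_ge0.
near=> h; have hn0 : h != 0 by near: h; exact: nbhs_dnbhs_neq.
have small r r' : 0 <= r <= 1 -> 0 <= r' <= 1 ->
    `|r *: (h *: v) + r' *: (h *: w)| < d.
  move=> /andP[r0 r1] /andP[r'0 r'1].
  apply: (@le_lt_trans _ _ (`|h| * (`|v| + `|w| + 1))).
    apply: (le_trans (ler_normD _ _)); rewrite !normrZ.
    rewrite (ger0_norm r0) (ger0_norm r'0).
    have a1 : r * (`|h| * `|v|) <= `|h| * `|v| by rewrite ler_piMl// mulr_ge0.
    have a2 : r' * (`|h| * `|w|) <= `|h| * `|w| by rewrite ler_piMl// mulr_ge0.
    apply: (le_trans (lerD a1 a2)); rewrite -mulrDr ler_wpM2l//.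
    by rewrite lerDl.
  rewrite -ltr_pdivlMr//; near: h; apply: dnbhs0_lt.
  by rewrite divr_gt0.
have [|r /andP[r0 r1] Er] := @line_mvt _ _ f x (h *: v).
  move=> r hr; have := small r 0 hr; rewrite lexx ler01 => /(_ isT).
  rewrite scale0r addr0 => /Hd[Uy _ _].
  by apply: ex_derive; apply: is_deriveZdir; apply: derivableP; exact: dv.
have [|r' /andP[r'0 r'1] Er'] := @line_mvt _ _ f (h *: v + x) (h *: w).
  move=> r' hr; have := small 1 r'; rewrite lexx ler01 => /(_ isT hr).
  rewrite scale1r => /Hd[Uy _ _]; rewrite addrA (addrC (r' *: _)).
  by apply: ex_derive; apply: is_deriveZdir; apply: derivableP; exact: dw.
have -> : f (h *: (v + w) + x) - f x =
    (f (h *: w + (h *: v + x)) - f (h *: v + x)) + (f (h *: v + x) - f x).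
  by rewrite addrA subrK scalerDr addrCA addrA.
rewrite Er Er'.
have := small r 0; rewrite lexx ler01 (ltW r0) (ltW r1) => /(_ isT isT).
rewrite scale0r addr0 => /Hd[Uy hv _].
have := small 1 r'; rewrite lexx ler01 (ltW r'0) (ltW r'1) => /(_ isT isT).
rewrite scale1r => /Hd[]; rewrite (addrC (h *: v)) -addrA => Uz _ hw.
rewrite (deriveZdir _ (dw _ Uz)) (deriveZdir _ (dv _ Uy)).
rewrite -mulrDr /GRing.scale/= mulKf//.
have -> : forall a b c k : R, a + b - (c + k) = (b - c) + (a - k) by move=> *; ring.
rewrite (le_trans (ler_normD _ _))//.
by move: hv hw; set X := `|_|; set Y := `|_|; lra.
Unshelve. all: by end_near. Qed.

(** The mean value theorem is used twice: along v for y |-> f (w + y) - f y, then along w for the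
    derivative of f along v. *)
Lemma second_difference U A f x v w : smooth_upto U A 2 f ->
  (forall r r' : R, 0 <= r <= 1 -> 0 <= r' <= 1 -> U (r *: v + r' *: w + x)) ->
  exists r r' : R, [/\ 0 <= r <= 1, 0 <= r' <= 1 &
    f (v + w + x) - f (w + x) - (f (v + x) - f x) =
      'D_w ('D_v f) (r *: v + r' *: w + x)].
Proof.
move=> sf HU; pose phi y := f (w + y) - f y.
have dphi r : 0 <= r <= 1 -> is_derive (r *: v + x) v phi
    ('D_v f (w + (r *: v + x)) - 'D_v f (r *: v + x)).
  move=> hr; apply: is_deriveB.
    apply: is_derive_shiftl; apply: derivableP; apply: smooth_derivable sf _.
    by rewrite addrA (addrC w) -[X in _ + X + _]scale1r; apply: HU; rewrite ?lexx ?ler01.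
  apply: derivableP; apply: smooth_derivable sf _.
  have := HU r 0 hr; rewrite lexx ler01 => /(_ isT).
  by rewrite scale0r addr0.
have [r hr|r /andP[r0 r1]] := @line_mvt _ _ phi x v; first by have [] := dphi _ hr.
have hr : 0 <= r <= 1 by rewrite !ltW.
have [_ ->] := dphi _ hr => Er.
have [r' hr'|r' /andP[r'0 r'1]] := @line_mvt _ _ ('D_v f) (r *: v + x) w.
  apply: smooth_derivable (smooth_derive v sf) _.
  by rewrite addrA (addrC (r' *: w)); exact: HU.
move=> Er'; have hr' : 0 <= r' <= 1 by rewrite (ltW r'0) (ltW r'1).
exists r, r'; split; [exact: hr|exact: hr'|].
move: Er; rewrite Er' /phi addrA (addrC w) (addrA _ (r *: v)) (addrC (r' *: w)) => <-.
by rewrite opprB addrACA opprB [in RHS]addrACA [- f (w + x) + _]addrC.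
Qed.

(** Schwarz's theorem: the second difference is symmetric in the two directions, so both mixed
    derivatives take a common value at points arbitrarily close to x, and continuity concludes. *)
Lemma derive_sym U A f x v w : open U -> smooth_upto U A 2 f -> U x ->
  'D_v ('D_w f) x = 'D_w ('D_v f) x.
Proof.
move=> oU sf Ux; apply: eq_dist_le => e e0.
have e20 : 0 < e / 2 by rewrite divr_gt0.
have cvw v1 w1 : {for x, continuous ('D_v1 ('D_w1 f))}.
  by apply: smooth_cont (smooth_derive _ (smooth_derive _ sf)) Ux.
have [d d0 Hd] : exists2 d : R, 0 < d & forall y, `|y| < d ->
    [/\ U (y + x), `|'D_v ('D_w f) x - 'D_v ('D_w f) (y + x)| <= e / 2 &
       `|'D_w ('D_v f) x - 'D_w ('D_v f) (y + x)| <= e / 2].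
  have /(_ (nbhs_filter x)) n2 := (cvgrPdist_le _ _).1 (cvw v w) _ e20.
  have /(_ (nbhs_filter x)) n3 := (cvgrPdist_le _ _).1 (cvw w v) _ e20.
  exact: near_ball_norm3 (open_near oU Ux) n2 n3.
have [h h0 small] := scaler_bound v w d0.
have HU r r' : 0 <= r <= 1 -> 0 <= r' <= 1 -> U (r *: (h *: v) + r' *: (h *: w) + x).
  by move=> hr hr'; have [] := Hd _ (small _ _ hr hr').
have HU' r r' : 0 <= r <= 1 -> 0 <= r' <= 1 -> U (r *: (h *: w) + r' *: (h *: v) + x).
  by move=> hr hr'; rewrite (addrC (r *: _)); exact: HU.
have ZZ v1 w1 y : U y -> 'D_(h *: w1) ('D_(h *: v1) f) y = h * (h * 'D_w1 ('D_v1 f) y).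
  move=> Uy; have E : {in U, 'D_(h *: v1) f =1 (fun z => h *: 'D_v1 f z)}.
    move=> z; rewrite inE => Uz.
    by rewrite (deriveZdir _ (smooth_derivable sf Uz)).
  rewrite (derive_ext_on _ oU E) ?inE//.
  have dd : derivable ('D_v1 f) y w1.
    by apply: smooth_derivable (smooth_derive v1 sf) Uy.
  rewrite deriveZdir; last by apply: derivableZ; exact: dd.
  by rewrite deriveZ; [|exact: dd].
have [r [r' [hr hr' E1]]] := second_difference sf HU.
have [q [q' [hq hq' E2]]] := second_difference sf HU'.
have E : 'D_v ('D_w f) (q *: (h *: w) + q' *: (h *: v) + x) =
         'D_w ('D_v f) (r *: (h *: v) + r' *: (h *: w) + x).
  have hn0 : h != 0 by rewrite gt_eqF.
  apply: (mulfI hn0); apply: (mulfI hn0).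
  have sw (a b c k : R) : a - b - (c - k) = a - c - (b - k) by ring.
  have e21 : f (h *: w + h *: v + x) - f (h *: v + x) - (f (h *: w + x) - f x) =
      f (h *: v + h *: w + x) - f (h *: w + x) - (f (h *: v + x) - f x).
    by rewrite (addrC (h *: w) (h *: v)); exact: sw.
  have Z1 := ZZ v w _ (HU _ _ hr hr').
  have Z2 := ZZ w v _ (HU' _ _ hq hq').
  exact: (etrans (esym Z2) (etrans (esym E2) (etrans e21 (etrans E1 Z1)))).
have [_ hA _] := Hd _ (small q' q hq' hq).
have [_ _ hB] := Hd _ (small r r' hr hr').
rewrite (addrC (q *: _)) in E.
exact: (dist_through E hA hB).
Unshelve. all: by end_near. Qed.

End derivations.

Section rows.
Context {R : realType} {d : nat}.
Implicit Types (U A : set 'rV[R]_d) (f g : 'rV[R]_d -> R) (x v w : 'rV[R]_d).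

Lemma derive_dot_grad U A f x v : open U -> smooth_upto U A 1 f -> U x ->
  'D_v f x = dot v (grad f x).
Proof.
move=> oU sf Ux; rewrite [in LHS](row_sum_delta v) /dot.
under [RHS]eq_bigr do rewrite mxE.
elim/big_rec2 : _ => [|i y1 y2 _ E]; first by rewrite derive0.
by rewrite (deriveDdir _ _ oU sf Ux) E (deriveZdir _ (smooth_derivable sf Ux)).
Qed.

End rows.

(** * Time slices of functions that are smooth in space-time *)

Section slices.
Context {R : realType} {V : normedModType R}.
Variables (U A : set V) (T : set R).
Implicit Types (f : V * R -> R) (x v : V) (t : R).

Lemma slice_quotient f x t v :
  (fun h : R => h^-1 *: (((fun y => f (y, t)) \o shift x) (h *: v) - f (x, t))) =
  (fun h : R => h^-1 *: ((f \o shift (x, t)) (h *: (v, 0)) - f (x, t))).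
Proof.
apply/funext => h /=; congr (_ *: (f _ - _)).
by rewrite -[RHS]/(h *: v + x, h *: 0 + t) scaler0 add0r.
Qed.

Lemma slice_derive f x t v : 'D_v (fun y => f (y, t)) x = 'D_((v, 0) : V * R) f (x, t).
Proof. by rewrite /derive slice_quotient. Qed.

Lemma slice_derivable f x t v : derivable f (x, t) (v, 0) ->
  derivable (fun y => f (y, t)) x v.
Proof. by rewrite /derivable slice_quotient. Qed.

Lemma time_quotient f x t :
  (fun h : R => h^-1 *: (((fun r => f (x, r)) \o shift t) (h *: 1) - f (x, t))) =
  (fun h : R => h^-1 *: ((f \o shift (x, t)) (h *: (0, 1)) - f (x, t))).
Proof.
apply/funext => h /=; congr (_ *: (f _ - _)).
by rewrite -[RHS]/(h *: 0 + x, h *: 1 + t) scaler0 add0r.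
Qed.

Lemma time_derive f x t : 'D_1 (fun r => f (x, r)) t = 'D_((0, 1) : V * R) f (x, t).
Proof. by rewrite /derive time_quotient. Qed.

Lemma time_derivable f x t : derivable f (x, t) (0, 1) ->
  derivable (fun r => f (x, r)) t 1.
Proof. by rewrite /derivable time_quotient. Qed.

Lemma slice_cvg (t : R) x : T t ->
  (fun y => (y, t)) @ within U (nbhs x) --> within (U `*` T) (nbhs (x, t)).
Proof.
move=> Tt S; rewrite /= !nbhs_simpl/= => -[[B1 B2] /= [n1 n2] BS].
rewrite /within/=; apply: filterS n1 => y By Uy; apply: BS => //=.
by split => //; exact: nbhs_singleton n2.
Qed.

Lemma slice_lim f (l : R) x t : T t -> f @ within (U `*` T) (nbhs (x, t)) --> l ->
  (fun y => f (y, t)) @ within U (nbhs x) --> l.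
Proof. by move=> Tt h S nS; exact: (slice_cvg Tt (h S nS)). Qed.

Lemma slice_cont f x t : {for (x, t), continuous f} ->
  {for x, continuous (fun y => f (y, t))}.
Proof.
move=> cf; apply: (@continuous_comp _ _ _ (fun y => (y, t)) f); last exact: cf.
move=> S [[B1 B2] /= [n1 n2] BS]; apply: filterS n1 => y By; apply: BS; split => //=.
exact: nbhs_singleton n2.
Qed.

Lemma smooth_slice k f t : open U -> T t -> smooth_upto (U `*` T) (A `*` T) k f ->
  smooth_upto U A k (fun x => f (x, t)).
Proof.
move=> oU Tt; elim: k f => [|k IH] f [h1 h2 h3]; split => //.
- by move=> x Ux; apply: slice_cont; exact: h1.
- move=> x Ax; have [//|l hl] := (cvg_ex _).1 (h2 (x, t) _).
  by apply/cvg_ex; exists l; exact: slice_lim hl.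
- by move=> x Ux; apply: slice_cont; exact: h1.
- move=> x Ax; have [//|l hl] := (cvg_ex _).1 (h2 (x, t) _).
  by apply/cvg_ex; exists l; exact: slice_lim hl.
- move=> v; have [h4 h5] := h3 (v, 0); split.
    by move=> x Ux; apply: slice_derivable; exact: h4.
  by apply: (smooth_ext oU _ (IH _ h5)) => x _; rewrite slice_derive.
Qed.

End slices.

(** * Lebesgue measure on row vectors *)

Section rV_norm.
Context {R : realType} {n : nat}.
Implicit Types x y : 'rV[R]_n.

Lemma rV_norm_lt x (e : R) : 0 < e -> (forall i, `|x 0 i| < e) -> `|x| < e.
Proof.
move=> e0 H; rewrite /Num.Def.normr/= mx_normrE; apply/bigmax_ltP; split => //= -[i j] _ /=.
by rewrite ord1.
Qed.

Lemma rV_norm_le x (e : R) : 0 <= e -> (forall i, `|x 0 i| <= e) -> `|x| <= e.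
Proof.
move=> e0 H; rewrite /Num.Def.normr/= mx_normrE; apply/bigmax_leP; split => //= -[i j] _ /=.
by rewrite ord1.
Qed.

Lemma rV_coord_le_norm x i : `|x 0 i| <= `|x|.
Proof.
rewrite [leRHS]/Num.Def.normr/= mx_normrE.
by apply: (@le_bigmax _ _ _ _ (fun ij => `|x ij.1 ij.2|) (0, i)).
Qed.

End rV_norm.

Section rV_open_measurable.
Context {R : realType} {n : nat}.
Implicit Types (U D : set 'rV[R]_n).

Let box (q : 'rV[rat]_n * nat) : set 'rV[R]_n :=
  [set x | forall i, `|x 0 i - ratr (q.1 0 i)| < q.2.+1%:R^-1].

Let measurable_box q : measurable (box q).
Proof.
have -> : box q = \bigcap_(i in [set: 'I_n])
    (@rV_coord _ R n i @^-1` [set r | `|r - ratr (q.1 0 i)| < q.2.+1%:R^-1]).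
  by apply/seteqP; split=> [x + i _|x + i] => /(_ i) H; apply: H.
apply: fin_bigcap_measurable => // i _.
rewrite -[X in measurable X]setTI; apply: measurable_rV_coord => //.
have -> : [set r : R | `|r - ratr (q.1 0 i)| < q.2.+1%:R^-1] =
    ball (ratr (q.1 0 i) : R) (q.2.+1%:R^-1).
  by apply/seteqP; split => r /=; rewrite /ball/= distrC.
by apply: measurable_realfun.open_measurable; exact: ball_open.
Qed.

(** An open set is the union of the rational cubes that it contains. The union is indexed by codes
    through [pickle], a code of any other cube contributing the empty set. *)
Lemma rV_open_measurable U : open U -> measurable U.
Proof.
move=> oU; pose B (k : nat) := if unpickle k is Some q then
  (if `[< box q `<=` U >] then box q else set0) else set0.
have -> : U = \bigcup_k B k.
  apply/seteqP; split => [x Ux|x [k _]]; last first.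
    by rewrite /B; case: unpickle => // q; case: asboolP => // h; exact: h.
  have [e e0 He] := near_ball_norm (open_near oU Ux).
  (* Half of e, because a point of the cube and x are each within 1 / (k + 1) of its centre. *)
  have [k /= hk] := @ltr_add_invr _ 0 (e / 2) (divr_gt0 e0 (@ltr0Sn _ 1)).
  rewrite add0r in hk.
  have [q hq] : exists q : 'I_n -> rat, forall i, `|x 0 i - ratr (q i)| < k.+1%:R^-1.
    have /choice[q hq] : forall i, exists q : rat, `|x 0 i - ratr q| < k.+1%:R^-1.
      move=> i; have xl : x 0 i - k.+1%:R^-1 < x 0 i + k.+1%:R^-1.
        by rewrite ltrD2l gtrN.
      have [q] := rat_in_itvoo xl; rewrite in_itv/= => hq.
      by exists q; rewrite distrC ltr_distl.
    by exists q.
  exists (pickle (\row_i q i, k)) => //; rewrite /B pickleK.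
  have hb : box (\row_i q i, k) `<=` U.
    move=> y hy; rewrite -(subrK x y); apply: He.
    apply: rV_norm_lt => // i; rewrite !mxE.
    have := hy i; have := hq i; rewrite /= mxE.
    set a := _^-1 in hk *; move=> h1 h2.
    have -> : y 0 i - x 0 i = (y 0 i - ratr (q i)) - (x 0 i - ratr (q i)) by ring.
    apply: (le_lt_trans (ler_normB _ _)); rewrite (splitr e).
    by apply: ltrD; exact: lt_trans hk.
  by case: asboolP => // _ i; rewrite /= mxE; exact: hq.
apply: bigcupT_measurable => k; rewrite /B; case: unpickle => // q.
by case: asboolP => // _; exact: measurable_box.
Qed.

Lemma rV_closed_measurable U : closed U -> measurable U.
Proof. by move/closed_openC/rV_open_measurable/measurableC; rewrite setCK. Qed.

Lemma open_continuous_measurable_rV U (f : 'rV[R]_n -> R) : open U ->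
  (forall x, U x -> {for x, continuous f}) -> measurable_fun U f.
Proof.
move=> oU cf; apply: (measurability _ (@measurable_realfun.RGenOpens.measurableE R)).
move=> _ [_ [a [b ->] <-]]; apply: rV_open_measurable.
rewrite openE => x [Ux fx]; apply: filterI; first exact: open_nbhs_nbhs.
by apply: cf => //; apply: open_nbhs_nbhs; split; [exact: interval_open|exact: fx].
Qed.

End rV_open_measurable.

Section lebesgue_rV_theory.
Context {R : realType}.

(** The image of Lebesgue measure under a translation agrees with it on half-open intervals, which
    determine it. *)
Lemma lebesgue_measure_translation (h : R) (A : set R) : measurable A ->
  lebesgue_measure ((fun x : R => x + h) @^-1` A) = lebesgue_measure A.
Proof.
move=> mA; have mh : measurable_fun setT (fun x : measurableTypeR R => (x + h : measurableTypeR R)).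
  by apply: measurable_funD => //; exact: measurable_cst.
pose mu : {measure set (measurableTypeR R) -> \bar R} :=
  measure_function_pushforward__canonical__measure_function_Measure
    (@lebesgue_measure R) mh.
rewrite -[LHS]/(mu A); apply/esym/lebesgue_measure_unique => // _ [[a b]] _ <-.
rewrite /mu/= /pushforward.
have -> : (fun x : R => x + h) @^-1` `]a, b] = `]a - h, b - h]%classic.
  by apply/seteqP; split => x /=; rewrite !in_itv/= ltrBlDr lerBrDr.
rewrite !lebesgue_measure_itv/= !lte_fin ltrD2r.
by rewrite !EFinB; case: ifP => // _; rewrite -!EFinB; congr EFin; ring.
Qed.

Lemma measurable_rV_shift n (h : 'rV[R]_n) :
  measurable_fun setT (fun x : 'rV[R]_n => x + h).
Proof.
apply: measurable_fun_rVP => i; under eq_fun do rewrite mxE.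
by apply: measurable_funD; [exact: measurable_rV_coord|exact: measurable_cst].
Qed.

Lemma lebesgue_rVS n (A : set 'rV[R]_n.+1) :
  lebesgue_rV n.+1 A =
  (\int[lebesgue_measure]_x lebesgue_rV n [set y | A (rV_cons (x, y))])%E.
Proof.
rewrite /= /lebesgue_rV_succ /pushforward /product_measure1.
apply: eq_integral => x _ /=; congr (lebesgue_rV n _).
by apply/seteqP; split => y /=; rewrite /xsection/= inE.
Qed.

(** Slicing along the first coordinate: the induction hypothesis absorbs the shift inside each
    slice, and invariance on the line absorbs the shift of the slices. *)
Lemma lebesgue_rV_translation n (h : 'rV[R]_n) (A : set 'rV[R]_n) :
  measurable A -> lebesgue_rV n ((fun x => x + h) @^-1` A) = lebesgue_rV n A.
Proof.
elim: n h A => [|n IH] h A mA.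
  suff -> : (fun x : 'rV_0 => x + h) = id by rewrite preimage_id.
  by apply/funext => x; apply/rowP => -[].
pose h0 := h 0 0; pose h' := \row_i h 0 (lift ord0 i).
have mS (x : R) : measurable [set y | A (rV_cons (x, y))].
  have mc : measurable_fun setT (fun y : 'rV[R]_n => rV_cons (x, y)).
    apply: measurableT_comp; first exact: measurable_rV_cons.
    by apply: measurable_fun_pair; [exact: measurable_cst|exact: measurable_id].
  by rewrite -[X in measurable X]setTI; exact: mc.
pose phi (x : R) := lebesgue_rV n [set y | A (rV_cons (x, y))].
have mphi : measurable_fun setT phi.
  have mp : measurable (rV_cons @^-1` A).
    by rewrite -[X in measurable X]setTI; exact: measurable_rV_cons.
  have := measurable_fun_xsection (lebesgue_rV n) mp.
  congr (measurable_fun _ _); apply/funext => x /=; congr (lebesgue_rV n _).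
  by apply/seteqP; split => y /=; rewrite /xsection/= inE.
rewrite !lebesgue_rVS.
transitivity (\int[lebesgue_measure]_x phi (x + h0)%R)%E.
  apply: eq_integral => x _; rewrite /phi -(IH h' _ (mS (x + h0))).
  congr (lebesgue_rV n _); apply/funext => y /=; congr (A _).
  apply/rowP => i; rewrite !mxE; case: (unliftP ord0 i) => [j|] -> //=.
  by rewrite !mxE.
have mh : measurable_fun setT (fun x : measurableTypeR R => (x + h0 : measurableTypeR R)).
  by apply: measurable_funD => //; exact: measurable_cst.
rewrite -[LHS]/(\int[lebesgue_measure]_(x in (fun x : R => (x + h0)%R) @^-1` setT)
   (phi \o (fun x : R => x + h0)%R) x)%E.
rewrite -(ge0_integral_pushforward mh)//.
by apply: eq_measure_integral => B mB _; rewrite /pushforward /=; exact: lebesgue_measure_translation.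
Qed.

Lemma ge0_integral_rV_translation n (h : 'rV[R]_n) (f : 'rV[R]_n -> \bar R) :
  measurable_fun setT f -> (forall x, 0 <= f x)%E ->
  (\int[lebesgue_rV n]_x f (x + h)%R = \int[lebesgue_rV n]_x f x)%E.
Proof.
move=> mf f0.
rewrite -[LHS]/(\int[lebesgue_rV n]_(x in (fun x => (x + h)%R) @^-1` setT)
   (f \o (fun x => x + h)%R) x)%E.
rewrite -(ge0_integral_pushforward (measurable_rV_shift h) (lebesgue_rV n)
  measurableT mf (fun y _ => f0 y)).
apply: eq_measure_integral; first exact: measurable_rV_shift.
by move=> mh B mB _; exact: lebesgue_rV_translation.
Qed.

Definition rV_cube n (M : R) : set 'rV[R]_n := [set x | forall i, `|x 0 i| <= M].
Arguments rV_cube : clear implicits.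

Lemma closed_rV_cube n (M : R) : closed (rV_cube n M).
Proof.
have -> : rV_cube n M = \bigcap_(i in [set: 'I_n])
    ((fun x : 'rV[R]_n => `|x 0 i|) @^-1` [set r | r <= M]).
  by apply/seteqP; split=> [x + i _|x + i] => /(_ i) H; apply: H.
apply: closed_bigI => i _; apply: closed_comp; last exact: closed_le.
move=> x _; apply: continuous_comp; last exact: norm_continuous.
exact: coord_continuous.
Qed.

Lemma lebesgue_rV_cube n (M : R) : (lebesgue_rV n (rV_cube n M) < +oo)%E.
Proof.
elim: n => [|n IH]; first by rewrite /= diracE ltry.
have -> : lebesgue_rV n.+1 (rV_cube n.+1 M) =
   (\int[lebesgue_measure]_(x in `[(- M)%R, M]) lebesgue_rV n (rV_cube n M))%E.
  rewrite lebesgue_rVS [RHS]integral_mkcond; apply: eq_integral => x _.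
  rewrite patchE mem_setE /= in_itv/= -ler_norml.
  case: ifPn => xM.
    congr (lebesgue_rV n _); apply/seteqP; split => y /= H i.
      by have := H (lift ord0 i); rewrite rV_consES.
    by case: (unliftP ord0 i) => [j|] ->; rewrite ?rV_consES ?rV_consE0.
  rewrite (_ : [set y | _] = set0) ?measure0//.
  apply/seteqP; split => // y /= /(_ ord0); rewrite rV_consE0/=.
  by rewrite (negbTE xM).
rewrite integral_cst//= lebesgue_measure_itv/=.
by case: ifP => _; rewrite ?mule0 ?ltry// lte_mul_pinfty ?ltry// ge0_fin_numE.
Qed.

End lebesgue_rV_theory.
Arguments rV_cube {R} n M.

(** * Poincare inequality on convex sets *)

Section dot_theory.
Context {R : realType} {n : nat}.
Implicit Types x y z : 'rV[R]_n.

Lemma dotC x y : dot x y = dot y x.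
Proof. by apply: eq_bigr => i _; rewrite mulrC. Qed.

Lemma dotDl x y z : dot (x + y) z = dot x z + dot y z.
Proof. by rewrite -big_split/=; apply: eq_bigr => i _; rewrite mxE mulrDl. Qed.

Lemma dotZl (a : R) x y : dot (a *: x) y = a * dot x y.
Proof. by rewrite /dot mulr_sumr; apply: eq_bigr => i _; rewrite mxE mulrA. Qed.

Lemma dotNl x y : dot (- x) y = - dot x y.
Proof. by rewrite -scaleN1r dotZl mulN1r. Qed.

Lemma dotBl x y z : dot (x - y) z = dot x z - dot y z.
Proof. by rewrite dotDl dotNl. Qed.

Lemma dotDr x y z : dot z (x + y) = dot z x + dot z y.
Proof. by rewrite dotC dotDl !(dotC z). Qed.

Lemma dotZr (a : R) x y : dot x (a *: y) = a * dot x y.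
Proof. by rewrite dotC dotZl dotC. Qed.

Lemma dotNr x y : dot x (- y) = - dot x y.
Proof. by rewrite dotC dotNl dotC. Qed.

Lemma dotBr x y z : dot z (x - y) = dot z x - dot z y.
Proof. by rewrite dotDr dotNr. Qed.

Lemma dot0l x : dot 0 x = 0.
Proof. by rewrite -(scale0r x) dotZl mul0r. Qed.

Lemma dot_ge0 x : 0 <= dot x x.
Proof. by apply: sumr_ge0 => i _; rewrite -expr2 sqr_ge0. Qed.

Lemma dot_eq0 x : (dot x x == 0) = (x == 0).
Proof.
apply/idP/idP => [|/eqP ->]; last by rewrite dot0l.
rewrite psumr_eq0 => [/allP H|i _]; last by rewrite -expr2 sqr_ge0.
apply/eqP/rowP => i; rewrite mxE; apply/eqP.
by have := H i; rewrite mem_index_enum /= mulf_eq0 orbb; apply.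
Qed.

Lemma dot_CS x y : dot x y ^+ 2 <= dot x x * dot y y.
Proof.
have [->|y0] := eqVneq y 0; first by rewrite dotC dot0l expr0n/= dot0l mulr0.
have yy : 0 < dot y y by rewrite lt_neqAle dot_ge0 eq_sym dot_eq0 y0.
rewrite -subr_ge0 -(pmulr_rge0 _ yy).
apply: le_trans (dot_ge0 (dot y y *: x - dot x y *: y)) _.
rewrite !(dotBl, dotBr, dotZl, dotZr) (dotC y x) le_eqVlt.
by apply/orP; left; apply/eqP; ring.
Qed.

Lemma dot_le_cube (M : R) x : rV_cube n M x -> dot x x <= n%:R * M ^+ 2.
Proof.
move=> H; rewrite mulr_natl -[X in _ *+ X]card_ord -sumr_const.
apply: ler_sum => i _; rewrite -expr2 -[leLHS]real_normK ?num_real//.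
by rewrite ler_sqr ?nnegrE// (le_trans _ (H i)).
Qed.

End dot_theory.

Section measurable_rV_ops.
Context {R : realType} {n : nat} {d} {T : measurableType d}.

Lemma measurable_rVD (f g : T -> 'rV[R]_n) : measurable_fun setT f ->
  measurable_fun setT g -> measurable_fun setT (fun x => f x + g x).
Proof.
move=> mf mg; apply: measurable_fun_rVP => i; under eq_fun do rewrite mxE.
by apply: measurable_funD; apply: (measurableT_comp (measurable_rV_coord i)).
Qed.

Lemma measurable_rVZ (f : T -> R) (h : 'rV[R]_n) : measurable_fun setT f ->
  measurable_fun setT (fun x => f x *: h).
Proof.
move=> mf; apply: measurable_fun_rVP => i; under eq_fun do rewrite mxE.
by apply: measurable_funM => //; exact: measurable_cst.
Qed.

End measurable_rV_ops.

Section segment.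
Context {R : realType}.
Local Notation mu := (@lebesgue_measure R).

(** Cauchy-Schwarz on [0, 1], obtained by integrating 2 c f' - c^2 <= f'^2 for the constant c = f 1
    - f 0. *)
Lemma sqr_increment_le (f df : R -> R) :
  (forall r : R, 0 <= r <= 1 -> is_derive r 1 f (df r)) ->
  {within `[0%R, 1%R], continuous df} ->
  (((f 1 - f 0)%R ^+ 2)%:E <= \int[mu]_(r in `[0%R, 1%R]) (df r ^+ 2)%:E)%E.
Proof.
move=> hf cdf; set c := f 1 - f 0.
have cf (r : R) : 0 <= r <= 1 -> {for r, continuous f}.
  by move=> /hf[+ _] => /derivable1_diffP/differentiable_continuous.
have ftc : (\int[mu]_(r in `[0%R, 1%R]) (df r)%:E = c%:E)%E.
  rewrite (@continuous_FTC2 _ df f) ?EFinB//.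
  - split.
    + by move=> r; rewrite in_itv/= => /andP[r0 r1]; have [] := hf r; rewrite ?ltW.
    + by apply: cvg_at_right_filter; apply: cf; rewrite lexx ler01.
    + by apply: cvg_at_left_filter; apply: cf; rewrite lexx ler01.
  - move=> r; rewrite in_itv/= => /andP[r0 r1].
    by have [] := hf r; rewrite ?ltW// => _ <-; rewrite derive1E.
have cI : compact `[0 : R, 1] by exact: segment_compact.
have i1 : mu.-integrable `[0, 1] (EFin \o df).
  exact: continuous_compact_integrable.
have i2 : mu.-integrable `[0, 1] (EFin \o (fun r => df r ^+ 2)).
  apply: continuous_compact_integrable => // r.
  under [X in continuous_at _ X]eq_fun do rewrite expr2.
  by apply: cvgM; exact: cdf.
have i0 : mu.-integrable `[0, 1] (EFin \o cst (c ^+ 2)).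
  by apply: continuous_compact_integrable => // r; exact: cvg_cst.
have ic : (\int[mu]_(r in `[0%R, 1%R]) (c ^+ 2)%:E = (c ^+ 2)%:E)%E.
  by rewrite integral_cst//= lebesgue_measure_itv/= lte_fin ltr01 -EFinB subr0 mule1.
have e1 : (\int[mu]_(r in `[0%R, 1%R]) (2 * c * df r - c ^+ 2)%:E = (c ^+ 2)%:E)%E.
  under eq_integral do rewrite EFinB EFinM.
  rewrite integralB//; last exact: integrableZl.
  rewrite integralZl// ftc ic -EFinM -EFinB.
  by congr EFin; ring.
rewrite -e1; apply: le_integral => //.
  have : mu.-integrable `[0, 1] (EFin \o (fun r => 2 * c * df r - c ^+ 2)).
    apply: continuous_compact_integrable => // r; apply: cvgB; last exact: cvg_cst.
    by apply: cvgM; [exact: cvg_cst|exact: cdf].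
  exact.
move=> r _ /=; rewrite lee_fin -subr_ge0.
have -> : df r ^+ 2 - (2 * c * df r - c ^+ 2) = (df r - c) ^+ 2 by ring.
exact: sqr_ge0.
Qed.

End segment.

Section poincare.
Context {R : realType} {n : nat}.
Implicit Types (U K A : set 'rV[R]_n).
Local Notation mu := (@lebesgue_rV R n).
Local Notation leb := (@lebesgue_measure R).

Lemma segment_energy U A (u : 'rV[R]_n -> R) y h : open U -> smooth_upto U A 1 u ->
  (forall r : R, 0 <= r <= 1 -> U (r *: h + y)) ->
  (((u (h + y) - u y) ^+ 2)%:E <=
    \int[leb]_(r in `[0%R, 1%R])
      (dot h h * dot (grad u (r *: h + y)) (grad u (r *: h + y)))%:E)%E.
Proof.
move=> oU su HU.
have hd (r : R) : 0 <= r <= 1 -> is_derive r 1 (fun r : R => u (r *: h + y))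
    ('D_h u (r *: h + y)).
  move=> hr; apply: (is_derive_line u y h r _).1; apply: derivableP.
  by apply: smooth_derivable su _; exact: HU.
have cl (r : R) : {for r, continuous (fun r : R => r *: h + y)}.
  by apply: cvgD; [exact: scalel_continuous|exact: cvg_cst].
have cD (w : 'rV[R]_n) (r : R) : 0 <= r <= 1 ->
    {for r, continuous (fun r : R => 'D_w u (r *: h + y))}.
  move=> hr; apply: (@continuous_comp _ _ _ (fun r : R => r *: h + y) ('D_w u)).
    exact: cl.
  by apply: smooth_cont (smooth_derive w su) _; exact: HU.
have cDw (w : 'rV[R]_n) : {within `[0, 1], continuous (fun r : R => 'D_w u (r *: h + y))}.
  apply: continuous_in_subspaceT => r; rewrite inE/= in_itv/= => hr; exact: cD.
have := @sqr_increment_le R (fun r : R => u (r *: h + y)) _ hd (cDw h).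
rewrite scale1r scale0r add0r => /le_trans; apply.
apply: ge0_le_integral => //.
- by move=> r _; rewrite lee_fin sqr_ge0.
- apply/measurable_EFinP; apply: measurable_funX.
  by apply: subspace_continuous_measurable_fun => //; exact: cDw.
- apply/measurable_EFinP; apply: measurable_funM; first exact: measurable_cst.
  apply: measurable_sum => i.
  have mg : measurable_fun (`[0%R, 1%R]%classic : set (measurableTypeR R))
      (fun r : R => grad u (r *: h + y) 0 i).
    have -> : (fun r : R => grad u (r *: h + y) 0 i) =
        (fun r : R => 'D_(delta_mx 0 i) u (r *: h + y)).
      by apply/funext => r; rewrite mxE.
    by apply: subspace_continuous_measurable_fun => //; exact: cDw.
  exact: measurable_funM.
- move=> r; rewrite /= in_itv/= => hr; rewrite lee_fin.
  by rewrite (derive_dot_grad _ oU su (HU _ hr)); exact: dot_CS.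
Qed.

(** With x = h + y, the increment of u is bounded by the energy on the segment from y to h + y,
    which convexity keeps inside K. Integrating in y first removes the position on the segment by
    translation invariance. The vectors h that occur lie in the cube of half-side 2 M, which gives
    the constant. *)
Lemma poincare_convex U A K (u : 'rV[R]_n -> R) (M : R) : open U ->
  smooth_upto U A 1 u -> K `<=` U -> measurable K -> K `<=` rV_cube n M ->
  (forall x y (r : R), K x -> K y -> 0 <= r <= 1 -> K (r *: (x - y) + y)) ->
  (\int[mu]_(y in K) \int[mu]_(x in K) ((u x - u y) ^+ 2)%:E <=
   (n%:R * (2 * M) ^+ 2)%:E * mu (rV_cube n (2 * M)) *
   \int[mu]_(x in K) (dot (grad u x) (grad u x))%:E)%E.
Proof.
move=> oU su KU mK KM Kc.
pose w := u \_ K.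
have mu_ : measurable_fun K u.
  apply: (measurable_funS (rV_open_measurable oU) KU).
  by apply: open_continuous_measurable_rV => // x; exact: (smooth_cont su).
have mw : measurable_fun setT w by exact/(measurable_restrictT _ mK).
have m1 : measurable_fun setT (\1_K : 'rV[R]_n -> R) by exact: measurable_indic.
(* The indicators extend all integrands by zero to the whole space, where translation invariance
   applies. *)
pose G (p : 'rV[R]_n * 'rV[R]_n) : \bar R :=
  (\1_K p.1 * \1_K p.2 * (w p.1 - w p.2) ^+ 2)%:E.
have G0 p : (0 <= G p)%E by rewrite lee_fin mulr_ge0 ?sqr_ge0// mulr_ge0.
have mG : measurable_fun setT G.
  apply/measurable_EFinP; apply: measurable_funM.
    by apply: measurable_funM; apply: measurableT_comp.
  by apply: measurable_funX; apply: measurable_funB; apply: measurableT_comp.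
pose e (x : 'rV[R]_n) : R := \1_K x * dot (((grad u) \_ K) x) (((grad u) \_ K) x).
have me : measurable_fun setT e.
  apply: measurable_funM => //; apply: measurable_sum => i.
  suff : measurable_fun setT (fun x => ((grad u) \_ K) x 0 i).
    by move=> h; apply: measurable_funM.
  have -> : (fun x => ((grad u) \_ K) x 0 i) = (partial i u) \_ K.
    by apply/funext => x; rewrite !patchE; case: ifP => _; rewrite mxE.
  apply/(measurable_restrictT _ mK); apply: (measurable_funS (rV_open_measurable oU) KU).
  apply: open_continuous_measurable_rV => // x; apply: smooth_cont.
  exact: smooth_derive su.
have e0 x : 0 <= e x by rewrite mulr_ge0// dot_ge0.
have -> : (\int[mu]_(y in K) \int[mu]_(x in K) ((u x - u y) ^+ 2)%:E =
    \int[mu]_y \int[mu]_x G (x, y))%E.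
  rewrite integral_mkcond; apply: eq_integral => y _; rewrite patchE.
  case: ifPn => yK; last first.
    by rewrite integral0_eq// => x _; rewrite /G/= [\1_K y]indicE (negbTE yK) mulr0 mul0r.
  rewrite integral_mkcond; apply: eq_integral => x _; rewrite patchE /G/= !indicE yK.
  by case: ifPn => xK; rewrite ?mul0r// !mul1r /w !patchE xK yK.
have -> : (\int[mu]_(x in K) (dot (grad u x) (grad u x))%:E = \int[mu]_x (e x)%:E)%E.
  rewrite integral_mkcond; apply: eq_integral => x _; rewrite patchE /e indicE !patchE.
  by case: ifPn => xK; rewrite ?mul0r// mul1r.
have -> : (\int[mu]_y \int[mu]_x G (x, y) = \int[mu]_y \int[mu]_h G (h + y, y)%R)%E.
  apply: eq_integral => y _.
  rewrite (@ge0_integral_rV_translation R n y (fun x => G (x, y)))//.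
  by apply: measurableT_comp mG _; apply: measurable_fun_pair.
have mGs : measurable_fun setT (fun p : 'rV[R]_n * 'rV[R]_n => G (p.1 + p.2, p.2)%R).
  apply: measurableT_comp mG _; apply: measurable_fun_pair => //.
  exact: measurable_rVD.
rewrite (@fubini_tonelli _ _ _ _ _ mu mu (fun p => G (p.2 + p.1, p.1)%R))//=; last first.
  apply: measurableT_comp mG _; apply: measurable_fun_pair => //.
  exact: measurable_rVD.
pose B (h : 'rV[R]_n) : R := \1_(rV_cube n (2 * M)) h * (n%:R * (2 * M) ^+ 2).
have mc : measurable (rV_cube n (2 * M)) by apply: rV_closed_measurable; exact: closed_rV_cube.
have mB : measurable_fun setT B.
  by apply: measurable_funM; [exact: measurable_indic|exact: measurable_cst].
have B0 h : 0 <= B h by rewrite mulr_ge0// mulr_ge0// sqr_ge0.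

(* If one endpoint is outside K the left-hand side is 0; otherwise the whole segment is in K, and
   |h|^2 is at most n (2 M)^2. *)
have GB h y : (G (h + y, y)%R <=
    \int[leb]_r (\1_(`[0%R, 1%R]%classic) r * B h * e (r *: h + y)%R)%:E)%E.
  have [/andP[yK hK]|] := boolP ((y \in K) && (h + y \in K)); last first.
    move=> H; rewrite (_ : G _ = 0%E); last first.
      rewrite /G/= !indicE; move: H; rewrite negb_and => /orP[]/negbTE->.
        by rewrite mulr0 mul0r.
      by rewrite !mul0r.
    by apply: integral_ge0 => r _; rewrite lee_fin; apply: mulr_ge0 => //; apply: mulr_ge0.
  have Ky : K y by rewrite inE in yK.
  have Kh : K (h + y) by rewrite inE in hK.
  have hr (r : R) : 0 <= r <= 1 -> K (r *: h + y).
    by move=> hr; have := Kc _ _ r Kh Ky hr; rewrite addrK.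
  have cB : rV_cube n (2 * M) h.
    move=> i; have := KM _ Kh i; have := KM _ Ky i; rewrite !mxE => a1 a2.
    by rewrite -(addrK (y 0 i) (h 0 i)) mulr2n mulrDl mul1r (le_trans (ler_normB _ _))// lerD.
  rewrite /G/= !indicE yK hK !mul1r /w !patchE yK hK.
  have := @segment_energy U A u y h oU su (fun r Hr => KU _ (hr r Hr)).
  move=> /le_trans; apply.
  have mer (c : R) : measurable_fun setT (fun r : R => (c * e (r *: h + y))%:E).
    apply/measurable_EFinP; apply: measurable_funM; first exact: measurable_cst.
    apply: measurableT_comp me _; apply: measurable_rVD; last exact: measurable_cst.
    exact: measurable_rVZ.
  have -> : (\int[leb]_r (\1_(`[0%R, 1%R]%classic) r * B h * e (r *: h + y)%R)%:E =
      \int[leb]_(r in `[0%R, 1%R]) (B h * e (r *: h + y)%R)%:E)%E.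
    rewrite [RHS]integral_mkcond; apply: eq_integral => r _.
    by rewrite patchE indicE; case: ifP => _; rewrite ?mul1r// !mul0r.
  have -> : (\int[leb]_(r in `[0%R, 1%R])
        (dot h h * dot (grad u (r *: h + y)) (grad u (r *: h + y)))%:E =
      \int[leb]_(r in `[0%R, 1%R]) (dot h h * e (r *: h + y)%R)%:E)%E.
    apply: eq_integral => r; rewrite inE/= in_itv/= => r01.
    by rewrite /e !indicE !patchE (mem_set (hr _ r01)) mul1r.
  apply: ge0_le_integral => //.
  - by move=> r _; rewrite lee_fin mulr_ge0// dot_ge0.
  - exact: measurable_funTS (mer _).
  - exact: measurable_funTS (mer _).
  - move=> r _; rewrite lee_fin; apply: ler_wpM2r => //.
    by rewrite /B indicE (mem_set cB) mul1r; exact: dot_le_cube.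
(* Once r and y are exchanged, translating by r h leaves the integral of [e], which depends neither
   on r nor on h. *)
have inner h : (\int[mu]_y G (h + y, y)%R <= (B h)%:E * \int[mu]_x (e x)%:E)%E.
  pose H (p : 'rV[R]_n * R) : \bar R :=
    (\1_(`[0%R, 1%R]%classic) p.2 * B h * e (p.2 *: h + p.1))%:E.
  have mH : measurable_fun setT H.
    apply/measurable_EFinP; apply: measurable_funM.
      apply: measurable_funM; last exact: measurable_cst.
      by apply: measurableT_comp => //; exact: measurable_indic.
    apply: measurableT_comp me _; apply: measurable_rVD => //.
    exact: measurable_rVZ.
  have H0 p : (0 <= H p)%E.
    by rewrite lee_fin; apply: mulr_ge0 => //; apply: mulr_ge0.
  apply: (@le_trans _ _ (\int[mu]_y \int[leb]_r H (y, r))%E).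
    apply: ge0_le_integral => //.
    - apply: measurableT_comp mG _; apply: measurable_fun_pair => //.
      apply: measurable_rVD => //; exact: measurable_cst.
    - by have := @measurable_fun_fubini_tonelli_F _ _ _ _ R leb H mH H0.
  have -> : (\int[mu]_y \int[leb]_r H (y, r) = \int[leb]_r \int[mu]_y H (y, r))%E.
    exact: (@fubini_tonelli _ _ _ _ R mu leb H mH H0).
  have -> : (\int[leb]_r \int[mu]_y H (y, r) =
      \int[leb]_(r in `[0%R, 1%R]) ((B h)%:E * \int[mu]_x (e x)%:E))%E.
    rewrite [RHS]integral_mkcond; apply: eq_integral => r _; rewrite patchE /H/= indicE.
    case: ifPn => r01; last first.
      by rewrite integral0_eq// => y _; rewrite !mul0r.
    under eq_integral do rewrite mul1r EFinM.
    have me2 : measurable_fun setT (fun y => (e (r *: h + y))%:E).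
      apply/measurable_EFinP; apply: measurableT_comp me _.
      by apply: measurable_rVD => //; exact: measurable_cst.
    have e20 (y : 'rV[R]_n) : setT y -> (0 <= (e (r *: h + y))%:E)%E by rewrite lee_fin.
    have Bh0 : (0 <= (B h)%:E)%E by rewrite lee_fin.
    apply: (etrans (ge0_integralZl mu measurableT me2 e20 Bh0)).
    have -> : (\int[mu]_y (e (r *: h + y))%:E = \int[mu]_y (e (y + r *: h))%:E)%E.
      by apply: eq_integral => y _; rewrite (addrC (r *: h) y).
    have me3 : measurable_fun setT (fun x => (e x)%:E) by exact/measurable_EFinP.
    have e30 x : (0 <= (e x)%:E)%E by rewrite lee_fin.
    by have -> := @ge0_integral_rV_translation R n (r *: h) (fun x => (e x)%:E) me3 e30.
  by rewrite integral_cst//= lebesgue_measure_itv/= lte_fin ltr01 -EFinB subr0 mule1.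
apply: (@le_trans _ _ (\int[mu]_h ((B h)%:E * \int[mu]_x (e x)%:E))%E).
  apply: ge0_le_integral => //.
  - by move=> h _; apply: integral_ge0.
  - by have := @measurable_fun_fubini_tonelli_F _ _ _ _ R mu
      (fun p : 'rV[R]_n * 'rV[R]_n => G (p.1 + p.2, p.2)%R) mGs (fun=> G0 _).
  - by apply: emeasurable_funM; [exact/measurable_EFinP|exact: measurable_cst].

have Ie0 : (0 <= \int[mu]_x (e x)%:E)%E by apply: integral_ge0 => x _; rewrite lee_fin.
have mBE : measurable_fun setT (fun h => (B h)%:E) by exact/measurable_EFinP.
have BE0 (h : 'rV[R]_n) : setT h -> (0 <= (B h)%:E)%E by rewrite lee_fin.
have := ge0_integralZr mu measurableT mBE BE0 Ie0 => ->.
apply: lee_wpmul2r => //.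
have mI : measurable_fun setT (fun h : 'rV[R]_n => (\1_(rV_cube n (2 * M)) h : R)%:E).
  by apply/measurable_EFinP; exact: measurable_indic.
have I0 (h : 'rV[R]_n) : setT h -> (0 <= (\1_(rV_cube n (2 * M)) h : R)%:E)%E by rewrite lee_fin.
have c0 : (0 <= (n%:R * (2 * M) ^+ 2)%:E :> \bar R)%E by rewrite lee_fin mulr_ge0// sqr_ge0.
have -> : (\int[mu]_h (B h)%:E =
    \int[mu]_h ((n%:R * (2 * M) ^+ 2)%:E * (\1_(rV_cube n (2 * M)) h : R)%:E))%E.
  by apply: eq_integral => h _; rewrite /B mulrC EFinM.
by rewrite (ge0_integralZl mu measurableT mI I0 c0) integral_indic// setIT.
Qed.

End poincare.

(** * Scalar inequalities *)

Section scalar.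
Context {R : realType}.
Implicit Types (x y t : R) (f df : R -> R).

Lemma powR_sub_bound (a b x : R) : 0 <= a <= b -> 0 < x -> x `^ a <= 1 + x `^ b.
Proof.
move=> /andP[a0 ab] x0; have [x1|x1] := leP 1 x.
  by apply: le_trans (ler_powR x1 ab) _; rewrite lerDr.
have : x `^ a <= x `^ 0 by apply: ger_powR; rewrite // x0 ltW.
by rewrite powRr0 => /le_trans; apply; rewrite lerDl powR_ge0.
Qed.

(* Young inequality with exponents 2, 4, 4, applied to x h, x h ^ 2 and
   x ^ -3. *)
Lemma young244 x h : 0 < x -> 0 <= h -> h <= x * h + x * h ^+ 2 + x ^- 3.
Proof.
move=> x0 h0; have i3 : 0 <= x ^- 3 by rewrite invr_ge0 exprn_ge0// ltW.
have xh2 : 0 <= x * h ^+ 2 by rewrite mulr_ge0 ?sqr_ge0// ltW.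
have xh : 0 <= x * h by rewrite mulr_ge0// ltW.
have [x1|x1] := leP 1 x.
  have : h <= x * h by rewrite ler_peMl.
  by move: i3 xh2; lra.
have [hx|hx] := leP 1 (x * h).
  have : h <= x * h ^+ 2 by rewrite expr2 mulrA ler_peMl.
  by move: i3 xh; lra.
have h1 : h <= x^-1 by rewrite -(ler_pM2l x0) divff ?gt_eqF// ltW.
have : x^-1 <= x ^- 3.
  rewrite lef_pV2 ?posrE ?exprn_gt0// exprS ler_piMr ?ltW//.
  by rewrite exprn_ilt1// ltW.
by move: xh xh2 h1; lra.
Qed.

(** The tangent at 1 of a concave power, obtained from Young's inequality for x^a and 1 with
    exponents 1/a and 1/(1-a). *)
Lemma bernoulli_powR_le1 (a x : R) : 0 < a <= 1 -> 0 < x ->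
  x `^ a <= 1 + a * (x - 1).
Proof.
move=> /andP[a0]; rewrite le_eqVlt => /orP[/eqP-> x0|a1 x0].
  by rewrite (powRr1 (ltW x0)); lra.
have := @conjugate_powR R (x `^ a) 1 a^-1 (1 - a)^-1 (powR_ge0 _ _) ler01.
rewrite !invr_gt0 subr_gt0 !invrK => /(_ a0 a1); rewrite [_ + _]addrC subrK.
move=> /(_ erefl); rewrite mulr1 -powRrM divff ?gt_eqF// (powRr1 (ltW x0)) powR1.
by move=> /le_trans; apply; rewrite le_eqVlt; apply/orP; left; apply/eqP; ring.
Qed.

(** A proportion t = z / (x + y) in [0, 1] satisfies t <= t^a; the two proportions x and y give add
    up to 1. *)
Lemma powRD_le (a x y : R) : 0 <= a <= 1 -> 0 <= x -> 0 <= y ->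
  (x + y) `^ a <= x `^ a + y `^ a.
Proof.
move=> /andP[a0 a1] x0 y0; have [s0|s0] := eqVneq (x + y) 0.
  by move/eqP: (s0); rewrite paddr_eq0// => /andP[/eqP-> /eqP->]; rewrite addr0 lerDl powR_ge0.
have sp : 0 < x + y by rewrite lt_neqAle eq_sym s0 addr_ge0.
have H z : 0 <= z <= x + y -> z / (x + y) * (x + y) `^ a <= z `^ a.
  move=> /andP[z0 zs]; have [->|zn0] := eqVneq z 0; first by rewrite !mul0r powR_ge0.
  have zp : 0 < z by rewrite lt_neqAle eq_sym zn0.
  have -> : z `^ a = (z / (x + y)) `^ a * (x + y) `^ a.
    have q0 : 0 <= z / (x + y) by rewrite divr_ge0// ltW.
    by rewrite -(powRM _ q0 (ltW sp)) divfK.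
  apply: ler_wpM2r; first exact: powR_ge0.
  by apply: ger1_powR => //; rewrite divr_gt0//= ler_pdivrMr// mul1r.
have := lerD (H x _) (H y _); rewrite x0 y0 lerDl y0 lerDr x0 => /(_ isT isT).
by rewrite -mulrDl -mulrDl divff// mul1r.
Qed.

Lemma subadditive_powR (a x y : R) : 0 <= a <= 1 -> 0 <= x -> 0 <= y ->
  `|x `^ a - y `^ a| <= `|x - y| `^ a.
Proof.
move=> a01; wlog xy : x y / x <= y => [H x0 y0|].
  have [xy|/ltW xy] := leP x y; first exact: H.
  by rewrite distrC (distrC x); exact: H.
move=> x0 y0; rewrite distrC ger0_norm; last first.
  by rewrite subr_ge0 ge0_ler_powR//; case/andP: a01.
rewrite distrC ger0_norm ?subr_ge0// lerBlDl.
have yx0 : 0 <= y - x by rewrite subr_ge0.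
by have := powRD_le a01 x0 yx0; rewrite subrKC.
Qed.

Lemma powR_le_split (e M z : R) : 0 < e -> e < 2 -> 0 < M -> 0 <= z ->
  z `^ e <= M `^ e + M `^ (e - 2) * z ^+ 2.
Proof.
move=> e0 e2 M0 z0; have [zM|Mz] := leP z M.
  apply: (@le_trans _ _ (M `^ e)).
    by apply: ge0_ler_powR => //; rewrite ?nnegrE//; exact: ltW.
  by rewrite lerDl mulr_ge0 ?powR_ge0 ?sqr_ge0.
have zp : 0 < z by exact: lt_trans Mz.
have -> : z `^ e = z `^ (e - 2) * z ^+ 2.
  rewrite -powR_mulrn// -powRD ?subrK//.
  by apply/implyP => _; rewrite gt_eqF.
apply: ler_wpDl; first exact: powR_ge0.
apply: ler_wpM2r; first exact: sqr_ge0.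
rewrite -(opprB 2 e) !powRN lef_pV2 ?posrE ?powR_gt0//.
by apply: ge0_ler_powR; rewrite ?nnegrE ?subr_ge0 ltW.
Qed.

(** The first bound serves where z is small in mean square, the second where its mean square is
    merely bounded. The cutting levels [M1] and [M2] solve M^e = eps and M^(e-2) = eps. *)
Lemma powR_lt2_bound (e eps : R) : 0 < e -> e < 2 -> 0 < eps -> exists2 C : R, 0 < C &
  forall z, 0 <= z -> z `^ e <= eps + C * z ^+ 2 /\ z `^ e <= eps * z ^+ 2 + C.
Proof.
move=> e0 e2 eps0.
have [M1 M10 E1] : exists2 M, 0 < M & M `^ e = eps.
  exists (eps `^ e^-1); first exact: powR_gt0.
  by rewrite -powRrM mulVf ?(powRr1 (ltW eps0))// gt_eqF.
have [M2 M20 E2] : exists2 M, 0 < M & M `^ (e - 2) = eps.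
  exists (eps `^ (e - 2)^-1); first exact: powR_gt0.
  by rewrite -powRrM mulVf ?(powRr1 (ltW eps0))// lt_eqF// subr_lt0.
exists (M1 `^ (e - 2) + M2 `^ e); first by rewrite addr_gt0 ?powR_gt0.
move=> z z0; split.
  have /le_trans := powR_le_split e0 e2 M10 z0; apply; rewrite E1 lerD2l.
  by apply: ler_wpM2r; [exact: sqr_ge0|rewrite lerDl powR_ge0].
have /le_trans := powR_le_split e0 e2 M20 z0; apply; rewrite E2 addrC lerD2l.
by rewrite lerDr powR_ge0.
Qed.

Lemma derive_le0_nincr f df (a b : R) : a <= b ->
  (forall t, a <= t <= b -> is_derive t 1 f (df t)) ->
  (forall t, a <= t <= b -> df t <= 0) -> f b <= f a.
Proof.
move=> ab hf df0; have [||c] := @MVT_segment R f df a b ab.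
- by move=> x; rewrite in_itv/= => /andP[xa xb]; apply: hf; rewrite !ltW.
- apply: derivable_within_continuous => x; rewrite in_itv/= => hx.
  by have [] := hf _ hx.
rewrite in_itv/= => hc E; rewrite -subr_le0 E.
by apply: mulr_le0_ge0; rewrite ?subr_ge0// df0.
Qed.

Lemma near_at_right0 (P : R -> Prop) (b : R) : 0 < b ->
  (forall t, 0 < t < b -> P t) -> \forall t \near 0^'+, P t.
Proof.
move=> b0 H; near=> t; apply: H; apply/andP; split; near: t.
- exact: nbhs_right_gt.
- exact: nbhs_right_lt.
Unshelve. all: by end_near. Qed.

(* In terms of y = I ^ (- 1 / 3), the differential inequality reads
   y' >= k / 3. *)
Lemma ode_decay (I dI : R -> R) (I0 k : R) : 0 < k ->
  (forall t, 0 < t -> is_derive t 1 I (dI t)) ->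
  (forall t, 0 < t -> 0 <= I t) ->
  (forall t, 0 < t -> dI t <= - k * I t `^ (4 / 3)) ->
  I @ 0^'+ --> I0 ->
  0 <= I0 /\ forall t, 0 < t -> I t <= I0 / (1 + k / 3 * I0 `^ 3^-1 * t) ^+ 3.
Proof.
move=> k0 hI Ipos hdI cI.
have I00 : 0 <= I0.
  apply: (cvgr_to_ge cI); apply: (near_at_right0 ltr01) => t /andP[t0 _].
  exact: Ipos.
split=> // t t0.
have den0 : 0 < 1 + k / 3 * I0 `^ 3^-1 * t.
  by rewrite ltr_pwDl// !mulr_ge0 ?powR_ge0// ltW.
have mono s : 0 < s <= t -> I t <= I s.
  move=> /andP[s0 st]; apply: (@derive_le0_nincr I dI) => // r /andP[sr _].
    by apply: hI; exact: lt_le_trans sr.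
  apply: le_trans (hdI _ (lt_le_trans s0 sr)) _.
  by rewrite mulNr oppr_le0 mulr_ge0 ?powR_ge0// ltW.
(* The substitution needs I > 0. If I t = 0 the claim is trivial; otherwise I, being nonincreasing,
   is positive on all of (0, t]. *)
have [It0|Itn0] := eqVneq (I t) 0.
  by rewrite It0 divr_ge0// exprn_ge0// ltW.
have Itp : 0 < I t by rewrite lt_neqAle eq_sym Itn0 Ipos.
have Isp s : 0 < s <= t -> 0 < I s by move=> /mono; exact: lt_le_trans.
have I0p : 0 < I0.
  apply: (lt_le_trans Itp); apply: (cvgr_to_ge cI).
  by apply: (near_at_right0 t0) => s /andP[s0 st]; apply: mono; rewrite s0 ltW.
pose y s := I s `^ (- 3^-1) - k / 3 * s.
have dy s : 0 < s <= t -> is_derive s 1 y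
    (- 3^-1 * I s `^ (- 3^-1 - 1) * dI s - k / 3).
  move=> hs; have s0 : 0 < s by case/andP: hs.
  apply: is_deriveB.
    apply: (@is_derive_comp1 _ _ (fun x => x `^ (- 3^-1)) I s 1).
      exact: is_derive1_powR (Isp _ hs).
    exact: hI.
  have H := @is_deriveZ R R R (@id R) (k / 3) s 1 1 (is_derive_id _ _).
  by apply: (is_derive_eq H); rewrite /GRing.scale/= mulr1.
have dy0 s : 0 < s <= t -> 0 <= - 3^-1 * I s `^ (- 3^-1 - 1) * dI s - k / 3.
  move=> hs; have s0 : 0 < s by case/andP: hs.
  rewrite subr_ge0; have := hdI _ s0; have Isn0 := Isp _ hs.
  have -> : - 3^-1 - 1 = - (4 / 3) :> R by field.
  rewrite powRN; set J := I s `^ _; have J0 : 0 < J by exact: powR_gt0.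
  move=> h; have : J^-1 * dI s <= - k.
    by rewrite -(ler_pM2l J0) mulrA divff ?gt_eqF// mul1r mulrC.
  by rewrite -mulrA mulNr; lra.
(* I is known at 0 only as a limit from the right, so monotonicity is used on [s, t] and s tends to
   0. *)
have ylow : I0 `^ (- 3^-1) <= y t.
  have cy : y s @[s --> 0^'+] --> I0 `^ (- 3^-1).
    rewrite -[X in _ --> X](subr0) -[X in _ - X](mulr0 (k / 3)).
    apply: cvgB.
      apply: (@continuous_cvg _ _ _ _ _ I (fun x => x `^ (- 3^-1))) => //.
      have [h _] := is_derive1_powR (- 3^-1) I0p.
      exact/differentiable_continuous/derivable1_diffP.
    by apply: cvgMr; apply: cvg_at_right_filter; exact: cvg_id.
  apply: (cvgr_to_le cy); apply: (near_at_right0 t0) => s /andP[s0 st].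
  rewrite -lerN2; apply: (@derive_le0_nincr (fun s => - y s)
      (fun s => - (- 3^-1 * I s `^ (- 3^-1 - 1) * dI s - k / 3))); first exact: ltW.
    move=> r /andP[sr rt]; apply: is_deriveN; apply: dy.
    by rewrite rt (lt_le_trans s0 sr).
  move=> r /andP[sr rt]; rewrite oppr_le0; apply: dy0.
  by rewrite rt (lt_le_trans s0 sr).
have E3 (x : R) : 0 < x -> (x `^ (- 3^-1)) ^+ 3 = x^-1.
  move=> x0; rewrite -powR_mulrn ?powR_ge0// -powRrM mulNr mulVf// powR_inv1//.
  exact: ltW.
have ->: I0 / (1 + k / 3 * I0 `^ 3^-1 * t) ^+ 3 = ((I0 `^ (- 3^-1) + k / 3 * t) ^+ 3)^-1.
  have -> : I0 `^ (- 3^-1) + k / 3 * t = I0 `^ (- 3^-1) * (1 + k / 3 * I0 `^ 3^-1 * t).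
    rewrite mulrDr mulr1; congr (_ + _); rewrite powRN.
    by rewrite [RHS]mulrC -!mulrA (mulrC t) (mulrA (_ `^ _)) divff ?mul1r// gt_eqF// powR_gt0.
  by rewrite [in RHS]exprMn [in RHS]E3// [RHS]invfM invrK.
rewrite -[leLHS]invrK lef_pV2 ?posrE ?invr_gt0//; last first.
  by rewrite exprn_gt0// addr_gt0 ?powR_gt0// mulr_gt0// divr_gt0.
rewrite -(E3 _ Itp) ler_pXn2r ?nnegrE ?powR_ge0//; last first.
  by rewrite addr_ge0 ?powR_ge0// mulr_ge0 ?divr_ge0// ltW.
by move: ylow; rewrite /y lerBrDr.
Qed.

End scalar.

(** * Boundary of a convex domain *)

Section boundary_geometry.
Context {R : realType} {d : nat}.
Implicit Types (Om U : set 'rV[R]_d) (x y z nu v : 'rV[R]_d) (rho f : 'rV[R]_d -> R).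

Definition segment_convex Om := forall x y (r : R), Om x -> Om y ->
  0 <= r <= 1 -> Om (r *: (x - y) + y).

Lemma convex_set_segment Om :
  convex_set (Om : set (convex_lmodType 'rV[R]_d)) -> segment_convex Om.
Proof.
move=> cO x y r Ox Oy /andP[r0 r1].
have := cO x y (Itv01 r0 r1); rewrite !inE => /(_ Ox Oy).
rewrite /conv/=; congr (Om _).
by rewrite scalerBr /unstable.onem scalerBl scale1r addrA addrAC.
Qed.

Lemma closure_norm Om x (e : R) : closure Om x -> 0 < e ->
  exists2 y, Om y & `|y - x| < e.
Proof.
move=> clx e0; have [y [Oy]] := clx _ (nbhsx_ballx x e e0).
by rewrite -ball_normE /= distrC => h; exists y.
Qed.

Lemma norm_closure Om x : (forall e : R, 0 < e -> exists2 y, Om y & `|y - x| < e) ->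
  closure Om x.
Proof.
move=> H B /nbhs_normP[e /= e0 He]; have [y Oy yx] := H e e0.
by exists y; split => //; apply: He; rewrite /= distrC.
Qed.

(** The point x is replaced by a nearby point x' of [Om], and the error is absorbed by moving z by u
    = ((1 - r) / r) (x - x'), which openness at z allows. *)
Lemma closure_convex_open Om x z (r : R) : open Om -> segment_convex Om ->
  closure Om x -> Om z -> 0 < r <= 1 -> Om (r *: (z - x) + x).
Proof.
move=> oO cO clx Oz /andP[r0]; rewrite le_eqVlt => /orP[/eqP->|r1].
  by rewrite scale1r subrK.
have [e e0 He] := near_ball_norm (open_near oO Oz).
have er : 0 < e * r by rewrite mulr_gt0.
have [x' Ox' hx'] := closure_norm clx er.
have rn0 : r != 0 by rewrite gt_eqF.
pose u := ((1 - r) / r) *: (x - x').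
have Oz' : Om (u + z).
  apply: He; rewrite /u normrZ distrC ger0_norm ?divr_ge0 ?subr_ge0//; try exact: ltW.
  apply: (@le_lt_trans _ _ (r^-1 * `|x' - x|)).
    apply: ler_wpM2r => //; rewrite ler_piMl ?invr_ge0//; try exact: ltW.
    by rewrite lerBlDr lerDl ltW.
  by rewrite mulrC ltr_pdivrMr.
have r01 : 0 <= r <= 1 by rewrite (ltW r0) (ltW r1).
have := cO _ _ r Oz' Ox' r01; congr (Om _).
rewrite /u; apply/rowP => i; rewrite !mxE.
by field.
Qed.

Lemma derive_neg_near f x v : derivable f x v -> 'D_v f x < 0 ->
  exists2 e : R, 0 < e & forall h : R, 0 < h < e -> f (h *: v + x) < f x.
Proof.
move=> df neg.
have : \forall h \near 0^', h^-1 *: (f (h *: v + x) - f x) < 0.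
  have : (fun h : R => h^-1 *: (f (h *: v + x) - f x)) @ 0^' --> 'D_v f x by exact: df.
  by move=> /cvgr_lt; apply.
move=> /nbhs_ballP[e /= e0 He]; exists e => // h /andP[h0 he].
have := He h; rewrite /ball/= sub0r normrN gtr0_norm// => /(_ he).
rewrite gt_eqF// => /(_ isT); rewrite /GRing.scale/= pmulr_rlt0 ?invr_gt0//.
by rewrite subr_lt0.
Qed.

Lemma derive_le0_near f x v (e : R) : derivable f x v -> 0 < e ->
  (forall h : R, 0 < h < e -> f (h *: v + x) <= f x) -> 'D_v f x <= 0.
Proof.
move=> df e0 H; rewrite leNgt; apply/negP => pos.
have [|//|e' e'0 H'] := @derive_neg_near (fun y => - f y) x v.
  exact: derivableN.
  by rewrite deriveN// oppr_lt0.
have [h0 h1 h2] : [/\ 0 < Num.min e e' / 2, Num.min e e' / 2 < e &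
    Num.min e e' / 2 < e'].
  by case: (ltP e e') => ee; split; lra.
have := H _ (introT andP (conj h0 h1)); have := H' _ (introT andP (conj h0 h2)).
by rewrite ltrN2; lra.
Qed.

End boundary_geometry.

Section local_defining.
Context {R : realType} {d : nat}.
Variables (Om U : set 'rV[R]_d) (rho : 'rV[R]_d -> R).
Hypotheses (oU : open U) (Crho : smooth_upto U set0 1 rho)
  (Dn0 : forall y, U y -> grad rho y != 0)
  (Omrho : forall y, U y -> (Om y <-> rho y < 0)).
Implicit Types (x y z nu v : 'rV[R]_d).

Let cont y : U y -> {for y, continuous rho}.
Proof. exact: smooth_cont Crho. Qed.

(** A positive value would persist near y and keep [Om] away from it. Conversely, from a zero, [rho]
    decreases strictly along - grad rho, so points of [Om] accumulate at y. *)
Lemma local_defining0 y : U y -> boundary Om y <-> rho y = 0.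
Proof.
move=> Uy; split.
  move=> [cly nOy]; apply/eqP; rewrite eq_le leNgt; apply/andP; split; last first.
    by rewrite leNgt; apply/negP => /(Omrho Uy).
  apply/negP => pos.
  have n1 : nbhs y U by exact: open_nbhs_nbhs.
  have n2 : \forall z \near y, 0 < rho z by apply: (cvgr_gt _ (cont Uy)).
  have [z [Oz [Uz]]] := cly _ (filterI n1 n2).
  by move=> /ltW; rewrite leNgt => /negP; apply; exact/Omrho.
move=> r0; split; last by move=> /(Omrho Uy); rewrite r0 ltxx.
apply: norm_closure => e e0; set v := - grad rho y.
have [||e1 e10 H1] := @derive_neg_near _ _ rho y v.
- exact: smooth_derivable Crho Uy.
- by rewrite (derive_dot_grad _ oU Crho Uy) dotNl oppr_lt0 lt_neqAle dot_ge0
    eq_sym dot_eq0 Dn0.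
have [e2 e20 H2] := near_ball_norm (open_near oU Uy).
have M0 : 0 < `|v| + 1 by rewrite ltr_wpDl.
pose h := Num.min e1 (Num.min (e / (`|v| + 1)) (e2 / (`|v| + 1))) / 2.
have [h0 h1 h2 h3] : [/\ 0 < h, h < e1, h < e / (`|v| + 1) & h < e2 / (`|v| + 1)].
  have a1 : 0 < e / (`|v| + 1) by rewrite divr_gt0.
  have a2 : 0 < e2 / (`|v| + 1) by rewrite divr_gt0.
  rewrite /h; move: a1 a2; set p := e / _; set q := e2 / _ => a1 a2.
  case: (ltP p q) => pq; [case: (ltP e1 p) => ee|case: (ltP e1 q) => ee]; split; lra.
have small (k : R) : h < k / (`|v| + 1) -> `|h *: v| < k.
  rewrite ltr_pdivlMr// normrZ gtr0_norm//; apply: le_lt_trans.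
  by rewrite ler_pM2l// lerDl.
exists (h *: v + y); last by rewrite addrK; exact: small.
apply/Omrho; first exact: H2 (small _ h3).
by rewrite -r0; apply: H1; rewrite h0.
Qed.

Lemma local_defining_normal y : U y -> boundary Om y ->
  outer_normal Om y ((enorm (grad rho y))^-1 *: grad rho y).
Proof.
move=> Uy _; exists rho => //; exists U; split => //.
by have /Ck_uptoP[] := Crho.
Qed.

(** Supporting hyperplane: on the segment from y to a point of [Om] the function [rho] is negative
    while it vanishes at y, so its derivative in that direction is at most 0. Points of the closure
    follow by approximation. *)
Lemma local_defining_support y z : open Om -> segment_convex Om -> U y ->
  boundary Om y -> closure Om z -> dot (grad rho y) (z - y) <= 0.
Proof.
move=> oO cO Uy bdy; have r0 := (local_defining0 Uy).1 bdy.
have H w : Om w -> dot (grad rho y) (w - y) <= 0.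
  move=> Ow; rewrite dotC -(derive_dot_grad _ oU Crho Uy).
  have [e2 e20 H2] := near_ball_norm (open_near oU Uy).
  have M0 : 0 < `|w - y| + 1 by rewrite ltr_wpDl.
  pose e := Num.min 1 (e2 / (`|w - y| + 1)).
  have a2 : 0 < e2 / (`|w - y| + 1) by rewrite divr_gt0.
  apply: (@derive_le0_near _ _ rho y _ e).
  - exact: smooth_derivable Crho Uy.
  - by rewrite lt_min ltr01.
  - move=> h /andP[h0]; rewrite lt_min => /andP[h1 h2].
    rewrite r0; apply/ltW/Omrho.
      apply: H2; rewrite normrZ gtr0_norm//; move: h2; rewrite ltr_pdivlMr//.
      by apply: le_lt_trans; rewrite ler_pM2l// lerDl.
    by apply: closure_convex_open => //; [case: bdy|rewrite h0 ltW].
move=> clz; apply/ler_addgt0Pl => e e0; rewrite addr0.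
set N := grad rho y; pose S := \sum_i `|N 0 i|.
have S0 : 0 < S + 1 by rewrite ltr_wpDl// sumr_ge0.
have [w Ow hw] := closure_norm clz (divr_gt0 e0 S0).
have -> : z - y = (w - y) - (w - z) by apply/rowP => i; rewrite !mxE; ring.
rewrite dotBr; have := H _ Ow; rewrite -/N => h.
apply: (le_trans (y := 0 - dot N (w - z))); first by rewrite lerD2r.
rewrite sub0r; apply: le_trans (ler_norm _) _; rewrite normrN.
apply: (@le_trans _ _ (\sum_i `|N 0 i| * `|w - z|)).
  apply: le_trans (ler_norm_sum _ _ _) _; apply: ler_sum => i _.
  by rewrite normrM ler_wpM2l// rV_coord_le_norm.
rewrite -mulr_suml; move: hw; rewrite ltr_pdivlMr// => /ltW; apply: le_trans.
by rewrite mulrC ler_wpM2l// lerDl.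
Qed.

End local_defining.

(** * Boundary values and first-order expansions up to the boundary *)

Section traces.
Context {R : realType} {V : normedModType R}.
Implicit Types (U : set V) (f g : V -> R) (x : V).

Lemma traceE U f x l : closure U x -> f @ within U (nbhs x) --> l -> trace U f x = l.
Proof. by move=> clx; have := within_nbhs_proper clx => PF; exact: cvg_lim. Qed.

Lemma within_norm U x (P : V -> Prop) : (\forall z \near within U (nbhs x), P z) ->
  exists2 e : R, 0 < e & forall z, U z -> `|z - x| < e -> P z.
Proof.
move=> /nbhs_normP[e /= e0 He]; exists e => // z Uz zx.
by apply: (He z) => //=; rewrite distrC.
Qed.

Lemma cvg_sumR {T : Type} (F : set_system T) {FF : Filter F} (I : Type)
    (r : seq I) (f : I -> T -> R) (a : I -> R) :
  (forall i, f i @ F --> a i) ->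
  (fun w : T => \sum_(i <- r) f i w) @ F --> \sum_(i <- r) a i.
Proof.
move=> H; elim: r => [|i r IH].
  by rewrite big_nil; under eq_fun do rewrite big_nil; exact: cvg_cst.
by rewrite big_cons; under eq_fun do rewrite big_cons; apply: cvgD.
Qed.

End traces.

Section trace_expansion.
Context {R : realType} {d : nat}.
Implicit Types (Om U : set 'rV[R]_d) (x y z nu v : 'rV[R]_d) (f : 'rV[R]_d -> R).

(** The segment between two interior points stays in [Om], so the mean value theorem applies even if
    x is on the boundary; the partial derivatives on it are close to their traces at x. *)
Lemma interior_expansion Om f x (e : R) : segment_convex Om -> open Om ->
  smooth_upto Om (closure Om) 1 f -> closure Om x -> 0 < e ->
  exists2 del : R, 0 < del & forall y z, Om y -> Om z ->
    `|y - x| < del -> `|z - x| < del ->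
    `|f y - f z - \sum_j (y - z) 0 j * trace Om (partial j f) x| <= e * `|y - z|.
Proof.
move=> cO oO sf clx e0.
have e1 : 0 < e / (d%:R + 1) by rewrite divr_gt0// ltr_wpDl.
have [del del0 Hdel] : exists2 del : R, 0 < del & forall z, Om z -> `|z - x| < del ->
    forall j, `|trace Om (partial j f) x - partial j f z| <= e / (d%:R + 1).
  apply: (@within_norm _ _ Om x (fun z => forall j,
    `|trace Om (partial j f) x - partial j f z| <= e / (d%:R + 1))).
  apply: filter_forall => j.
  have := smooth_trace (smooth_derive (delta_mx 0 j) sf) clx.
  by move/cvgrPdist_le; apply.
exists del => // y z Oy Oz hy hz.
have seg (r : R) : 0 <= r <= 1 -> Om (r *: (y - z) + z) by exact: cO.
have segd (r : R) : 0 <= r <= 1 -> `|(r *: (y - z) + z) - x| < del.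
  move=> /andP[r0 r1].
  have -> : (r *: (y - z) + z) - x = r *: (y - x) + (1 - r) *: (z - x).
    by apply/rowP => i; rewrite !mxE; ring.
  apply: le_lt_trans (ler_normD _ _) _; rewrite !normrZ !ger0_norm// ?subr_ge0//.
  have [->|rn0] := eqVneq r 0; first by rewrite mul0r add0r subr0 mul1r.
  have rp : 0 < r by rewrite lt_neqAle eq_sym rn0.
  apply: (@lt_le_trans _ _ (r * del + (1 - r) * del)).
    by apply: ltr_leD; [rewrite ltr_pM2l|rewrite ler_wpM2l ?subr_ge0// ltW].
  by rewrite -mulrDl addrC subrK mul1r.
have [|r /andP[r0 r1] E] := @line_mvt _ _ f z (y - z).
  by move=> r hr; apply: smooth_derivable sf _; exact: seg.
have hr : 0 <= r <= 1 by rewrite !ltW.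
rewrite subrK in E; rewrite E (derive_dot_grad _ oO sf (seg _ hr)) /dot -sumrB.
apply: le_trans (ler_norm_sum _ _ _) _.
apply: (@le_trans _ _ (\sum_(j < d) `|y - z| * (e / (d%:R + 1)))).
  apply: ler_sum => j _; rewrite -mulrBr normrM; apply: ler_pM => //.
    exact: rV_coord_le_norm.
  by rewrite mxE distrC; apply: Hdel; [exact: seg|exact: segd].
rewrite sumr_const card_ord -[leLHS]mulr_natl; set a := `|y - z|.
have -> : d%:R * (a * (e / (d%:R + 1))) = e * a * (d%:R / (d%:R + 1)) by ring.
apply: ler_piMr; first exact: mulr_ge0 (ltW e0) (normr_ge0 _).
by rewrite ler_pdivrMr ?ltr_wpDl// mul1r lerDl.
Qed.

(** Boundary values are only limits from inside, so the interior estimate is passed to the limit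
    twice: its first point tends to y, then its second to x. *)
Lemma trace_expansion Om f x (e : R) : segment_convex Om -> open Om ->
  smooth_upto Om (closure Om) 1 f -> closure Om x -> 0 < e ->
  exists2 del : R, 0 < del & forall y, closure Om y -> `|y - x| < del ->
    `|trace Om f y - trace Om f x - \sum_j (y - x) 0 j * trace Om (partial j f) x|
      <= e * `|y - x|.
Proof.
move=> cO oO sf clx e0.
have [del del0 H] := interior_expansion cO oO sf clx e0.
exists del => // y cly hy.
have PFx := within_nbhs_proper clx; have PFy := within_nbhs_proper cly.
pose A := fun j => trace Om (partial j f) x.
have cid (w : 'rV[R]_d) : (fun y : 'rV[R]_d => y) @ within Om (nbhs w) --> w.
  by move=> P; exact: (@cvg_within _ (nbhs w) _ Om P).
have cc (w : 'rV[R]_d) j : (fun y => y 0 j) @ within Om (nbhs w) --> w 0 j.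
  exact: (cvg_comp _ _ (cid w) (@coord_continuous R 1 d 0 j w)).
have step z : Om z -> `|z - x| < del ->
  `|trace Om f y - f z - \sum_j (y - z) 0 j * A j| <= e * `|y - z|.
  move=> Oz hz; rewrite -subr_le0.
  have c1 : (fun w => `|f w - f z - \sum_j (w - z) 0 j * A j| - e * `|w - z|)
      @ within Om (nbhs y) -->
      `|trace Om f y - f z - \sum_j (y - z) 0 j * A j| - e * `|y - z|.
    apply: cvgB.
      apply: cvg_norm; apply: cvgB.
        by apply: cvgB; [exact: smooth_trace sf cly|exact: cvg_cst].
      apply: cvg_sumR => j; apply: cvgM; last exact: cvg_cst.
      under eq_fun do rewrite !mxE.
      by rewrite !mxE; apply: cvgB; [exact: cc|exact: cvg_cst].
    apply: cvgM; [exact: cvg_cst|]; apply: cvg_norm; apply: cvgB; [exact: cid|exact: cvg_cst].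
  apply: (cvgr_to_le c1); rewrite near_withinE; near=> w => Ow.
  rewrite subr_le0; apply: H => //.
  near: w; apply: (@cvgr_lt _ _ _ _ (fun w => `|w - x|) `|y - x|) => //.
  by apply: cvg_norm; apply: cvgB; [exact: cvg_id|exact: cvg_cst].
rewrite -subr_le0.
have c1 : (fun w => `|trace Om f y - f w - \sum_j (y - w) 0 j * A j| - e * `|y - w|)
    @ within Om (nbhs x) -->
    `|trace Om f y - trace Om f x - \sum_j (y - x) 0 j * A j| - e * `|y - x|.
  apply: cvgB.
    apply: cvg_norm; apply: cvgB.
      by apply: cvgB; [exact: cvg_cst|exact: smooth_trace sf clx].
    apply: cvg_sumR => j; apply: cvgM; last exact: cvg_cst.
      under eq_fun do rewrite !mxE.
    by rewrite !mxE; apply: cvgB; [exact: cvg_cst|exact: cc].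
  apply: cvgM; [exact: cvg_cst|]; apply: cvg_norm; apply: cvgB; [exact: cvg_cst|exact: cid].
apply: (cvgr_to_le c1); rewrite near_withinE; near=> w => Ow.
rewrite subr_le0; apply: step => //.

Unshelve. all: by end_near. Qed.

End trace_expansion.

(** * Sign of the Bochner flux on a convex boundary *)

Section neumann.
Context {R : realType} {d : nat}.
Implicit Types (Om U : set 'rV[R]_d) (x y z nu v : 'rV[R]_d) (f s : 'rV[R]_d -> R).

Lemma dot_le_sum x y (a b : R) : 0 <= a -> (forall i, `|x 0 i| <= a) ->
  (forall i, `|y 0 i| <= b) -> `|dot x y| <= d%:R * (a * b).
Proof.
move=> a0 xa yb; apply: le_trans (ler_norm_sum _ _ _) _.
apply: (@le_trans _ _ (\sum_(i < d) a * b)).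
  by apply: ler_sum => i _; rewrite normrM ler_pM.
by rewrite sumr_const card_ord -[leLHS]mulr_natl.
Qed.

Lemma ler_sum_single (F : 'I_d -> R) i : (forall j, 0 <= F j) -> F i <= \sum_j F j.
Proof. by move=> F0; rewrite (bigD1 i)//= lerDl sumr_ge0. Qed.

Lemma near_ball_norm_forall (I : finType) U (Q : I -> set 'rV[R]_d) x :
  nbhs x U -> (forall i, nbhs x (Q i)) ->
  exists2 e : R, 0 < e & forall y, `|y| < e -> U (y + x) /\ forall i, Q i (y + x).
Proof.
move=> nU nQ; have nQ' : nbhs x (fun y => forall i, Q i y).
  by exact: (@filter_forall _ I Q (nbhs x) (nbhs_filter x) nQ).
have [e e0 H] := @near_ball_norm _ _ (U `&` (fun y => forall i, Q i y)) x (filterI nU nQ').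
by exists e => // y /H[].
Qed.

(* For y on the boundary close to x along T x = D s (x), the normals at x and y
   are monotone, and D s (y) is orthogonal to the normal at y; hence D s, which
   is tangent to the boundary at x, does not point outwards at first order. *)
Lemma neumann_convex_flux Om s x nu : open Om -> segment_convex Om ->
  smooth_upto Om (closure Om) 2 s ->
  (forall x nu, boundary Om x -> outer_normal Om x nu ->
    \sum_i trace Om (partial i s) x * nu 0 i = 0) ->
  boundary Om x -> outer_normal Om x nu ->
  \sum_i (\sum_j trace Om (partial j s) x *
     trace Om (partial j (partial i s)) x) * nu 0 i <= 0.
Proof.
move=> oO cO ss neu bdx [rho [U [oU Ux Crho Dn0 Omrho]] nuE].
have {}Crho : smooth_upto U set0 1 rho by apply/Ck_uptoP; split.
have clx : closure Om x by case: bdx.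
set N := grad rho in nuE; set e0 := enorm (N x) in nuE.
have NN : 0 < dot (N x) (N x) by rewrite lt_neqAle dot_ge0 eq_sym dot_eq0 Dn0.
have e00 : 0 < e0 by rewrite sqrtr_gt0.
have e0n : e0 != 0 by rewrite gt_eqF.
have e0E : dot (N x) (N x) = e0 ^+ 2 by rewrite sqr_sqrtr// ltW.
have NxE : N x = e0 *: nu by rewrite nuE scalerA divff// scale1r.
have Nnu : dot (N x) nu = e0.
  by rewrite nuE dotZr e0E expr2 mulrA mulVf// mul1r.
have nunu : dot nu nu = 1.
  by apply: (mulfI e0n); rewrite -dotZl -NxE Nnu mulr1.
have nu1 i : `|nu 0 i| <= 1.
  rewrite -(@ler_pXn2r _ 2)// ?nnegrE// expr1n real_normK ?num_real// -nunu.
  rewrite expr2; apply: (@ler_sum_single (fun i => nu 0 i * nu 0 i)) => j.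
  by rewrite -expr2 sqr_ge0.
pose T y : 'rV[R]_d := \row_i trace Om (partial i s) y.
have TN y : U y -> boundary Om y -> dot (T y) (N y) = 0.
  move=> Uy bdy; have := neu _ _ bdy (local_defining_normal oU Crho Dn0 Omrho Uy bdy).
  have en : (enorm (grad rho y))^-1 != 0.
    rewrite invr_eq0; apply: lt0r_neq0.
    by rewrite sqrtr_gt0 lt_neqAle dot_ge0 eq_sym dot_eq0 Dn0.
  move=> E; apply: (mulfI en); rewrite mulr0 -dotZr -E.
  by apply: eq_bigr => i _; rewrite [T y 0 i]mxE.
pose tau := T x; pose A i j := trace Om (partial j (partial i s)) x.
have taunu : dot tau nu = 0.
  by apply: (mulfI e0n); rewrite mulr0 -dotZr -NxE; exact: TN.
pose a := \sum_i (\sum_j tau 0 j * A i j) * nu 0 i.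
have -> : \sum_i (\sum_j trace Om (partial j s) x *
     trace Om (partial j (partial i s)) x) * nu 0 i = a.
  by apply: eq_bigr => i _; congr (_ * _); apply: eq_bigr => j _; rewrite /tau mxE.
pose S1 := \sum_i `|nu 0 i|.
pose B1 := \sum_i \sum_j `|tau 0 j * A i j|.
pose B2 := \sum_i \sum_j `|nu 0 j * A i j|.
pose P := `|tau| + `|nu| + 1.
pose Q := B1 + B2 + P.
pose W := 1 + S1.
have S10 : 0 <= S1 by exact: sumr_ge0.
have B10 : 0 <= B1 by apply: sumr_ge0 => i _; exact: sumr_ge0.
have B20 : 0 <= B2 by apply: sumr_ge0 => i _; exact: sumr_ge0.
have P0 : 0 < P by rewrite ltr_wpDl// addr_ge0.
have Q0 : 0 <= Q by rewrite !addr_ge0// ltW.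
have W0 : 0 < W by rewrite ltr_pwDl.
(* The bracket does not depend on eps, so a positive [a] is excluded by letting eps be small. The
   condition on S1 keeps the component along nu of the normal at y above e0 / 2. *)
suff key (eps : R) : 0 < eps -> eps <= 1 -> eps * S1 <= e0 / 2 ->
    a <= eps * (B2 + P * S1 + 2 / e0 * (d%:R * (Q * W))).
  rewrite leNgt; apply/negP => a0.
  pose C := B2 + P * S1 + 2 / e0 * (d%:R * (Q * W)).
  have C0 : 0 <= C.
    rewrite !addr_ge0// ?mulr_ge0//; try exact: ltW.
    by rewrite invr_ge0 ltW.
  pose eps := Num.min 1 (Num.min (e0 / 2 / (S1 + 1)) (a / 2 / (C + 1))).
  have S11 : 0 < S1 + 1 by rewrite ltr_wpDl.
  have C1 : 0 < C + 1 by rewrite ltr_wpDl.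
  have ep : 0 < eps by rewrite !lt_min ltr01 !divr_gt0.
  have ep1 : eps <= 1 by rewrite ge_min lexx.
  have ep2 : eps <= e0 / 2 / (S1 + 1) by rewrite !ge_min lexx orbT.
  have ep3 : eps <= a / 2 / (C + 1) by rewrite !ge_min lexx !orbT.
  move: ep2 ep3; rewrite (ler_pdivlMr _ _ S11) (ler_pdivlMr _ _ C1) => ep2 ep3.
  have h : a <= eps * C.
    apply: key => //; apply: le_trans ep2.
    by rewrite ler_pM2l// lerDl.
  have : eps * C <= eps * (C + 1) by rewrite ler_pM2l// lerDl.
  by lra.
move=> ep ep1 ep2.
have [del1 del10 H1] : exists2 del : R, 0 < del & forall y, closure Om y ->
    `|y - x| < del -> forall i,
    `|T y 0 i - tau 0 i - \sum_j (y - x) 0 j * A i j| <= eps * `|y - x|.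
  apply: within_norm; apply: filter_forall => i.
  have si : smooth_upto Om (closure Om) 1 (partial i s) by exact: smooth_derive ss.
  have [del del0 H] := trace_expansion cO oO si clx ep.
  have nb : nbhs x [set y | `|y - x| < del].
    apply: (filterS _ (nbhsx_ballx x del del0)) => y.
    by rewrite -ball_normE /= distrC.
  rewrite near_withinE; near=> y => cly.
  by rewrite /tau !mxE; apply: H => //; near: y.
have [del2 del20 H2] : exists2 del : R, 0 < del & forall y, `|y| < del ->
    U (y + x) /\ forall i, `|N (y + x) 0 i - N x 0 i| <= eps.
  have nNi i : nbhs x [set y | `|N y 0 i - N x 0 i| <= eps].
    have := smooth_cont (smooth_derive (delta_mx 0 i) Crho) Ux.
    move=> /cvgrPdist_le/(_ _ ep); apply: filterS => y.
    by move=> hy; rewrite /= /N !mxE distrC; exact: hy.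
  exact: (near_ball_norm_forall (open_nbhs_nbhs (conj oU Ux)) nNi).
(* Tilting the tangential direction slightly inwards makes [rho] strictly decrease. *)
pose v := tau - eps *: nu.
have [||e1 e10 H3] := @derive_neg_near _ _ rho x v.
- exact: smooth_derivable Crho Ux.
- rewrite (derive_dot_grad _ oU Crho Ux) -/N NxE dotZr dotBl taunu dotZl nunu.
  by rewrite sub0r mulr1 mulrN oppr_lt0 mulr_gt0.
have rx0 : rho x = 0 by exact/(local_defining0 oU Crho Dn0 Omrho Ux).
have [h [h0 he1 hd1 hd2]] : exists h : R, [/\ 0 < h, h < e1, h * P < del1 & h * P < del2].
  pose m := Num.min (e1 * P) (Num.min del1 del2).
  have m0 : 0 < m by rewrite !lt_min mulr_gt0// del10 del20.
  exists (m / 2 / P); rewrite divfK ?gt_eqF// !divr_gt0// ltr_pdivrMr//.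
  have m1 : m <= e1 * P by rewrite ge_min lexx.
  have m2 : m <= del1 by rewrite !ge_min lexx orbT.
  have m3 : m <= del2 by rewrite !ge_min lexx !orbT.
  by split => //; move: m0 m1 m2 m3; clear; lra.
(* At g = 0 this point is not in [Om], at g = eps h it is; an intermediate g gives a boundary point
   y with y - x = h tau - g nu and 0 <= g <= eps h. *)
pose p (g : R) := (- g) *: nu + (h *: tau + x).
have pE (g : R) : p g - x = h *: tau - g *: nu.
  by apply/rowP => i; rewrite !mxE; ring.
have pd (g : R) : 0 <= g <= h -> `|p g - x| <= h * P.
  move=> /andP[g0 gh]; rewrite pE; apply: le_trans (ler_normB _ _) _.
  rewrite !normrZ (ger0_norm g0) (ger0_norm (ltW h0)).
  apply: (@le_trans _ _ (h * `|tau| + h * `|nu|)); first by rewrite lerD2l ler_wpM2r.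
  by rewrite -mulrDr ler_pM2l// lerDl.
have eh : eps * h <= h by rewrite ler_piMl// ltW.
have pU (g : R) : 0 <= g <= h -> U (p g).
  move=> hg; have [] := H2 (p g - x) (le_lt_trans (pd _ hg) hd2).
  by rewrite subrK.
have hh : 0 <= h <= h by rewrite lexx ltW.
have h00 : (0 : R) <= 0 <= h by rewrite lexx ltW.
(* Were x + h tau in [Om], so would be a point slightly further along nu, which lies beyond the
   supporting hyperplane at x because tau is orthogonal to nu. *)
have rp0 : 0 <= rho (p 0).
  rewrite leNgt; apply/negP => /(Omrho _ (pU _ h00)) Op.
  have [e3 e30 H4] := near_ball_norm (open_near oO Op).
  have nu0 : 0 < `|nu| + 1 by rewrite ltr_wpDl.
  pose k := e3 / 2 / (`|nu| + 1).
  have k0 : 0 < k by rewrite !divr_gt0.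
  have Oz : Om (k *: nu + p 0).
    apply: H4; rewrite normrZ gtr0_norm// mulrAC ltr_pdivrMr//.
    by have := normr_ge0 nu; nra.
  have := local_defining_support oU Crho Dn0 Omrho oO cO Ux bdx (subset_closure Oz).
  rewrite -addrA pE scale0r subr0 dotDr !dotZr -/N Nnu NxE dotZl dotC.
  by rewrite taunu !mulr0 addr0 leNgt mulr_gt0.
have rpe : rho (p (eps * h)) < 0.
  have -> : p (eps * h) = h *: v + x.
    by apply/rowP => i; rewrite !mxE; ring.
  by rewrite -[ltRHS]rx0; apply: H3; rewrite h0.
have e0h : 0 <= eps * h by rewrite mulr_ge0// ltW.
have [g] : exists2 g : R, g \in `[0, eps * h] & rho (p g) = 0.
  apply: (@IVT R (fun g => rho (p g)) 0 (eps * h) 0) => //.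
    apply: continuous_in_subspaceT => g; rewrite inE/= in_itv/= => /andP[g0 gh].
    apply: continuous_comp.
      apply: cvgD; last exact: cvg_cst.
      by apply: cvgZ; [apply: cvgN; exact: cvg_id|exact: cvg_cst].
    by apply: smooth_cont Crho _; apply: pU; rewrite g0 (le_trans gh).
  by rewrite ge_min le_max rp0 (ltW rpe) orbT.
rewrite in_itv/= => /andP[g0 gh] rg.
have ghh : 0 <= g <= h by rewrite g0 (le_trans gh).
set y := p g in rg; have Uy : U y by exact: pU.
have bdy : boundary Om y by exact/(local_defining0 oU Crho Dn0 Omrho Uy).
have yx : `|y - x| <= h * P by exact: pd.
have yE : y - x = h *: tau - g *: nu by exact: pE.
have Nyx i : `|N y 0 i - N x 0 i| <= eps.
  by have [_] := H2 _ (le_lt_trans yx hd2); rewrite subrK; exact.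
have Tyx i : `|T y 0 i - tau 0 i - \sum_j (y - x) 0 j * A i j| <= eps * (h * P).
  apply: le_trans (H1 _ bdy.1 (le_lt_trans yx hd1) i) _.
  by rewrite ler_pM2l.
pose lam := dot (N y) nu.
have lamd : `|lam - e0| <= eps * S1.
  rewrite -Nnu -dotBl /S1 mulr_sumr; apply: le_trans (ler_norm_sum _ _ _) _.
  apply: ler_sum => i _; rewrite normrM ler_wpM2r//.
  by rewrite [(N y - N x) 0 i]mxE [(- N x) 0 i]mxE.
have lam2 : e0 / 2 <= lam.
  by move: lamd ep2; rewrite ler_norml => /andP[l1 _]; move: l1; clear; lra.
have lam0 : 0 <= lam by apply: le_trans lam2; rewrite divr_ge0// ltW.
(* The supporting hyperplane at y, tested at x, gives h tau . N y >= g lam >= 0. *)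
have tauN : 0 <= dot tau (N y).
  have := local_defining_support oU Crho Dn0 Omrho oO cO Uy bdy clx.
  rewrite -opprB yE dotNr dotBr !dotZr -/N -/lam (dotC _ tau) oppr_le0 subr_ge0.
  move=> H; rewrite -(pmulr_rge0 _ h0); apply: le_trans H.
  by rewrite mulr_ge0.
(* The part of the normal at y that is not along nu; it is of order eps. *)
pose m := N y - lam *: nu.
have mE i : `|m 0 i| <= eps * W.
  have -> : m 0 i = (N y 0 i - N x 0 i) + (e0 - lam) * nu 0 i.
    by rewrite NxE !mxE; ring.
  apply: le_trans (ler_normD _ _) _; rewrite /W mulrDr mulr1; apply: lerD => //.
  rewrite normrM distrC; apply: (@le_trans _ _ `|lam - e0|) => //.
  by rewrite ler_piMr.
have SE i : \sum_j (y - x) 0 j * A i j =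
    h * (\sum_j tau 0 j * A i j) - g * \sum_j nu 0 j * A i j.
  rewrite yE !mulr_sumr -sumrB; apply: eq_bigr => j _.
  rewrite [(h *: tau - g *: nu) 0 j]mxE [(h *: tau) 0 j]mxE [(- (g *: nu)) 0 j]mxE.
  by rewrite [(g *: nu) 0 j]mxE; ring.
pose dT := T y - tau.
(* T y is orthogonal to N y, so lam dT . nu = - tau . N y - dT . m. The first term has a sign, and
   the second is of order h eps. *)
have dTnu : lam * dot dT nu <= d%:R * (h * Q * (eps * W)).
  have -> : lam * dot dT nu = - dot tau (N y) - dot dT m.
    rewrite /m dotBr dotZr.
    have -> : dot dT (N y) = - dot tau (N y).
      have E := dotBl (T y) tau (N y).
      by apply: (etrans E); rewrite [X in X - _](TN _ Uy bdy) sub0r.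
    by rewrite opprB addrCA subrr addr0.
  apply: (@le_trans _ _ (- dot dT m)).
    by rewrite lerBlDr addNr oppr_le0.
  apply: le_trans (ler_norm _) _; rewrite normrN; apply: dot_le_sum => //.
    by rewrite mulr_ge0// ltW.
  move=> i; have -> : dT 0 i = (T y 0 i - tau 0 i - \sum_j (y - x) 0 j * A i j)
      + (h * (\sum_j tau 0 j * A i j) - g * \sum_j nu 0 j * A i j).
    by rewrite SE [dT 0 i]mxE [(- tau) 0 i]mxE subrK.
  apply: le_trans (ler_normD _ _) _.
  have b1 : `|\sum_j tau 0 j * A i j| <= B1.
    apply: le_trans (ler_norm_sum _ _ _) _.
    by apply: (@ler_sum_single (fun i => \sum_j `|tau 0 j * A i j|)) => j; exact: sumr_ge0.
  have b2 : `|\sum_j nu 0 j * A i j| <= B2.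
    apply: le_trans (ler_norm_sum _ _ _) _.
    by apply: (@ler_sum_single (fun i => \sum_j `|nu 0 j * A i j|)) => j; exact: sumr_ge0.
  have t1 : eps * (h * P) <= h * P by rewrite ler_piMl// mulr_ge0// ltW.
  have t2 : `|h * (\sum_j tau 0 j * A i j) - g * \sum_j nu 0 j * A i j| <= h * B1 + h * B2.
    apply: le_trans (ler_normB _ _) _; rewrite !normrM (ger0_norm g0) (ger0_norm (ltW h0)).
    apply: lerD; first by rewrite ler_pM2l.
    apply: ler_pM => //; by case/andP: ghh.
  have /le_trans := lerD (Tyx i) t2; apply; have /le_trans := lerD t1 (lexx (h * B1 + h * B2)).
  by apply; rewrite addrC -!mulrDr.
(* By the expansion of Ds at x, dT . nu equals h a up to the displacement g along nu and the
   remainder, both of order eps h. *)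
have dTa : h * a - eps * h * (B2 + P * S1) <= dot dT nu.
  have -> : dot dT nu = h * a - g * (\sum_i (\sum_j nu 0 j * A i j) * nu 0 i) +
      \sum_i (T y 0 i - tau 0 i - \sum_j (y - x) 0 j * A i j) * nu 0 i.
    rewrite /a !mulr_sumr -sumrB -big_split/=; apply: eq_bigr => i _.
    by rewrite SE [dT 0 i]mxE [(- tau) 0 i]mxE; ring.
  have b2 : `|\sum_i (\sum_j nu 0 j * A i j) * nu 0 i| <= B2.
    apply: le_trans (ler_norm_sum _ _ _) _; apply: ler_sum => i _.
    rewrite normrM; apply: (@le_trans _ _ (`|\sum_j nu 0 j * A i j|)).
      by rewrite ler_piMr.
    exact: ler_norm_sum.
  have b3 : `|\sum_i (T y 0 i - tau 0 i - \sum_j (y - x) 0 j * A i j) * nu 0 i|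
      <= eps * (h * P) * S1.
    apply: le_trans (ler_norm_sum _ _ _) _; rewrite /S1 mulr_sumr.
    by apply: ler_sum => i _; rewrite normrM ler_wpM2r.
  move: b2 b3; set X := \sum_i _; set Y := \sum_i _.
  rewrite !ler_norml => /andP[_ x2] /andP[y1 _].
  have gX : g * X <= eps * h * B2.
    apply: (@le_trans _ _ (g * B2)); first by rewrite ler_wpM2l.
    by rewrite ler_wpM2r.
  by lra.
have fin : h * a <= h * (eps * (B2 + P * S1 + 2 / e0 * (d%:R * (Q * W)))).
  have R0 : 0 <= h * (eps * (2 / e0 * (d%:R * (Q * W)))).
    by rewrite !mulr_ge0// ?invr_ge0// ltW.
  suff : dot dT nu <= h * (eps * (2 / e0 * (d%:R * (Q * W)))) by move: dTa; lra.
  have [D0|D0] := leP (dot dT nu) 0; first exact: le_trans R0.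
  have : e0 / 2 * dot dT nu <= d%:R * (h * Q * (eps * W)).
    by apply: le_trans dTnu; rewrite ler_pM2r.
  rewrite -ler_pdivlMl ?divr_gt0//; congr (_ <= _); field.
  by rewrite e0n.
by move: fin; rewrite ler_pM2l.
Unshelve. all: by end_near. Qed.

End neumann.

(** * Weighted integrals and divergences *)

Section gint_theory.
Context {R : realType} {d : nat}.
Variables (Om : set 'rV[R]_d) (F : 'rV[R]_d -> R).
Hypotheses (mO : measurable Om) (mF : measurable_fun Om F).
Implicit Types (f g : 'rV[R]_d -> R).

Lemma measurable_gweight : measurable_fun Om (fun x => expR (- F x)).
Proof.
apply: measurableT_comp; first exact: measurable_expR.
exact: measurable_funN.
Qed.

Lemma gintegrable_ext f g : {in Om, f =1 g} -> gintegrable Om F f -> gintegrable Om F g.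
Proof.
move=> fg; apply: eq_integrable => // x Ox; by rewrite fg.
Qed.

Lemma gint_ext f g : {in Om, f =1 g} -> gint Om F f = gint Om F g.
Proof. by move=> fg; apply: eq_Rintegral => // x Ox; rewrite fg. Qed.

Lemma gintegrable_le f g : measurable_fun Om f ->
  (forall x, Om x -> `|f x| <= g x) -> gintegrable Om F g -> gintegrable Om F f.
Proof.
move=> mf fg ig; apply: (le_integrable mO _ _ ig).
  apply/measurable_EFinP; apply: measurable_funM => //; exact: measurable_gweight.
move=> x Ox /=; rewrite lee_fin !normrM; apply: ler_wpM2r => //.
by apply: le_trans (fg _ Ox) _; exact: ler_norm.
Qed.

Lemma gintegrableD f g : gintegrable Om F f -> gintegrable Om F g ->
  gintegrable Om F (fun x => f x + g x).
Proof.
move=> hf hg; have := integrableD mO hf hg.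
by apply: eq_integrable => // x _ /=; rewrite -EFinD -mulrDl.
Qed.

Lemma gintegrableZ (c : R) f : gintegrable Om F f -> gintegrable Om F (fun x => c * f x).
Proof.
move=> hf; have := integrableZl mO c hf.
by apply: eq_integrable => // x _ /=; rewrite -EFinM mulrA.
Qed.

Lemma gintegrableN f : gintegrable Om F f -> gintegrable Om F (fun x => - f x).
Proof.
by move/(gintegrableZ (-1)); apply: gintegrable_ext => x _; rewrite mulN1r.
Qed.

Lemma gintegrableB f g : gintegrable Om F f -> gintegrable Om F g ->
  gintegrable Om F (fun x => f x - g x).
Proof. by move=> hf /gintegrableN; exact: gintegrableD. Qed.

Lemma gintD f g : gintegrable Om F f -> gintegrable Om F g ->
  gint Om F (fun x => f x + g x) = gint Om F f + gint Om F g.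
Proof.
move=> hf hg; rewrite -RintegralD//.
by apply: eq_Rintegral => x _; rewrite mulrDl.
Qed.

Lemma gintZ (c : R) f : gintegrable Om F f -> gint Om F (fun x => c * f x) = c * gint Om F f.
Proof.
move=> hf; rewrite -RintegralZl//.
by apply: eq_Rintegral => x _; rewrite mulrA.
Qed.

Lemma gintN f : gintegrable Om F f -> gint Om F (fun x => - f x) = - gint Om F f.
Proof.
move=> hf; rewrite -mulN1r -gintZ//; apply: gint_ext => x _; by rewrite mulN1r.
Qed.

Lemma gintB f g : gintegrable Om F f -> gintegrable Om F g ->
  gint Om F (fun x => f x - g x) = gint Om F f - gint Om F g.
Proof. by move=> hf hg; rewrite gintD ?gintN//; exact: gintegrableN. Qed.

Lemma gint_le f g : gintegrable Om F f -> gintegrable Om F g ->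
  (forall x, Om x -> f x <= g x) -> gint Om F f <= gint Om F g.
Proof.
move=> hf hg fg; apply: le_Rintegral => // x Ox.
by rewrite ler_wpM2r ?expR_ge0// fg.
Qed.

Lemma gint_ge0 f : (forall x, Om x -> 0 <= f x) -> 0 <= gint Om F f.
Proof.
by move=> f0; apply: Rintegral_ge0 => x Ox; rewrite mulr_ge0 ?expR_ge0// f0.
Qed.

End gint_theory.

Section divergence.
Context {R : realType} {d : nat}.
Implicit Types (Om : set 'rV[R]_d) (F s phi : 'rV[R]_d -> R) (X : 'rV[R]_d -> 'rV[R]_d).

(** The vector D^2 s Ds, half the gradient of |Ds|^2 for s of class C^2. *)
Definition dgrad s x : 'rV[R]_d := grad s x *m hess s x.

Lemma dgradE s x i : dgrad s x 0 i = \sum_j partial j s x * partial j (partial i s) x.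
Proof. by rewrite /dgrad mxE; apply: eq_bigr => j _; rewrite !mxE. Qed.

Lemma divg_scale F phi X x :
  (forall i, derivable phi x (delta_mx 0 i)) ->
  (forall i, derivable (fun y => X y 0 i) x (delta_mx 0 i)) ->
  divg F (fun y => phi y *: X y) x = phi x * divg F X x + dot (grad phi x) (X x).
Proof.
move=> dphi dX; rewrite /divg.
have -> : \sum_i partial i (fun y => (phi y *: X y) 0 i) x =
    \sum_i (phi x * partial i (fun y => X y 0 i) x + partial i phi x * X x 0 i).
  apply: eq_bigr => i _.
  have -> : (fun y => (phi y *: X y) 0 i) = phi * (fun y => X y 0 i).
    by apply/funext => y; rewrite mxE.
  by rewrite /partial (deriveM (dphi i) (dX i)) /GRing.scale/= (mulrC (X x 0 i)).
rewrite big_split/= -mulr_sumr dotZr.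
have -> : \sum_i partial i phi x * X x 0 i = dot (grad phi x) (X x).
  by apply: eq_bigr => i _; rewrite mxE.
by ring.
Qed.

Lemma gradE s i : (fun y => grad s y 0 i) = partial i s.
Proof. by apply/funext => y; rewrite mxE. Qed.

Lemma divg_grad F s x : divg F (grad s) x = lapg F s x.
Proof.
rewrite /divg /lapg; congr (_ - _); apply: eq_bigr => i _.
by rewrite gradE.
Qed.

Lemma divgB F X1 X2 x :
  (forall i, derivable (fun y => X1 y 0 i) x (delta_mx 0 i)) ->
  (forall i, derivable (fun y => X2 y 0 i) x (delta_mx 0 i)) ->
  divg F (fun y => X1 y - X2 y) x = divg F X1 x - divg F X2 x.
Proof.
move=> d1 d2; rewrite /divg dotBr.
have -> : \sum_i partial i (fun y => (X1 y - X2 y) 0 i) x =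
    \sum_i partial i (fun y => X1 y 0 i) x - \sum_i partial i (fun y => X2 y 0 i) x.
  rewrite -sumrB; apply: eq_bigr => i _.
  have -> : (fun y => (X1 y - X2 y) 0 i) = (fun y => X1 y 0 i) - (fun y => X2 y 0 i).
    by apply/funext => y; rewrite !mxE.
  by rewrite /partial (deriveB (d1 i) (d2 i)).
by ring.
Qed.

Lemma smooth_partial Om A k s i : smooth_upto Om A k.+1 s -> smooth_upto Om A k (partial i s).
Proof. exact: smooth_derive. Qed.

Lemma smooth_lapg Om A k F s : open Om -> smooth_upto Om A k.+1 F ->
  smooth_upto Om A k.+2 s -> smooth_upto Om A k (lapg F s).
Proof.
move=> oO sF ss.
have -> : lapg F s = (fun x => \sum_i partial i (partial i s) x -
    \sum_i partial i F x * partial i s x).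
  apply/funext => x; rewrite /lapg; congr (_ - _).
  by apply: eq_bigr => i _; rewrite !mxE.
apply: smoothB => //; apply: smooth_sum => // i.
  by do 2 apply: smooth_partial.
apply: smoothM => //; first exact: smooth_partial.
by apply: smooth_partial; exact: smoothW ss.
Qed.

Lemma smooth_dot Om A k X1 X2 : open Om ->
  (forall i, smooth_upto Om A k (fun x => X1 x 0 i)) ->
  (forall i, smooth_upto Om A k (fun x => X2 x 0 i)) ->
  smooth_upto Om A k (fun x => dot (X1 x) (X2 x)).
Proof. by move=> oO s1 s2; apply: smooth_sum => // i; exact: smoothM. Qed.

Lemma smooth_grad Om A k s i : smooth_upto Om A k.+1 s ->
  smooth_upto Om A k (fun x => grad s x 0 i).
Proof. by rewrite gradE; exact: smooth_partial. Qed.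

Lemma smooth_dgrad Om A k s i : open Om -> smooth_upto Om A k.+2 s ->
  smooth_upto Om A k (fun x => dgrad s x 0 i).
Proof.
move=> oO ss; under eq_fun do rewrite dgradE.
apply: smooth_sum => // j; apply: smoothM => //.
  by apply: smooth_partial; exact: smoothW ss.
by do 2 apply: smooth_partial.
Qed.

Lemma smoothX2 Om A k s : open Om -> smooth_upto Om A k s ->
  smooth_upto Om A k (fun x => s x ^+ 2).
Proof. by move=> oO ss; under eq_fun do rewrite expr2; exact: smoothM. Qed.

Lemma partial_sum (I : finType) (f : I -> 'rV[R]_d -> R) x i :
  (forall j, derivable (f j) x (delta_mx 0 i)) ->
  partial i (fun y => \sum_j f j y) x = \sum_j partial i (f j) x.
Proof.
move=> df; rewrite /partial.
suff [_ ->] : is_derive x (delta_mx 0 i) (fun y => \sum_j f j y)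
    (\sum_j 'D_(delta_mx 0 i) (f j) x) by [].
elim: (index_enum I) => [|j r IH].
  under eq_fun do rewrite big_nil; rewrite big_nil; exact: is_derive_cst.
under eq_fun do rewrite big_cons; rewrite big_cons.
by apply: is_deriveD; first exact: derivableP.
Qed.

Lemma partialM (f g : 'rV[R]_d -> R) x i :
  derivable f x (delta_mx 0 i) -> derivable g x (delta_mx 0 i) ->
  partial i (fun y => f y * g y) x = f x * partial i g x + partial i f x * g x.
Proof.
move=> df dg; rewrite /partial (deriveM df dg) /GRing.scale/=.
by rewrite (mulrC (g x)).
Qed.

Lemma partialB (f g : 'rV[R]_d -> R) x i :
  derivable f x (delta_mx 0 i) -> derivable g x (delta_mx 0 i) ->
  partial i (fun y => f y - g y) x = partial i f x - partial i g x.
Proof. by move=> df dg; rewrite /partial (deriveB df dg). Qed.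

Lemma partial_powR s (a : R) x i : derivable s x (delta_mx 0 i) -> 0 < s x ->
  partial i (fun y => s y `^ a) x = a * s x `^ (a - 1) * partial i s x.
Proof.
move=> ds s0; have [_ E] := is_derive_comp1 (is_derive1_powR a s0) (derivableP ds).
exact: E.
Qed.

Lemma grad_powR s (a : R) x : (forall i, derivable s x (delta_mx 0 i)) -> 0 < s x ->
  grad (fun y => s y `^ a) x = (a * s x `^ (a - 1)) *: grad s x.
Proof.
by move=> ds s0; apply/rowP => i; rewrite !mxE partial_powR.
Qed.

(* Bochner formula: dgrad s = D (|D s|^2 / 2). *)
Lemma divg_bochner Om A F s x : open Om -> smooth_upto Om A 3 s ->
  smooth_upto Om A 2 F -> Om x ->
  divg F (fun y => lapg F s y *: grad s y - dgrad s y) x =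
  lapg F s x ^+ 2 - hess_norm2 s x - hess_form F x (grad s x).
Proof.
move=> oO s3 F2 Ox.
have s2 : smooth_upto Om A 2 s by exact: smoothW s3.
have s1 : smooth_upto Om A 1 s by exact: smoothW s3.
have F1 : smooth_upto Om A 1 F by exact: smoothW F2.
have sl : smooth_upto Om A 1 (lapg F s) by exact: smooth_lapg.
have dl i : derivable (lapg F s) x (delta_mx 0 i) by exact: smooth_derivable sl Ox.
have dg i : derivable (fun y => grad s y 0 i) x (delta_mx 0 i).
  by apply: smooth_derivable (smooth_grad i s2) Ox.
have dgij i j : derivable (partial i s) x (delta_mx 0 j).
  by apply: smooth_derivable (smooth_partial i s2) Ox.
have dgijk i j k : derivable (partial i (partial j s)) x (delta_mx 0 k).
  by apply: smooth_derivable (smooth_partial i (smooth_partial j s3)) Ox.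
have dFij i j : derivable (partial i F) x (delta_mx 0 j).
  by apply: smooth_derivable (smooth_partial i F2) Ox.
have sym i j : partial i (partial j s) x = partial j (partial i s) x.
  exact: derive_sym oO s2 Ox.
have sym3 i j : partial i (partial j (partial i s)) x = partial j (partial i (partial i s)) x.
  by apply: derive_sym oO (smooth_partial i s3) Ox.
rewrite divgB; last 2 first.
- move=> i; under eq_fun do rewrite mxE.
  by apply: derivableM; [exact: dl|exact: dg].
- by move=> i; apply: smooth_derivable (smooth_dgrad i oO s3) Ox.
rewrite (divg_scale _ dl dg) divg_grad -expr2.
have Dl j : partial j (lapg F s) x = \sum_i partial j (partial i (partial i s)) x -
    \sum_i (partial i F x * partial j (partial i s) x
            + partial j (partial i F) x * partial i s x).
  have -> : lapg F s = (fun x => (\sum_i partial i (partial i s) x) -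
      \sum_i partial i F x * partial i s x).
    apply/funext => y; rewrite /lapg; congr (_ - _).
    by apply: eq_bigr => i _; rewrite !mxE.
  have dM i : derivable (fun y => partial i F y * partial i s y) x (delta_mx 0 j).
    by apply: derivableM; [exact: dFij|exact: dgij].
  rewrite partialB; last 2 first.
  - by apply: smooth_derivable _ Ox; apply: smooth_sum => // i;
      exact: smooth_partial (smooth_partial i s3).
  - apply: smooth_derivable _ Ox; apply: smooth_sum => // i.
    by apply: smoothM => //; [exact: smooth_partial F2|exact: smooth_partial s2].
  rewrite (partial_sum (fun i => dgijk i i j)) (partial_sum dM); congr (_ - _).
  by apply: eq_bigr => i _; rewrite (partialM (dFij i j) (dgij i j)).
(* [T1] collects the third derivatives of s and [T2] the first derivatives of F; both occur in div
   (D^2 s Ds) and in D (Delta_g s) . Ds, and cancel. What is left is the squared Hessian and the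
   Hessian of F. *)
pose N := \sum_i \sum_j partial i (partial j s) x * partial j (partial i s) x.
pose T1 := \sum_i \sum_j partial j s x * partial i (partial j (partial i s)) x.
pose T2 := \sum_j \sum_i partial j F x * (partial i s x * partial i (partial j s) x).
pose Hf := \sum_j \sum_i partial i (partial j F) x * partial j s x * partial i s x.
have hD : divg F (dgrad s) x = (T1 + N) - T2.
  rewrite /divg; congr (_ - _); last first.
    by apply: eq_bigr => i _; rewrite dgradE [grad F x 0 i]mxE mulr_sumr.
  rewrite -big_split/=; apply: eq_bigr => i _.
  have -> : (fun y => dgrad s y 0 i) =
      (fun y => \sum_j partial j s y * partial j (partial i s) y).
    by apply/funext => y; rewrite dgradE.
  have dM j : derivable (fun y => partial j s y * partial j (partial i s) y) x (delta_mx 0 i).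
    by apply: derivableM; [exact: dgij|exact: dgijk].
  rewrite (partial_sum dM) -big_split/=.
  by apply: eq_bigr => j _; rewrite (partialM (dgij j i) (dgijk j i i)).
have hX : dot (grad (lapg F s) x) (grad s x) = T1 - (T2 + Hf).
  rewrite -big_split -sumrB/= /dot.
  have alg (a b c e f g : R) : (a - (b * c + e * f)) * g = g * a - (b * (g * c) + e * f * g).
    by ring.
  transitivity (\sum_i \sum_j (partial i s x * partial j (partial i (partial j s)) x -
    (partial j F x * (partial i s x * partial i (partial j s) x)
     + partial i (partial j F) x * partial j s x * partial i s x))).
    apply: eq_bigr => i _; rewrite [grad (lapg F s) x 0 i]mxE [grad s x 0 i]mxE.
    rewrite Dl -sumrB mulr_suml; apply: eq_bigr => j _.
    by rewrite (sym3 j i); exact: alg.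
  rewrite exchange_big/=; apply: eq_bigr => i _; rewrite -big_split -sumrB/=.
  exact: eq_bigr.
have hF : hess_form F x (grad s x) = Hf.
  have alg (a b c : R) : a * b * c = b * c * a by ring.
  rewrite /hess_form /dot /Hf; apply: eq_bigr => j _; rewrite mxE mulr_suml.
  apply: eq_bigr => i _.
  rewrite [grad s x 0 i]mxE [hess F x i j]mxE [grad s x 0 j]mxE; exact: alg.
have hN : hess_norm2 s x = N.
  apply: eq_bigr => i _; apply: eq_bigr => j _; rewrite [hess s x i j]mxE expr2.
  exact: (congr1 (fun z => partial i (partial j s) x * z) (sym i j)).
rewrite hD hX hF hN.
have alg (a b c e f : R) : a + (b - (c + e)) - (b + f - c) = a - f - e by ring.
exact: alg.
Qed.

End divergence.

(** * Static identities *)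

Opaque derive.

Section quadratic_bounds.
Context {R : realType} {d : nat}.
Implicit Types (x xi : 'rV[R]_d) (u : 'rV[R]_d -> R).

Lemma amgm_abs (t a b : R) : 0 <= a -> 0 <= b -> t ^+ 2 <= a * b -> `|t| <= a + b.
Proof.
move=> a0 b0 tab; rewrite -(@ler_pXn2r _ 2)// ?nnegrE ?addr_ge0//.
rewrite real_normK ?num_real//; apply: le_trans tab _.
rewrite sqrrD -subr_ge0.
have -> : a ^+ 2 + a * b *+ 2 + b ^+ 2 - a * b = a ^+ 2 + b ^+ 2 + a * b by ring.
by rewrite !addr_ge0 ?sqr_ge0// mulr_ge0.
Qed.

Lemma hess_norm2_ge0 u x : 0 <= hess_norm2 u x.
Proof. by apply: sumr_ge0 => i _; apply: sumr_ge0 => j _; exact: sqr_ge0. Qed.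

Lemma dot_mulmx_hess u x xi :
  dot (xi *m hess u x) (xi *m hess u x) <= hess_norm2 u x * dot xi xi.
Proof.
rewrite /hess_norm2 exchange_big/= mulr_suml; apply: ler_sum => j _.
have -> : (xi *m hess u x) 0 j = dot xi (\row_i hess u x i j).
  by rewrite mxE; apply: eq_bigr => i _; rewrite [X in _ = _ * X]mxE.
rewrite -expr2; apply: le_trans (dot_CS _ _) _.
rewrite mulrC ler_wpM2r ?dot_ge0//; apply: ler_sum => i _.
by rewrite !mxE expr2.
Qed.

Lemma hess_form_CS u x xi :
  hess_form u x xi ^+ 2 <= hess_norm2 u x * dot xi xi ^+ 2.
Proof.
apply: le_trans (dot_CS _ _) _; rewrite expr2 mulrA ler_wpM2r ?dot_ge0//.
exact: dot_mulmx_hess.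
Qed.

Lemma enorm_le (x : 'rV[R]_d) (b : R) : 0 <= b -> dot x x <= b ^+ 2 -> enorm x <= b.
Proof.
by move=> b0 h; rewrite /enorm -(ger0_norm b0) -sqrtr_sqr ler_sqrt// sqr_ge0.
Qed.

(** Reduces the integrability of a flux w psi Ds to that of w psi^2 and w |Ds|^2. *)
Lemma enorm_scale_le (w psi : R) xi : 0 <= w ->
  enorm ((w * psi) *: xi) <= w * (psi ^+ 2 + dot xi xi).
Proof.
move=> w0; apply: enorm_le; first by rewrite mulr_ge0// addr_ge0 ?sqr_ge0 ?dot_ge0.
rewrite dotZl dotZr exprMn mulrA -expr2 exprMn -mulrA ler_wpM2l ?sqr_ge0//.
have q0 := dot_ge0 xi; have p0 := sqr_ge0 psi.
rewrite [leRHS]sqrrD -subr_ge0; set a := psi ^+ 2; set b := dot xi xi.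
have -> : a ^+ 2 + a * b *+ 2 + b ^+ 2 - a * b = a ^+ 2 + b ^+ 2 + a * b by ring.
by rewrite !addr_ge0 ?sqr_ge0// mulr_ge0.
Qed.

End quadratic_bounds.

Section trace_algebra.
Context {R : realType} {V : normedModType R}.
Implicit Types (U : set V) (f g : V -> R) (x : V).

Lemma traceM U k l f g x : smooth_upto U (closure U) k f ->
  smooth_upto U (closure U) l g -> closure U x ->
  trace U (fun y => f y * g y) x = trace U f x * trace U g x.
Proof.
move=> sf sg clx; apply: traceE => //.
by apply: cvgM; [exact: smooth_trace sf clx|exact: smooth_trace sg clx].
Qed.

Lemma traceB U k l f g x : smooth_upto U (closure U) k f ->
  smooth_upto U (closure U) l g -> closure U x ->
  trace U (fun y => f y - g y) x = trace U f x - trace U g x.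
Proof.
move=> sf sg clx; apply: traceE => //.
by apply: cvgB; [exact: smooth_trace sf clx|exact: smooth_trace sg clx].
Qed.

Lemma trace_sum U k (I : Type) (r : seq I) (f : I -> V -> R) x :
  (forall i, smooth_upto U (closure U) k (f i)) -> closure U x ->
  trace U (fun y => \sum_(i <- r) f i y) x = \sum_(i <- r) trace U (f i) x.
Proof.
move=> sf clx; apply: traceE => //.
have FF := within_filter U (nbhs_filter x).
by apply: cvg_sumR => i; exact: smooth_trace (sf i) clx.
Qed.

Lemma trace_powR U k f (a : R) x : smooth_upto U (closure U) k f ->
  0 < trace U f x -> closure U x ->
  trace U (fun y => f y `^ a) x = trace U f x `^ a.
Proof.
move=> sf f0 clx; apply: traceE => //.
have FF := within_filter U (nbhs_filter x).
apply: (@continuous_cvg _ _ _ _ FF f (fun y => y `^ a)).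
  have [h _] := is_derive1_powR a f0.
  exact/differentiable_continuous/derivable1_diffP.
exact: smooth_trace sf clx.
Qed.

Lemma smooth_inv U A k f : open U -> smooth_upto U A k f ->
  (forall x, U x -> 0 < f x) -> (forall x, A x -> 0 < trace U f x) ->
  smooth_upto U A k (fun x => (f x)^-1).
Proof.
move=> oU sf f0 t0; apply: smooth_ext (smooth_powR (-1) oU sf f0 t0) => // x.
by rewrite inE => Ux; rewrite powR_inv1// ltW// f0.
Qed.

End trace_algebra.

Section green.
Context {R : realType} {d : nat}.
Variables (Om : set 'rV[R]_d) (F : 'rV[R]_d -> R).
Hypotheses (oO : open Om) (F2 : smooth_upto Om (closure Om) 2 F)
  (green : gauss_green Om F).
Implicit Types (s phi : 'rV[R]_d -> R).

Definition neumann s := forall x nu, boundary Om x -> outer_normal Om x nu ->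
  \sum_i trace Om (partial i s) x * nu 0 i = 0.

Let mO : measurable Om := rV_open_measurable oO.

Lemma smooth_measurable A k f : smooth_upto Om A k f -> measurable_fun Om f.
Proof.
by move=> sf; apply: open_continuous_measurable_rV => // x; exact: (smooth_cont sf).
Qed.

Lemma measurable_enorm (X : 'rV[R]_d -> 'rV[R]_d) :
  measurable_fun Om (fun x => dot (X x) (X x)) -> measurable_fun Om (fun x => enorm (X x)).
Proof.
have ms : measurable_fun setT (@Num.sqrt R).
  by apply: continuous_measurable_fun; exact: sqrt_continuous.
by move=> mX; exact: (measurableT_comp ms mX).
Qed.

Let mF : measurable_fun Om F := smooth_measurable F2.

Lemma divg_scale_grad A phi s x : smooth_upto Om A 1 phi -> smooth_upto Om A 2 s ->
  Om x -> divg F (fun y => phi y *: grad s y) x =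
    phi x * lapg F s x + dot (grad phi x) (grad s x).
Proof.
move=> sp s2 Ox; rewrite divg_scale ?divg_grad// => i.
  exact: smooth_derivable sp Ox.
exact: smooth_derivable (smooth_grad i s2) Ox.
Qed.

Let green_ge phi s : smooth_upto Om (closure Om) 1 phi ->
  smooth_upto Om (closure Om) 2 s -> neumann s ->
  gintegrable Om F (fun x => enorm (phi x *: grad s x)) ->
  gintegrable Om F (fun x => phi x * lapg F s x + dot (grad phi x) (grad s x)) ->
  0 <= gint Om F (fun x => phi x * lapg F s x + dot (grad phi x) (grad s x)).
Proof.
move=> sp s2 ns i1 i2.
have E : {in Om, (fun x => phi x * lapg F s x + dot (grad phi x) (grad s x)) =1
    divg F (fun y => phi y *: grad s y)}.
  by move=> x; rewrite inE => Ox; rewrite (divg_scale_grad sp s2 Ox).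
rewrite (gint_ext F E); apply: green => //.
- move=> i; apply/Ck_uptoP; under eq_fun do rewrite mxE.
  exact: (smoothM oO sp (smooth_grad i s2)).
- exact: (gintegrable_ext mO E i2).
- move=> x nu bdx onu; have clx : closure Om x by case: bdx.
  rewrite /normal_trace.
  under eq_bigr => i _.
    have -> : (fun y => (phi y *: grad s y) 0 i) = (fun y => phi y * partial i s y).
      by apply/funext => y; rewrite !mxE.
    rewrite (traceM sp (smooth_partial i s2) clx) -mulrA.
    over.
  by rewrite -mulr_sumr (ns _ _ bdx onu) mulr0.
Qed.

Lemma green_tangential phi s : smooth_upto Om (closure Om) 1 phi ->
  smooth_upto Om (closure Om) 2 s -> neumann s ->
  gintegrable Om F (fun x => enorm (phi x *: grad s x)) ->
  gintegrable Om F (fun x => phi x * lapg F s x + dot (grad phi x) (grad s x)) ->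
  gint Om F (fun x => phi x * lapg F s x + dot (grad phi x) (grad s x)) = 0.
Proof.
move=> sp s2 ns i1 i2; apply/eqP; rewrite eq_le (green_ge sp s2 ns i1 i2) andbT.
rewrite -oppr_ge0 -(gintN mO)//.
have E : {in Om, (fun x => (- phi x) * lapg F s x +
      dot (grad (fun x => - phi x) x) (grad s x)) =1
    (fun x => - (phi x * lapg F s x + dot (grad phi x) (grad s x)))}.
  move=> x; rewrite inE => Ox.
  have -> : grad (fun x => - phi x) x = - grad phi x.
    apply/rowP => i; rewrite !mxE /partial deriveN//.
    exact: smooth_derivable sp Ox.
  by rewrite dotNl mulNr -opprD.
rewrite -(gint_ext F E); apply: (green_ge (smoothN oO sp) s2 ns).
- apply: (gintegrable_ext mO _ i1) => x _.
  by rewrite /enorm scaleNr dotNl dotNr opprK.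
- by apply: (gintegrable_ext mO _ (gintegrableN mO i2)) => x Ox; exact/esym/E.
Qed.

End green.

(** * The divergence identity and the Bochner inequality for s *)

Section static.
Context {R : realType} {d : nat}.
Variables (Om : set 'rV[R]_d) (F s : 'rV[R]_d -> R) (k : R).
Hypotheses (oO : open Om) (cO : segment_convex Om)
  (F2 : smooth_upto Om (closure Om) 2 F) (green : gauss_green Om F)
  (s3 : smooth_upto Om (closure Om) 3 s) (s_gt0 : forall x, Om x -> 0 < s x)
  (tr_gt0 : forall x, closure Om x -> 0 < trace Om s x) (ns : neumann Om s).

Let mO : measurable Om := rV_open_measurable oO.
Let mF : measurable_fun Om F := smooth_measurable oO F2.
Let wt x := s x `^ k.
Let q x := dot (grad s x) (grad s x).
Let z x := q x / s x.
Let l := lapg F s.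
Let hf x := hess_form s x (grad s x).

Hypotheses (iK : gintegrable Om F (fun x => wt x * q x))
  (iH : gintegrable Om F (fun x => wt x * hess_norm2 s x))
  (iA : gintegrable Om F (fun x => wt x * l x ^+ 2))
  (iQ : gintegrable Om F (fun x => wt x * hess_form F x (grad s x)))
  (iL : gintegrable Om F (fun x => wt x * z x ^+ 2)).

Let s2 : smooth_upto Om (closure Om) 2 s. Proof. exact: smoothW s3. Qed.
Let s1 : smooth_upto Om (closure Om) 1 s. Proof. exact: smoothW s3. Qed.
Let F1 : smooth_upto Om (closure Om) 1 F. Proof. exact: smoothW F2. Qed.
Let swt : smooth_upto Om (closure Om) 3 wt. Proof. exact: smooth_powR. Qed.
Let swt1 : smooth_upto Om (closure Om) 1 wt. Proof. exact: smoothW swt. Qed.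
Let sq : smooth_upto Om (closure Om) 2 q.
Proof. exact: (smooth_dot oO (fun i => smooth_grad i s3) (fun i => smooth_grad i s3)). Qed.
Let sinv : smooth_upto Om (closure Om) 3 (fun x => (s x)^-1).
Proof. exact: smooth_inv. Qed.
Let sz : smooth_upto Om (closure Om) 2 z.
Proof. exact: (smoothM oO sq (smoothW (isT : (2 <= 3)%N) sinv)). Qed.
Let sz1 : smooth_upto Om (closure Om) 1 z. Proof. exact: smoothW sz. Qed.
Let sq1 : smooth_upto Om (closure Om) 1 q. Proof. exact: smoothW sq. Qed.
Let sinv1 : smooth_upto Om (closure Om) 1 (fun x => (s x)^-1).
Proof. exact: smoothW sinv. Qed.
Let sl : smooth_upto Om (closure Om) 1 l.
Proof. exact: smooth_lapg. Qed.
Let shf : smooth_upto Om (closure Om) 1 hf.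
Proof.
exact: (smooth_dot oO (fun i => smooth_dgrad i oO s3) (fun i => smooth_grad i s2)).
Qed.

Let wt0 x : 0 <= wt x. Proof. exact: powR_ge0. Qed.

Let smooth0_measurable m f : smooth_upto Om (closure Om) m f -> measurable_fun Om f.
Proof. exact: smooth_measurable. Qed.

Lemma static_iB : gintegrable Om F (fun x => wt x * z x * l x).
Proof.
apply: (gintegrable_le mO mF _ _ (gintegrableD mO iL iA)).
  exact: (smooth0_measurable (smoothM oO (smoothM oO swt1 sz1) sl)).
move=> x Ox; rewrite -mulrDr -mulrA normrM (ger0_norm (wt0 x)) ler_wpM2l//.
by apply: amgm_abs; rewrite ?sqr_ge0// exprMn.
Qed.

Lemma static_iC : gintegrable Om F (fun x => wt x / s x * hf x).
Proof.
apply: (gintegrable_le mO mF _ _ (gintegrableD mO iH iL)).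
  exact: (smooth0_measurable (smoothM oO (smoothM oO swt1 sinv1) shf)).
move=> x Ox; rewrite -mulrDr -mulrA normrM (ger0_norm (wt0 x)) ler_wpM2l//.
apply: amgm_abs; rewrite ?sqr_ge0 ?hess_norm2_ge0//.
rewrite exprMn mulrC /z exprMn [leRHS]mulrA ler_wpM2r ?sqr_ge0//.
exact: hess_form_CS.
Qed.

Lemma static_flux (psi : 'rV[R]_d -> R) : smooth_upto Om (closure Om) 1 psi ->
  gintegrable Om F (fun x => wt x * psi x ^+ 2) ->
  gintegrable Om F (fun x => enorm ((wt x * psi x) *: grad s x)).
Proof.
move=> sp ip; apply: (gintegrable_le mO mF _ _ (gintegrableD mO ip iK)).
  apply: measurable_enorm.
  under eq_fun do rewrite dotZl dotZr; have swp := smoothM oO swt1 sp.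
  exact: (smooth0_measurable (smoothM oO swp (smoothM oO swp sq1))).
move=> x Ox; rewrite -mulrDr ger0_norm ?sqrtr_ge0//.
exact: enorm_scale_le.
Qed.

Let derivable_s x i : Om x -> derivable s x (delta_mx 0 i).
Proof. exact: smooth_derivable s1. Qed.

Lemma partial_sqr_grad x i : Om x -> partial i q x = 2 * dgrad s x 0 i.
Proof.
move=> Ox; rewrite dgradE mulr_sumr.
have dg j : derivable (partial j s) x (delta_mx 0 i).
  exact: smooth_derivable (smooth_partial j s2) Ox.
have -> : q = (fun y => \sum_j partial j s y * partial j s y).
  by apply/funext => y; apply: eq_bigr => j _; rewrite mxE.
rewrite partial_sum => [|j]; last by apply: derivableM; exact: dg.
apply: eq_bigr => j _; rewrite (partialM (dg j) (dg j)).
have <- : partial i (partial j s) x = partial j (partial i s) x by exact: derive_sym s2 Ox.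
have alg (a b : R) : a * b + b * a = 2 * (a * b) by ring.
exact: alg.
Qed.

Let gradwt x : Om x -> grad wt x = (k * (wt x / s x)) *: grad s x.
Proof.
move=> Ox; rewrite grad_powR//; last 2 first.
- by move=> i; exact: derivable_s.
- exact: s_gt0.
congr (_ *: _); congr (k * _); rewrite powRB ?powRr1//; first exact/ltW/s_gt0.
by apply/implyP => _; rewrite gt_eqF// s_gt0.
Qed.

Lemma static_identity :
  gint Om F (fun x => wt x * z x * l x) +
  2 * gint Om F (fun x => wt x / s x * hf x) +
  (k - 1) * gint Om F (fun x => wt x * z x ^+ 2) = 0.
Proof.
have iB := static_iB; have iC := static_iC.
have sphi : smooth_upto Om (closure Om) 1 (fun x => wt x * z x).
  exact: (smoothM oO swt1 sz1).
have E : {in Om, (fun x => wt x * z x * l x + 2 * (wt x / s x * hf x)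
       + (k - 1) * (wt x * z x ^+ 2)) =1
    (fun x => (wt x * z x) * lapg F s x + dot (grad (fun y => wt y * z y) x) (grad s x))}.
  move=> x; rewrite inE => Ox; rewrite -addrA; congr (_ + _).
  have sx := s_gt0 Ox; have sn0 : s x != 0 by rewrite gt_eqF.
  have dwt i : derivable wt x (delta_mx 0 i) by exact: smooth_derivable swt1 Ox.
  have dq i : derivable q x (delta_mx 0 i) by exact: smooth_derivable sq Ox.
  have dinv i : derivable (fun y => (s y)^-1) x (delta_mx 0 i).
    exact: smooth_derivable sinv Ox.
  have pinv i : partial i (fun y => (s y)^-1) x = - (s x) ^- 2 * partial i s x.
    rewrite /partial (deriveV sn0 (@derivable_s x i Ox)).
    by rewrite /GRing.scale/=.
  have -> : grad (fun y => wt y * z y) x =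
      (k * (wt x / s x) * z x - wt x * q x / s x ^+ 2) *: grad s x
      + (2 * (wt x / s x)) *: dgrad s x.
    apply/rowP => i.
    have -> : grad (fun y => wt y * z y) x 0 i = partial i (fun y => wt y * z y) x.
      by rewrite mxE.
    rewrite partialM//; last by apply: derivableM; [exact: dq|exact: dinv].
    rewrite (partialM (dq i) (dinv i)) pinv partial_sqr_grad//.
    have -> : partial i wt x = grad wt x 0 i by rewrite mxE.
    rewrite gradwt//.
    have EZ (c : R) (u : 'rV[R]_d) : (c *: u) 0 i = c * u 0 i by rewrite mxE.
    have -> (u v : 'rV[R]_d) : (u + v) 0 i = u 0 i + v 0 i by rewrite mxE.
    rewrite !EZ; have -> : grad s x 0 i = partial i s x by rewrite mxE.
    move: (partial i s x) (dgrad s x 0 i) => p1 p2; rewrite /z.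
    by move: (wt x) (q x) sn0 => w1 q1 sn0; field.
  rewrite dotDl !dotZl -/(q x).
  have -> : dot (dgrad s x) (grad s x) = hf x by [].
  by rewrite /z; move: (wt x) (q x) (hf x) sn0 => w1 q1 h1 sn0; field.
have i2 : gintegrable Om F (fun x => (wt x * z x) * lapg F s x +
    dot (grad (fun y => wt y * z y) x) (grad s x)).
  apply: (gintegrable_ext mO E); apply: gintegrableD => //.
    by apply: gintegrableD => //; exact: gintegrableZ.
  exact: gintegrableZ.
have := green_tangential oO green sphi s2 ns (static_flux sz1 iL) i2.
rewrite -(gint_ext F E) !(gintD mO) ?(gintZ mO)//.
- exact: gintegrableZ.
- by apply: gintegrableD => //; exact: gintegrableZ.
- exact: gintegrableZ.
Qed.

Lemma static_bochner :
  0 <= gint Om F (fun x => wt x * l x ^+ 2) - gint Om F (fun x => wt x * hess_norm2 s x)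
    - gint Om F (fun x => wt x * hess_form F x (grad s x))
    + k * (gint Om F (fun x => wt x * z x * l x) - gint Om F (fun x => wt x / s x * hf x)).
Proof.
have iB := static_iB; have iC := static_iC.
pose Y x := l x *: grad s x - dgrad s x.
pose X x := wt x *: Y x.
have sY i : smooth_upto Om (closure Om) 1 (fun x => Y x 0 i).
  have -> : (fun x => Y x 0 i) = (fun x => l x * partial i s x - dgrad s x 0 i).
    apply/funext => x; rewrite [Y x 0 i]mxE [(l x *: grad s x) 0 i]mxE [grad s x 0 i]mxE.
    by rewrite [(- dgrad s x) 0 i]mxE.
  exact: (smoothB oO (smoothM oO sl (smooth_partial i s2)) (smooth_dgrad i oO s3)).
have E : {in Om, (fun x => (wt x * l x ^+ 2 - wt x * hess_norm2 s x -
      wt x * hess_form F x (grad s x)) + k * (wt x * z x * l x - wt x / s x * hf x)) =1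
    divg F X}.
  move=> x; rewrite inE => Ox.
  rewrite /X divg_scale; last 2 first.
  - by move=> i; exact: smooth_derivable swt1 Ox.
  - by move=> i; exact: smooth_derivable (sY i) Ox.
  rewrite (divg_bochner oO s3 F2 Ox) gradwt// /Y dotZl dotBr dotZr.
  rewrite (dotC (grad s x) (dgrad s x)) -/(q x).
  have -> : dot (dgrad s x) (grad s x) = hf x by [].
  by rewrite /z /l; move: (wt x) (q x) (hf x) => w1 q1 h1; ring.
have iAH := gintegrableB mO iA iH.
have iAHQ := gintegrableB mO iAH iQ.
have iBC := gintegrableB mO iB iC.
have ikBC := gintegrableZ mO k iBC.
have iX := gintegrable_ext mO E (gintegrableD mO iAHQ ikBC).
suff : 0 <= gint Om F (divg F X).
  rewrite -(gint_ext F E) (gintD mO iAHQ ikBC) (gintB mO iAH iQ) (gintB mO iA iH).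
  by rewrite (gintZ mO k iBC) (gintB mO iB iC).
apply: green; [| |exact: iX|].
- move=> i; apply/Ck_uptoP; under eq_fun do rewrite mxE.
  exact: (smoothM oO swt1 (sY i)).
(* |Y|^2 <= 2 (l^2 + |D^2 s|^2) q <= (l^2 + |D^2 s|^2 + q)^2, so three of the integrability
   hypotheses bound the flux. *)
- apply: (gintegrable_le mO mF _ _ (gintegrableD mO (gintegrableD mO iA iH) iK)).
    apply: measurable_enorm.
    under eq_fun do rewrite dotZl dotZr.
    exact: (smooth0_measurable (smoothM oO swt1 (smoothM oO swt1 (smooth_dot oO sY sY)))).
  move=> x Ox; rewrite -!mulrDr ger0_norm ?sqrtr_ge0//.
  apply: enorm_le.
    by rewrite mulr_ge0// !addr_ge0 ?sqr_ge0 ?hess_norm2_ge0 ?dot_ge0.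
  rewrite dotZl dotZr mulrA -expr2 exprMn ler_wpM2l ?sqr_ge0//.
  have b1 : dot (dgrad s x) (dgrad s x) <= hess_norm2 s x * q x by exact: dot_mulmx_hess.
  have b2 : dot (l x *: grad s x) (l x *: grad s x) = l x ^+ 2 * q x.
    by rewrite dotZl dotZr mulrA -expr2.
  have b3 : dot (Y x) (Y x) <= 2 * (l x ^+ 2 * q x) + 2 * dot (dgrad s x) (dgrad s x).
    rewrite -b2 /Y; set a := l x *: _; set b := dgrad s x.
    have := dot_ge0 (a + b).
    rewrite !(dotDl, dotDr, dotNl, dotNr) (dotC b a).
    by move: (dot a a) (dot a b) (dot b b) => a1 a2 a3; lra.
  apply: le_trans b3 _; have h0 := hess_norm2_ge0 s x; have q0 : 0 <= q x by exact: dot_ge0.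
  have l0 := sqr_ge0 (l x).
  move: b1 h0 q0 l0; rewrite -/(q x).
  move: (dot _ _) (hess_norm2 s x) (q x) (l x ^+ 2) => b h q0 l0 b1 h0 q00 l00.
  have : 0 <= (l0 + h) * (l0 + h) by rewrite mulr_ge0// addr_ge0.
  have : 0 <= q0 * q0 by rewrite mulr_ge0.
  by rewrite !expr2; lra.
(* The part of the flux along Ds vanishes by the Neumann condition, and the part along D^2 s Ds has
   the sign given by convexity. *)
- move=> x nu bdx onu; have clx : closure Om x by case: bdx.
  have E1 i : trace Om (fun y => X y 0 i) x = trace Om wt x *
     (trace Om l x * trace Om (partial i s) x -
      \sum_j trace Om (partial j s) x * trace Om (partial j (partial i s)) x).
    have -> : (fun y => X y 0 i) = (fun y => wt y * (l y * partial i s y -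
        \sum_j partial j s y * partial j (partial i s) y)).
      apply/funext => y; rewrite -dgradE [X y 0 i]mxE [Y y 0 i]mxE [(l y *: grad s y) 0 i]mxE.
      by rewrite [grad s y 0 i]mxE [(- dgrad s y) 0 i]mxE.
    have sa : smooth_upto Om (closure Om) 1 (fun y => l y * partial i s y).
      exact: (smoothM oO sl (smooth_partial i s2)).
    have sb j : smooth_upto Om (closure Om) 1 (fun y => partial j s y * partial j (partial i s) y).
      exact: (smoothM oO (smooth_partial j s2) (smooth_partial j (smooth_partial i s3))).
    have sbs : smooth_upto Om (closure Om) 1
        (fun y => \sum_j partial j s y * partial j (partial i s) y) by exact: (smooth_sum _ oO sb).
    rewrite (traceM swt1 (smoothB oO sa sbs) clx) (traceB sa sbs clx).
    rewrite (traceM sl (smooth_partial i s2) clx) (trace_sum _ sb clx).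
    congr (_ * (_ - _)); apply: eq_bigr => j _.
    by rewrite (traceM (smooth_partial j s2) (smooth_partial j (smooth_partial i s3)) clx).
  rewrite /normal_trace; under eq_bigr do rewrite E1 -mulrA mulrBl -mulrA.
  rewrite -mulr_sumr sumrB -mulr_sumr (ns bdx onu) mulr0 sub0r.
  rewrite mulr_ge0 ?oppr_ge0//.
    by rewrite (trace_powR _ s3 (tr_gt0 clx) clx) powR_ge0.
  exact: (neumann_convex_flux oO cO s2 ns bdx onu).
Qed.

End static.

(** * The quotient lambda1 *)

Section compact_support.
Context {R : realType} {d : nat}.
Variables (Om : set 'rV[R]_d).
Hypothesis oO : open Om.
Implicit Types (f g : 'rV[R]_d -> R) (K : set 'rV[R]_d).
Local Notation mu := (@lebesgue_rV R d).

Let mO : measurable Om := rV_open_measurable oO.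

Lemma compact_rV_closed K : compact K -> closed K.
Proof. by move=> cK; apply: compact_closed => //; exact: norm_hausdorff. Qed.

Lemma continuous_compact_bound g K : compact K -> K `<=` Om ->
  (forall x, Om x -> {for x, continuous g}) ->
  exists2 C : R, 0 <= C & forall x, K x -> `|g x| <= C.
Proof.
move=> cK KO cg.
have : compact (g @` K).
  apply: continuous_compact => //; apply: continuous_in_subspaceT => x.
  by rewrite inE => Kx; apply: cg; exact: KO.
move=> /compact_bounded[M [_ HM]]; exists (`|M| + 1) => [|x Kx].
  by rewrite addr_ge0.
apply: (HM (`|M| + 1)); last by exists x.
by rewrite (le_lt_trans (ler_norm _))// ltrDl.
Qed.

Lemma compact_lebesgue_lty K : compact K -> (mu K < +oo)%E.
Proof.
move=> cK; have /compact_bounded[M [_ HM]] := cK.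
have KM : K `<=` rV_cube d (`|M| + 1).
  move=> x Kx i; apply: le_trans (rV_coord_le_norm x i) _.
  by apply: (HM (`|M| + 1)) => //; rewrite (le_lt_trans (ler_norm _))// ltrDl.
apply: le_lt_trans (lebesgue_rV_cube d (`|M| + 1)).
apply: le_measure => //; rewrite inE; apply: rV_closed_measurable.
  exact: compact_rV_closed.
exact: closed_rV_cube.
Qed.

Lemma integrable_on_compact f g K : measurable_fun Om f ->
  (forall x, Om x -> `|f x| <= g x) -> (forall x, Om x -> {for x, continuous g}) ->
  compact K -> K `<=` Om -> mu.-integrable K (EFin \o f).
Proof.
move=> mf fg cg cK KO.
have mK : measurable K by apply: rV_closed_measurable; exact: compact_rV_closed.
have mfK : measurable_fun K f by exact: measurable_funS mf.
have [C C0 HC] := continuous_compact_bound cK KO cg.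
apply/integrableP; split; first exact/measurable_EFinP.
apply: (@le_lt_trans _ _ (C%:E * mu K)%E).
  apply: integral_le_bound => //; first exact/measurable_EFinP.
  apply: aeW => x Kx /=; rewrite lee_fin; apply: le_trans (fg _ (KO _ Kx)) _.
  by apply: le_trans (ler_norm _) _; exact: HC.
by rewrite lte_mul_pinfty//; exact: compact_lebesgue_lty.
Qed.

Lemma integrable_compact_support f g K : measurable_fun Om f ->
  (forall x, Om x -> `|f x| <= g x) -> (forall x, Om x -> {for x, continuous g}) ->
  compact K -> K `<=` Om -> (forall x, ~ K x -> f x = 0) ->
  mu.-integrable Om (EFin \o f).
Proof.
move=> mf fg cg cK KO f0.
have mK : measurable K by apply: rV_closed_measurable; exact: compact_rV_closed.
have := integrable_on_compact mf fg cg cK KO.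
move=> /(integrable_mkcond _ mK) h; apply/(integrable_mkcond _ mO).
rewrite (_ : _ \_ Om = (EFin \o f) \_ K)//; apply/funext => x; rewrite !patchE.
have [xK|xK] := boolP (x \in K).
  by rewrite ifT//; move: xK; rewrite !inE; exact: KO.
case: ifP => // _; rewrite /= f0//; move: xK; rewrite notin_setE; exact.
Qed.

Lemma continuous_normr f x : {for x, continuous f} -> {for x, continuous (fun y => `|f y|)}.
Proof. by move=> cf; apply: (@cvg_norm _ _ _ (nbhs x)). Qed.

End compact_support.

Section test_functions.
Context {R : realType} {d : nat}.
Variables (Om : set 'rV[R]_d) (F : 'rV[R]_d -> R).
Hypotheses (oO : open Om) (F2 : smooth_upto Om (closure Om) 2 F)
  (green : gauss_green Om F).
Local Notation mu := (@lebesgue_rV R d).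

Let mO : measurable Om := rV_open_measurable oO.
Let F1 : smooth_upto Om (closure Om) 1 F. Proof. exact: smoothW F2. Qed.

Lemma test_function_smooth A k (phi : 'rV[R]_d -> R) :
  test_function Om phi -> smooth_upto Om A k phi.
Proof.
move=> [sphi _]; apply/Ck_uptoP; split=> [vs hvs x _|vs hvs x _].
  by have [h1 h2] := sphi k vs hvs x Logic.I; split.
have [h1 _] := sphi k vs hvs x Logic.I.
by apply/cvg_ex; exists (iter_derive vs phi x); exact: cvg_within_filter h1.
Qed.

Lemma partial_off_support (phi : 'rV[R]_d -> R) (K : set 'rV[R]_d) (i : 'I_d) :
  compact K -> (forall x, ~ K x -> phi x = 0) -> forall x, ~ K x -> partial i phi x = 0.
Proof.
move=> cK phi0 x Kx; have oK : open (~` K) by apply: closed_openC; exact: compact_rV_closed.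
have E : {in ~` K, phi =1 cst 0} by move=> y; rewrite inE => Ky; rewrite phi0.
have := derive_ext_on (delta_mx 0 i) oK E; rewrite /partial => ->.
  exact: derive_cst.
by rewrite inE.
Qed.

(** Gauss-Green for the field e^F v phi e_i, which vanishes near the boundary. The factor e^F
    cancels the weight, both in the measure and in the drift term. Nonnegativity for v = u and for v
    = - u gives equality. *)
Lemma ibp_test (u phi : 'rV[R]_d -> R) (i : 'I_d) :
  smooth_upto Om (closure Om) 1 u -> test_function Om phi ->
  \int[mu]_(x in Om) (u x * partial i phi x + partial i u x * phi x) = 0.
Proof.
move=> su tphi; have sphi := test_function_smooth (closure Om) 1 tphi.
have [K [cK KO phi0]] := tphi.2.
have dphi0 := partial_off_support i cK phi0.
pose h x := u x * partial i phi x + partial i u x * phi x.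
have cont v : smooth_upto Om (closure Om) 1 v -> smooth_upto Om (closure Om) 0
    (fun x => v x * partial i phi x + partial i v x * phi x).
  move=> sv; have sv0 : smooth_upto Om (closure Om) 0 v by exact: (smoothW (leq0n 1) sv).
  have sp0 : smooth_upto Om (closure Om) 0 phi by exact: (smoothW (leq0n 1) sphi).
  have dv := smooth_derive (delta_mx 0 i) sv.
  have dp := smooth_derive (delta_mx 0 i) sphi.
  exact: (smoothD oO (smoothM oO sv0 dp) (smoothM oO dv sp0)).
have mono v : smooth_upto Om (closure Om) 1 v ->
    0 <= \int[mu]_(x in Om) (v x * partial i phi x + partial i v x * phi x).
  move=> sv; pose eF x := expR (F x).
  pose psi x := eF x * (v x * phi x).
  have seF : smooth_upto Om (closure Om) 1 eF by exact: smooth_expR.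
  have svp := smoothM oO sv sphi.
  have spsi : smooth_upto Om (closure Om) 1 psi by exact: (smoothM oO seF svp).
  pose c : 'rV[R]_d := delta_mx 0 i.
  pose X x : 'rV[R]_d := psi x *: c.
  pose g x := v x * partial i phi x + partial i v x * phi x.
  have dX : {in Om, divg F X =1 (fun x => eF x * g x)}.
    move=> x; rewrite inE => Ox.
    rewrite /X divg_scale; last 2 first.
    - by move=> j; exact: smooth_derivable spsi Ox.
    - by move=> j; exact: derivable_cst.
    have -> : divg F (fun=> c) x = - partial i F x.
      rewrite /divg big1 ?sub0r => [|j _]; last by rewrite /partial derive_cst.
      congr (- _); rewrite dotC /dot (bigD1 i)//= big1 ?addr0 => [|j ji].
        by rewrite !mxE !eqxx mul1r.
      by rewrite !mxE (negbTE ji) andbF mul0r.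
    have -> : dot (grad psi x) c = partial i psi x.
      rewrite dotC /dot (bigD1 i)//= big1 ?addr0 => [|j ji].
        by rewrite !mxE !eqxx mul1r.
      by rewrite !mxE (negbTE ji) andbF mul0r.
    have dv : derivable v x (delta_mx 0 i) by exact: smooth_derivable sv Ox.
    have dp : derivable phi x (delta_mx 0 i) by exact: smooth_derivable sphi Ox.
    have dF : derivable F x (delta_mx 0 i) by exact: smooth_derivable F1 Ox.
    have deF : derivable eF x (delta_mx 0 i) by exact: smooth_derivable seF Ox.
    have dvp : derivable (fun y => v y * phi y) x (delta_mx 0 i).
      exact: smooth_derivable svp Ox.
    have peF : partial i eF x = eF x * partial i F x.
      by have [_ E] := is_derive_comp1 (is_derive_expR (F x)) (derivableP dF).
    rewrite /psi (partialM deF dvp) (partialM dv dp) peF /g.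
    move: (partial i F x) (partial i v x) (partial i phi x) => p1 p2 p3.
    by ring.
  have cg x : Om x -> {for x, continuous g}.
    by move=> Ox; exact: smooth_cont (cont v sv) Ox.
  have cpsi x : Om x -> {for x, continuous psi} by move=> Ox; exact: smooth_cont spsi Ox.
  have mg : measurable_fun Om g by exact: open_continuous_measurable_rV.
  have g0 x : ~ K x -> g x = 0.
    by move=> Kx; rewrite /g phi0// dphi0// !mulr0 addr0.
  have weight x : eF x * g x * expR (- F x) = g x.
    by rewrite mulrAC -expRD subrr expR0 mul1r.
  have iX : gintegrable Om F (divg F X).
    apply: (gintegrable_ext mO (fun x Ox => esym (dX x Ox))).
    rewrite /gintegrable; under eq_fun do rewrite weight.
    apply: (integrable_compact_support oO mg (g := fun x => `|g x|) _ _ cK KO) => //.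
    by move=> x Ox; exact: (continuous_normr (cg _ Ox)).
  have := green (X := X); have -> : gint Om F (divg F X) = \int[mu]_(x in Om) g x.
    rewrite (gint_ext F dX) /gint; apply: eq_Rintegral => x _; exact: weight.
  apply => //.
  - move=> j; apply/Ck_uptoP.
    have -> : (fun x => X x 0 j) = (fun x => c 0 j * psi x).
      by apply/funext => x; rewrite [LHS]mxE mulrC.
    exact: smoothZ.
  - have cf x : Om x -> {for x, continuous (fun x => `|psi x| * expR (- F x))}.
      move=> Ox; have cF := smooth_cont (smooth_expR oO (smoothN oO F1)) Ox.
      exact: (@cvgM _ _ (nbhs x) _ _ _ _ _ (continuous_normr (cpsi _ Ox)) cF).
    rewrite /gintegrable.
    have -> : (fun x => (enorm (X x) * expR (- F x))%:E) =
        EFin \o (fun x => `|psi x| * expR (- F x)).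
      apply/funext => x /=; congr (_ * _)%:E; rewrite /enorm /X dotZl dotZr.
      rewrite (_ : dot c c = 1) ?mulr1 -?expr2 ?sqrtr_sqr//.
      rewrite /dot (bigD1 i)//= big1 ?addr0 => [|j ji].
        by rewrite !mxE !eqxx mul1r.
      by rewrite !mxE (negbTE ji) andbF mul0r.
    apply: (integrable_compact_support oO _ (g := fun x => `|psi x| * expR (- F x)) _ cf cK KO).
    - exact: open_continuous_measurable_rV.
    - by move=> x _; rewrite ger0_norm// mulr_ge0// expR_ge0.
    - by move=> x Kx; rewrite /psi phi0// !mulr0 normr0 mul0r.
  - move=> x nu [clx nOx] _; rewrite /normal_trace big1// => j _.
    rewrite (@traceE _ _ _ _ _ 0) ?mul0r//.
    have Kx : ~ K x by move=> /KO.
    have nK : nbhs x (~` K).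
      by apply: open_nbhs_nbhs; split => //; apply: closed_openC; exact: compact_rV_closed.
    apply: cvg_within_filter.
    apply: cvg_near_cst; apply: filterS nK => y Ky.
    by rewrite /X mxE /psi phi0// !mulr0 mul0r.
apply/eqP; rewrite eq_le mono// andbT.
have := mono _ (smoothN oO su).
have -> : \int[mu]_(x in Om) ((fun x => - u x) x * partial i phi x +
    partial i (fun x => - u x) x * phi x) = - \int[mu]_(x in Om) h x.
  rewrite -mulN1r -RintegralZl; last 2 first.
  - exact: mO.
  - have mh : forall x, Om x -> {for x, continuous h}.
      by move=> x Ox; exact: smooth_cont (cont u su) Ox.
    apply: (integrable_compact_support oO _ (g := fun x => `|h x|) _ _ cK KO) => //.
    + exact: open_continuous_measurable_rV.
    + by move=> x Ox; exact: (continuous_normr (mh _ Ox)).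
    + by move=> x Kx; rewrite /h phi0// dphi0// !mulr0 addr0.
  apply: eq_Rintegral => x; rewrite inE => Ox.
  rewrite /partial deriveN; last exact: smooth_derivable su Ox.
  by rewrite /h mulN1r !mulNr -opprD.
by rewrite oppr_ge0.
Qed.

End test_functions.

Section sqrt_bounds.
Context {R : realType}.

Lemma sqrt_add_cvg (a : R) : 0 <= a ->
  (fun n => Num.sqrt (a + harmonic n)) @ \oo --> Num.sqrt a.
Proof.
move=> a0; apply: (continuous_cvg _ (@sqrt_continuous R a)).
rewrite -[X in _ --> X]addr0; apply: cvgD; first exact: cvg_cst.
exact: cvg_harmonic.
Qed.

(** Where a = 0 the hypothesis forces b = 0, so every quotient is 0 and so is the limit, whatever
    the inverse of 0 is. *)
Lemma div_sqrt_cvg (a b h : R) : 0 <= a -> b ^+ 2 <= a * h ->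
  (fun n => b / Num.sqrt (a + harmonic n)) @ \oo --> b / Num.sqrt a.
Proof.
move=> a0 bah; have [a00|a1] := eqVneq a 0.
  have -> : b = 0.
    by apply/eqP; rewrite -sqrf_eq0 eq_le sqr_ge0 andbT (le_trans bah)// a00 mul0r.
  by under eq_fun do rewrite mul0r; rewrite mul0r; exact: cvg_cst.
apply: cvgM; first exact: cvg_cst.
apply: cvgV; last exact: sqrt_add_cvg.
by rewrite sqrtr_eq0 -ltNge lt_neqAle eq_sym a1.
Qed.

(** The quotient is at most sqrt h, uniformly in e, and sqrt h <= 1 + h. *)
Lemma div_sqrt_bound (a b h e : R) : 0 <= a -> 0 <= h -> 0 <= e -> b ^+ 2 <= a * h ->
  `|b / Num.sqrt (a + e)| <= 1 + h.
Proof.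
move=> a0 h0 e0 bah.
have [->|ae] := eqVneq (a + e) 0; first by rewrite sqrtr0 invr0 mulr0 normr0 addr_ge0.
have ae0 : 0 < a + e by rewrite lt_neqAle eq_sym ae addr_ge0.
have r0 : 0 < Num.sqrt (a + e) by rewrite sqrtr_gt0.
rewrite normrM normfV (gtr0_norm r0) ler_pdivrMr//.
rewrite -(@ler_pXn2r _ 2)// ?nnegrE ?mulr_ge0 ?addr_ge0 ?(ltW r0)//.
rewrite real_normK ?num_real// exprMn sqr_sqrtr ?(ltW ae0)//.
move: a0 h0 e0 bah; clear; nra.
Qed.

Lemma sqrt_add_bound (a e : R) : 0 <= a -> 0 <= e <= 1 ->
  `|Num.sqrt (a + e)| <= a + 2.
Proof.
move=> a0 /andP[e0 e1]; rewrite ger0_norm ?sqrtr_ge0//.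
rewrite -(@ler_pXn2r _ 2)// ?nnegrE ?sqrtr_ge0 ?addr_ge0//.
rewrite sqr_sqrtr ?addr_ge0//; move: a0 e0 e1; clear; nra.
Qed.

End sqrt_bounds.

Section weak_gradient.
Context {R : realType} {d : nat}.
Variables (Om : set 'rV[R]_d) (F : 'rV[R]_d -> R).
Hypotheses (oO : open Om) (F2 : smooth_upto Om (closure Om) 2 F)
  (green : gauss_green Om F).
Local Notation mu := (@lebesgue_rV R d).

Let mO : measurable Om := rV_open_measurable oO.

Lemma continuous_forD (f g : 'rV[R]_d -> R) x : {for x, continuous f} ->
  {for x, continuous g} -> {for x, continuous (fun y => f y + g y)}.
Proof. by move=> cf cg; exact: (@cvgD _ _ _ (nbhs x) _ _ _ _ _ cf cg). Qed.

Lemma continuous_forM (f g : 'rV[R]_d -> R) x : {for x, continuous f} ->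
  {for x, continuous g} -> {for x, continuous (fun y => f y * g y)}.
Proof. by move=> cf cg; exact: (@cvgM _ _ (nbhs x) _ _ _ _ _ cf cg). Qed.

Lemma partialDc (f : 'rV[R]_d -> R) (c : R) x i : derivable f x (delta_mx 0 i) ->
  partial i (fun y => f y + c) x = partial i f x.
Proof.
move=> df; have dc : derivable (cst c : 'rV[R]_d -> R) x (delta_mx 0 i).
  exact: derivable_cst.
by rewrite /partial (deriveD df dc) derive_cst addr0.
Qed.

Variables (P Q h : 'rV[R]_d -> R) (D : 'I_d -> 'rV[R]_d -> R).
Hypotheses (sP : smooth_upto Om (closure Om) 1 P) (sQ : smooth_upto Om (closure Om) 1 Q)
  (Q0 : forall x, 0 <= Q x) (QD : forall i x, Om x -> partial i Q x = 2 * D i x)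
  (ch : forall x, Om x -> {for x, continuous h}) (h0 : forall x, 0 <= h x)
  (Dh : forall i x, D i x ^+ 2 <= Q x * h x).

(** The term 1 / (n + 1) keeps the radicand positive, hence [u n] of class C^1. With D_i half the
    derivative of Q, the hypothesis D_i^2 <= Q h bounds D_i / sqrt Q locally, across the zeros of
    Q. *)
Let u n x : R := P x * Num.sqrt (Q x + harmonic n).
Let du n i x : R :=
  partial i P x * Num.sqrt (Q x + harmonic n) + P x * (D i x / Num.sqrt (Q x + harmonic n)).
Let w x : R := P x * Num.sqrt (Q x).
Let dw i x : R := partial i P x * Num.sqrt (Q x) + P x * (D i x / Num.sqrt (Q x)).

Let harm01 n : 0 <= (harmonic n : R) <= 1.
Proof. by rewrite harmonic_ge0/= invf_le1 ?ltr0n// ler1n. Qed.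

Let Qe n : smooth_upto Om (closure Om) 1 (fun x => Q x + harmonic n).
Proof. exact: (smoothD oO sQ (smooth_cst _ _ _ oO)). Qed.

Let Qe0 n x : 0 < Q x + harmonic n.
Proof. by rewrite ltr_wpDl// invr_gt0 ltr0n. Qed.

Let Qe_trace n x : closure Om x -> 0 < trace Om (fun y => Q y + harmonic n) x.
Proof.
move=> clx; apply: (@lt_le_trans _ _ (harmonic n)); first by rewrite invr_gt0 ltr0n.
have PF := within_nbhs_proper clx.
have c := smooth_trace (Qe n) clx.
apply: limr_ge; first by apply/cvg_ex; exists (trace Om (fun y => Q y + harmonic n) x).
by apply: nearW => y; rewrite lerDr.
Qed.

Let sqrtE n : (fun x => Num.sqrt (Q x + harmonic n)) = (fun x => (Q x + harmonic n) `^ 2^-1).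
Proof. by apply/funext => x; rewrite powR12_sqrt// ltW. Qed.

Let ssqrt n : smooth_upto Om (closure Om) 1 (fun x => Num.sqrt (Q x + harmonic n)).
Proof.
rewrite sqrtE.
exact: (smooth_powR _ oO (Qe n) (fun x _ => Qe0 n x) (fun x => @Qe_trace n x)).
Qed.

Let su n : smooth_upto Om (closure Om) 1 (u n).
Proof. exact: (smoothM oO sP (ssqrt n)). Qed.

Let partial_u n i x : Om x -> partial i (u n) x = du n i x.
Proof.
move=> Ox; have dQ := @smooth_derivable _ _ _ _ _ _ _ (delta_mx 0 i) (Qe n) Ox.
have dQ1 := @smooth_derivable _ _ _ _ _ _ _ (delta_mx 0 i) sQ Ox.
have dP := @smooth_derivable _ _ _ _ _ _ _ (delta_mx 0 i) sP Ox.
have ds := @smooth_derivable _ _ _ _ _ _ _ (delta_mx 0 i) (ssqrt n) Ox.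
rewrite /u (partialM dP ds) addrC /du; congr (_ + _ * _).
have -> : partial i (fun y => Num.sqrt (Q y + harmonic n)) x =
    2^-1 * (Q x + harmonic n) `^ (2^-1 - 1) * partial i (fun y => Q y + harmonic n) x.
  by rewrite sqrtE; exact: (partial_powR 2^-1 dQ (Qe0 n x)).
have -> : partial i (fun y => Q y + harmonic n) x = 2 * D i x.
  by rewrite -QD//; exact: (partialDc (harmonic n) dQ1).
have -> : 2^-1 - 1 = - 2^-1 :> R by lra.
rewrite powRN powR12_sqrt ?(ltW (Qe0 n x))//.
by move: (Num.sqrt _)^-1 (D i x) => a b; field.
Qed.

Let measurable_u n : measurable_fun Om (u n).
Proof. exact: (smooth_measurable oO (su n)). Qed.

Let measurable_du n i : measurable_fun Om (du n i).
Proof.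
have := smooth_measurable oO (smooth_partial i (su n)).
by apply: eq_measurable_fun => x; rewrite inE => Ox; exact: partial_u.
Qed.

Let u_cvg x : (fun n => u n x) @ \oo --> w x.
Proof. by apply: cvgM; [exact: cvg_cst|exact: sqrt_add_cvg]. Qed.

Let du_cvg i x : (fun n => du n i x) @ \oo --> dw i x.
Proof.
apply: cvgD; apply: cvgM; [exact: cvg_cst|exact: sqrt_add_cvg|exact: cvg_cst|].
exact: (div_sqrt_cvg (Q0 x) (Dh i x)).
Qed.

Let measurable_w : measurable_fun Om w.
Proof. by apply: (measurable_fun_cvg measurable_u) => x _; exact: u_cvg. Qed.

Let measurable_dw i : measurable_fun Om (dw i).
Proof. by apply: (measurable_fun_cvg (measurable_du^~ i)) => x _; exact: du_cvg. Qed.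

Let bu x := `|P x| * (Q x + 2).
Let bdu i x := `|partial i P x| * (Q x + 2) + `|P x| * (1 + h x).

Let u_bound e x : 0 <= e <= 1 -> `|P x * Num.sqrt (Q x + e)| <= bu x.
Proof. by move=> e01; rewrite normrM ler_wpM2l//; exact: sqrt_add_bound. Qed.

Let du_bound e i x : 0 <= e <= 1 ->
  `|partial i P x * Num.sqrt (Q x + e) + P x * (D i x / Num.sqrt (Q x + e))| <= bdu i x.
Proof.
move=> e01; apply: le_trans (ler_normD _ _) _; rewrite normrM (normrM (P x)) lerD//.
  by rewrite ler_wpM2l//; exact: sqrt_add_bound.
by rewrite ler_wpM2l//; apply: div_sqrt_bound => //; case/andP: e01.
Qed.

Let w_bound x : `|w x| <= bu x.
Proof. by have := @u_bound 0 x; rewrite addr0; apply; rewrite lexx ler01. Qed.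

Let dw_bound i x : `|dw i x| <= bdu i x.
Proof. by have := @du_bound 0 i x; rewrite addr0; apply; rewrite lexx ler01. Qed.

Let cQ x : Om x -> {for x, continuous (fun y => Q y + 2)}.
Proof. move=> Ox; exact: (smooth_cont (smoothD oO sQ (smooth_cst _ _ 2 oO)) Ox). Qed.

Let cbu x : Om x -> {for x, continuous bu}.
Proof.
by move=> Ox; exact: (continuous_forM
  (continuous_normr (smooth_cont sP Ox)) (cQ Ox)).
Qed.

Let cbdu i x : Om x -> {for x, continuous (bdu i)}.
Proof.
move=> Ox; have c1 := continuous_forM
  (continuous_normr (smooth_cont (smooth_partial i sP) Ox)) (cQ Ox).
have c1h : {for x, continuous (fun _ : 'rV[R]_d => 1 : R)} by exact: cst_continuous.
have c2 := continuous_forD c1h (ch Ox).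
have c3 := continuous_forM (continuous_normr (smooth_cont sP Ox)) c2.
exact: (continuous_forD c1 c3).
Qed.

(* The weak gradient of P sqrt(Q), as the limit of that of P sqrt(Q + 1/n). *)
Lemma W11loc_sqrt : W11loc Om w (fun x => \row_i dw i x).
Proof.
have rowE i : (fun x => (\row_j dw j x) 0 i) = dw i by apply/funext => x; rewrite mxE.
split.
- split; first exact: measurable_w.
  by move=> K cK KO;
    exact: (integrable_on_compact oO measurable_w (fun x _ => w_bound x) cbu cK KO).
- move=> i; suff : L1loc Om (dw i) by rewrite -(rowE i).
  split; first exact: measurable_dw.
  move=> K cK KO.
  exact: (integrable_on_compact oO (measurable_dw i) (fun x _ => dw_bound i x)
    (@cbdu i) cK KO).
move=> phi tphi i.
have sphi := test_function_smooth (closure Om) 1 tphi.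
have [K [cK KO phi0]] := tphi.2.
have dphi0 := partial_off_support i cK phi0.
have mphi := smooth_measurable oO sphi.
have mdphi := smooth_measurable oO (smooth_partial i sphi).
pose g x := bu x * `|partial i phi x| + bdu i x * `|phi x|.
have cg x : Om x -> {for x, continuous g}.
  move=> Ox.
  have c1 := continuous_forM (cbu Ox)
    (continuous_normr (smooth_cont (smooth_partial i sphi) Ox)).
  have c2 := continuous_forM (@cbdu i x Ox)
    (continuous_normr (smooth_cont sphi Ox)).
  exact: (continuous_forD c1 c2).
have bu0 x : 0 <= bu x by rewrite mulr_ge0// addr_ge0.
have bdu0 x : 0 <= bdu i x by rewrite addr_ge0// mulr_ge0// addr_ge0.
have g0 x : 0 <= g x by rewrite addr_ge0// mulr_ge0.
have ig : mu.-integrable Om (EFin \o g).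
  apply: (integrable_compact_support oO _ (g := g) _ cg cK KO).
  - exact: open_continuous_measurable_rV.
  - by move=> x _; rewrite ger0_norm.
  - by move=> x Kx; rewrite /g phi0// dphi0// !normr0 !mulr0 addr0.
have bound (a b a' b' c e : R) : `|a| <= a' -> `|b| <= b' ->
    `|a * c + b * e| <= a' * `|c| + b' * `|e|.
  move=> h1 h2; apply: le_trans (ler_normD _ _) _; rewrite !normrM.
  by rewrite lerD// ler_wpM2r.
have mint (f e : 'rV[R]_d -> R) : measurable_fun Om f -> measurable_fun Om e ->
    measurable_fun Om (fun x => (f x * partial i phi x + e x * phi x)%:E).
  move=> mf me; apply/measurable_EFinP.
  by apply: measurable_funD; apply: measurable_funM.
have ifn (f e : 'rV[R]_d -> R) : measurable_fun Om f -> measurable_fun Om e ->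
    (forall x, `|f x| <= bu x) -> (forall x, `|e x| <= bdu i x) ->
    mu.-integrable Om (fun x => (f x * partial i phi x + e x * phi x)%:E).
  move=> mf me hf he; apply: (le_integrable mO (mint _ _ mf me) _ ig) => x Ox /=.
  by rewrite lee_fin (ger0_norm (g0 x)) bound.
have hu n x : `|u n x| <= bu x by exact: u_bound.
have hdu n x : `|du n i x| <= bdu i x by exact: du_bound.
have ibp n : (\int[mu]_(x in Om) (u n x * partial i phi x + du n i x * phi x)%:E = 0)%E.
  have iu := ifn _ _ (measurable_u n) (measurable_du n i) (hu n) (hdu n).
  rewrite -(fineK (integrable_fin_num mO iu)); congr (_%:E).
  rewrite -[RHS](ibp_test oO F2 green i (su n) tphi).
  by apply: eq_Rintegral => x; rewrite inE => Ox; rewrite partial_u.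
have lim0 : (\int[mu]_(x in Om) (w x * partial i phi x + dw i x * phi x)%:E = 0)%E.
  (* The dominating function [g] does not depend on n and is carried by the support K of phi. *)
  have DC := @dominated_cvg _ _ _ mu Om mO
    (fun n x => (u n x * partial i phi x + du n i x * phi x)%:E)
    (fun x => (w x * partial i phi x + dw i x * phi x)%:E) (EFin \o g)
    (fun n => mint _ _ (measurable_u n) (measurable_du n i)).
  have lim1 x : Om x -> (fun n => (u n x * partial i phi x + du n i x * phi x)%:E) @ \oo
      --> (w x * partial i phi x + dw i x * phi x)%:E.
    move=> _; apply: cvg_EFin; first exact: nearW.
    apply: cvgD; apply: cvgM; [exact: u_cvg|exact: cvg_cst|exact: du_cvg|exact: cvg_cst].
  have bd n x : Om x ->
      (`|(u n x * partial i phi x + du n i x * phi x)%:E| <= (EFin \o g) x)%E.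
    by move=> _; rewrite lee_fin bound.
  have := DC lim1 (fun _ _ => isT) ig bd.
  under eq_fun do rewrite ibp.
  move=> /(cvg_lim (@ereal_hausdorff R)) <-.
  by apply: lim_cst; exact: ereal_hausdorff.
have i1 : mu.-integrable Om (EFin \o (fun x => w x * partial i phi x)).
  have := ifn w (cst 0) measurable_w (measurable_cst _) w_bound.
  rewrite (_ : (fun x => _) = EFin \o (fun x => w x * partial i phi x)); last first.
    by apply/funext => x /=; rewrite mul0r addr0.
  by apply=> x; rewrite normr0.
have i2 : mu.-integrable Om (EFin \o (fun x => dw i x * phi x)).
  have := ifn (cst 0) (dw i) (measurable_cst _) (measurable_dw i).
  rewrite (_ : (fun x => _) = EFin \o (fun x => dw i x * phi x)); last first.
    by apply/funext => x /=; rewrite mul0r add0r.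
  by apply=> x; rewrite ?normr0.
have : \int[mu]_(x in Om) (w x * partial i phi x + dw i x * phi x) = 0.
  by rewrite /Rintegral lim0.
rewrite RintegralD// => /eqP; rewrite addr_eq0 => /eqP ->; congr (- _).
by apply: eq_Rintegral => x _; rewrite mxE.
Qed.

End weak_gradient.

(* Monotonicity of the integral, without measurability (V is not assumed
   measurable in rayleigh_num). *)
Lemma le_integral_pointwise {d} {T : measurableType d} {R : realType}
    (mu : {measure set T -> \bar R}) (D : set T) (f g : T -> \bar R) :
  (forall x, D x -> (f x <= g x)%E) ->
  (\int[mu]_(x in D) f x <= \int[mu]_(x in D) g x)%E.
Proof.
move=> fg; rewrite /integral.
have fgD x : ((f \_ D) x <= (g \_ D) x)%E.
  by rewrite !patchE; case: ifPn => //; rewrite inE; exact: fg.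
apply: leeB; apply: le_ereal_sup => _ [h /= hh <-]; exists h => // x.
  apply: le_trans (hh x) _; rewrite !funeposE ge_max !le_max fgD/= lexx orbT//.
apply: le_trans (hh x) _; rewrite !funenegE ge_max !le_max leeN2 fgD/= lexx orbT//.
Qed.

Section vanishing.
Context {R : realType} {d : nat}.
Variables (Om : set 'rV[R]_d) (F : 'rV[R]_d -> R).
Hypotheses (mO : measurable Om) (mF : measurable_fun Om F).

(** Serves the degenerate case in which wt |Ds|^2 has integral 0 and the Rayleigh quotient cannot be
    formed. *)
Lemma gint_vanish (f g : 'rV[R]_d -> R) : measurable_fun Om f -> measurable_fun Om g ->
  (forall x, Om x -> 0 <= f x) -> gintegrable Om F f -> gint Om F f = 0 ->
  (forall x, Om x -> f x = 0 -> g x = 0) -> gint Om F g = 0.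
Proof.
move=> mf mg f0 fi fE fg.
have mw := measurable_gweight mF.
have mfw : measurable_fun Om (fun x => (f x * expR (- F x))%:E).
  by apply/measurable_EFinP; exact: measurable_funM.
have mgw : measurable_fun Om (fun x => (g x * expR (- F x))%:E).
  by apply/measurable_EFinP; exact: measurable_funM.
have f00 : (\int[lebesgue_rV d]_(x in Om) `|(f x * expR (- F x))%:E| = 0)%E.
  rewrite (eq_integral (fun x => (f x * expR (- F x))%:E)); last first.
    move=> x; rewrite inE => Ox.
    by rewrite gee0_abs// lee_fin mulr_ge0 ?expR_ge0// f0.
  by rewrite -(fineK (integrable_fin_num mO fi)); congr (_%:E).
have ae0 := (ae_eq_integral_abs _ mO mfw).1 f00.
rewrite /gint /Rintegral (@ae_eq_integral _ _ _ _ _ (cst 0%E))//.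
  by rewrite integral0.
apply: filterS ae0 => x /= h Ox; have := h Ox => -[/eqP].
rewrite mulf_eq0 (gt_eqF (expR_gt0 _)) orbF => /eqP fx.
by rewrite fg// mul0r.
Qed.

End vanishing.

Lemma regroup_le {R : realType} (k X Y Z T : R) : X <= T ->
  Z + k / 2 * Y + (k / 2 * Y + X) <= T + k * Y + Z.
Proof. by move=> XT; lra. Qed.

Lemma hess_formZ {R : realType} {d : nat} (u : 'rV[R]_d -> R) x (a : R) (xi : 'rV[R]_d) :
  hess_form u x (a *: xi) = a ^+ 2 * hess_form u x xi.
Proof. by rewrite /hess_form -scalemxAl dotZl dotZr mulrA expr2. Qed.

Lemma Vmin_le {R : realType} {d : nat} (F : 'rV[R]_d -> R) (x xi : 'rV[R]_d) :
  Vmin F x * dot xi xi <= hess_form F x xi.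
Proof.
have [->|xi0] := eqVneq xi 0.
  by rewrite /hess_form mul0mx !dot0l mulr0.
have n0 : 0 < dot xi xi by rewrite lt_neqAle dot_ge0 eq_sym dot_eq0 xi0.
pose a := (Num.sqrt (dot xi xi))^-1.
have a2 : a ^+ 2 = (dot xi xi)^-1 by rewrite exprVn sqr_sqrtr ?(ltW n0).
rewrite -ler_pdivlMr// mulrC -a2 -hess_formZ; apply: ge_inf.
  (* A lower bound of the set, needed for the infimum to be meaningful: on unit vectors the form is
     at most |D^2 F| <= 1 + |D^2 F|^2 in absolute value. *)
  exists (- (1 + hess_norm2 F x)) => _ [eta /= eta1 <-].
  have h := hess_form_CS F x eta; rewrite eta1 expr1n mulr1 in h.
  have n1 := hess_norm2_ge0 F x; move: h n1; move: (hess_form F x eta) (hess_norm2 F x).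
  by move=> b n; nra.
by exists (a *: xi) => //=; rewrite dotZl dotZr mulrA -expr2 a2 mulVf// gt_eqF.
Qed.

(** * Testing lambda1 with s^(k/2) |Ds| *)

Section lambda_bound.
Context {R : realType} {d : nat}.
Variables (Om : set 'rV[R]_d) (F s : 'rV[R]_d -> R) (k : R).
Hypotheses (oO : open Om) (cO : segment_convex Om)
  (F2 : smooth_upto Om (closure Om) 2 F) (green : gauss_green Om F)
  (s3 : smooth_upto Om (closure Om) 3 s) (s_gt0 : forall x, Om x -> 0 < s x)
  (tr_gt0 : forall x, closure Om x -> 0 < trace Om s x) (ns : neumann Om s).

Let mO : measurable Om := rV_open_measurable oO.
Let mF : measurable_fun Om F := smooth_measurable oO F2.
Let wt x := s x `^ k.
Let q x := dot (grad s x) (grad s x).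
Let z x := q x / s x.
Let l := lapg F s.
Let hf x := hess_form s x (grad s x).

Hypotheses (iK : gintegrable Om F (fun x => wt x * q x))
  (iH : gintegrable Om F (fun x => wt x * hess_norm2 s x))
  (iA : gintegrable Om F (fun x => wt x * l x ^+ 2))
  (iQ : gintegrable Om F (fun x => wt x * hess_form F x (grad s x)))
  (iL : gintegrable Om F (fun x => wt x * z x ^+ 2)).

Let s2 : smooth_upto Om (closure Om) 2 s. Proof. exact: smoothW s3. Qed.
Let s1 : smooth_upto Om (closure Om) 1 s. Proof. exact: smoothW s3. Qed.
Let swt : smooth_upto Om (closure Om) 3 wt. Proof. exact: smooth_powR. Qed.
Let sq : smooth_upto Om (closure Om) 2 q.
Proof. exact: (smooth_dot oO (fun i => smooth_grad i s3) (fun i => smooth_grad i s3)). Qed.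
Let sinv : smooth_upto Om (closure Om) 3 (fun x => (s x)^-1).
Proof. exact: smooth_inv. Qed.
Let sz : smooth_upto Om (closure Om) 2 z.
Proof. exact: (smoothM oO sq (smoothW (isT : (2 <= 3)%N) sinv)). Qed.
Let shf : smooth_upto Om (closure Om) 1 hf.
Proof.
exact: (smooth_dot oO (fun i => smooth_dgrad i oO s3) (fun i => smooth_grad i s2)).
Qed.
Let shn : smooth_upto Om (closure Om) 1 (hess_norm2 s).
Proof.
apply: (smooth_sum _ oO) => i; apply: (smooth_sum _ oO) => j.
rewrite (_ : (fun x => _) = (fun x => partial i (partial j s) x ^+ 2)); last first.
  by apply/funext => x; rewrite mxE.
exact: (smoothX2 oO (smooth_partial i (smooth_partial j s3))).
Qed.

Let sFF : smooth_upto Om (closure Om) 0 (fun x => hess_form F x (grad s x)).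
Proof.
apply: (smooth_dot oO) => i; last first.
  exact: (smoothW (leq0n 2) (smooth_grad i s3)).
rewrite (_ : (fun x => _) =
    (fun x => \sum_j partial j s x * partial j (partial i F) x)); last first.
  by apply/funext => x; rewrite mxE; apply: eq_bigr => j _; rewrite !mxE.
apply: (smooth_sum _ oO) => j.
exact: (smoothM oO (smoothW (leq0n 2) (smooth_partial j s3))
  (smooth_partial j (smooth_partial i F2))).
Qed.

Let iC := static_iC oO F2 s3 s_gt0 tr_gt0 iH iL.

Let P x := s x `^ (k / 2).
Let sP : smooth_upto Om (closure Om) 3 P. Proof. exact: smooth_powR. Qed.
Let w x := P x * Num.sqrt (q x).
Let G x : 'rV[R]_d := \row_i
  (partial i P x * Num.sqrt (q x) + P x * (dgrad s x 0 i / Num.sqrt (q x))).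
Let U x := wt x * hess_norm2 s x + k * (wt x / s x * hf x) + k ^+ 2 / 4 * (wt x * z x ^+ 2).

Let wt0 x : 0 <= wt x. Proof. exact: powR_ge0. Qed.
Let q0 x : 0 <= q x. Proof. exact: dot_ge0. Qed.

Let W11w : W11loc Om w G.
Proof.
have Dh i x : dgrad s x 0 i ^+ 2 <= q x * hess_norm2 s x.
  apply: le_trans (_ : dot (dgrad s x) (dgrad s x) <= _); last first.
    by rewrite mulrC; exact: dot_mulmx_hess.
  by rewrite /dot (bigD1 i)//= -expr2 lerDl sumr_ge0// => j _; rewrite -expr2 sqr_ge0.
have QD i x : Om x -> partial i q x = 2 * dgrad s x 0 i.
  by move=> Ox; exact: (partial_sqr_grad oO s3 i Ox).
exact: (W11loc_sqrt oO F2 green (smoothW (isT : (1 <= 3)%N) sP) (smoothW (isT : (1 <= 2)%N) sq)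
  q0 QD (fun x Ox => smooth_cont shn Ox) (hess_norm2_ge0 s) Dh).
Qed.

Let PP x : Om x -> P x * P x = wt x.
Proof.
move=> Ox; rewrite /P /wt -powRD; first by congr (_ `^ _); field.
by rewrite (gt_eqF (s_gt0 Ox)) implybT.
Qed.

Let w2E x : Om x -> w x ^+ 2 = wt x * q x.
Proof. by move=> Ox; rewrite /w exprMn sqr_sqrtr// expr2 PP. Qed.

Let partialP i x : Om x -> partial i P x = k / 2 * (P x / s x) * partial i s x.
Proof.
move=> Ox; rewrite /P (partial_powR _ (smooth_derivable s1 Ox) (s_gt0 Ox)).
congr (_ * _); congr (_ * _); rewrite powRB ?powRr1//; first exact/ltW/s_gt0.
by apply/implyP => _; rewrite gt_eqF// s_gt0.
Qed.

(** G is a combination of Ds and D^2 s Ds / |Ds|. Two of the terms of U are exact, and the remaining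
    square uses |D^2 s Ds|^2 <= |D^2 s|^2 |Ds|^2. *)
Let GG_le x : Om x -> dot (G x) (G x) <= U x.
Proof.
move=> Ox; have sx := s_gt0 Ox.
set r := Num.sqrt (q x).
have r2 : r ^+ 2 = q x by rewrite sqr_sqrtr.
have -> : G x = (k / 2 * (P x / s x) * r) *: grad s x + (P x / r) *: dgrad s x.
  apply/rowP => i; rewrite !mxE partialP// -/r.
  by move: (partial i s x) (P x) (dgrad s x 0 i) => p1 p2 p3; ring.
rewrite dotDl !dotDr !dotZl !dotZr (dotC (grad s x) (dgrad s x)).
rewrite -[dot (grad s x) (grad s x)]/(q x) -[dot (dgrad s x) (grad s x)]/(hf x).
have hn : dot (dgrad s x) (dgrad s x) <= hess_norm2 s x * q x by exact: dot_mulmx_hess.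
have hf2 : hf x ^+ 2 <= hess_norm2 s x * q x ^+ 2 by exact: hess_form_CS.
have n0 := hess_norm2_ge0 s x.
rewrite /U /z -PP//; move: (PP Ox) => _.
(* At a critical point of s the inverse of 0 is 0, so G vanishes, while U reduces to the nonnegative
   term wt |D^2 s|^2. *)
have [r0|rN0] := eqVneq r 0.
  have qx0 : q x = 0 by rewrite -r2 r0 expr0n.
  have hf0 : hf x = 0.
    by apply/eqP; rewrite -sqrf_eq0 eq_le sqr_ge0 andbT (le_trans hf2)// qx0 expr0n mulr0.
  rewrite r0 qx0 hf0 invr0 !(mulr0, mul0r, addr0, expr0n)/=.
  by rewrite ?mulr0 ?addr0 mulr_ge0// -expr2 sqr_ge0.
move: (P x) (s x) sx (hf x) (q x) r2 (hess_norm2 s x) n0 hn => p a a0 b c r2 n n0 hn.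
have -> : k / 2 * (p / a) * r * (k / 2 * (p / a) * r * c) = k ^+ 2 / 4 * (p * p * (c / a) ^+ 2).
  by rewrite -r2; field; rewrite gt_eqF.
have e1 : k / 2 * (p / a) * r * (p / r * b) = k / 2 * (p * p / a * b).
  by field; rewrite rN0 gt_eqF.
have e2 : p / r * (k / 2 * (p / a) * r * b) = k / 2 * (p * p / a * b).
  by field; rewrite rN0 gt_eqF.
have e3 : p / r * (p / r * dot (dgrad s x) (dgrad s x)) <= p * p * n.
  rewrite (_ : _ * (_ * _) = p * p * (dot (dgrad s x) (dgrad s x) / c)); last first.
    by rewrite -r2; field.
  by rewrite -expr2 ler_wpM2l ?sqr_ge0// ler_pdivrMr// -r2
    exprn_gt0// lt_neqAle eq_sym rN0 sqrtr_ge0.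
by rewrite e1 e2; exact: (regroup_le _ _ _ e3).
Qed.

Let iU : gintegrable Om F U.
Proof.
have h := gintegrableD mO iH (gintegrableZ mO k iC).
exact: (gintegrableD mO h (gintegrableZ mO (k ^+ 2 / 4) iL)).
Qed.

Let H1w : H1 Om F w G.
Proof.
have [_ mG _] := W11w.
split; first exact: W11w.
- by apply: (gintegrable_ext mO _ iK) => x; rewrite inE => Ox; rewrite w2E.
- apply: (gintegrable_le mO mF _ _ iU) => [|x Ox].
    by apply: measurable_sum => i; apply: measurable_funM; exact: (mG i).1.
  by rewrite ger0_norm ?dot_ge0// GG_le.
Qed.

Lemma lambda1_static (theta lam : R) : theta < 1 -> (lam%:E <= lambda1 Om F theta)%E ->
  lam * gint Om F (fun x => wt x * q x) <=
  (1 - theta) * (gint Om F (fun x => wt x * hess_norm2 s x) +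
    k * gint Om F (fun x => wt x / s x * hf x) +
    k ^+ 2 / 4 * gint Om F (fun x => wt x * z x ^+ 2)) +
  gint Om F (fun x => wt x * hess_form F x (grad s x)).
Proof.
move=> th1 lamle; have th0 : 0 <= 1 - theta by rewrite subr_ge0 ltW.
have K0 : 0 <= gint Om F (fun x => wt x * q x).
  by apply: gint_ge0 => x _; rewrite mulr_ge0.
(* If K = 0 then Ds = 0 almost everywhere, every term that contains Ds integrates to 0, and the
   claim reduces to 0 <= (1 - theta) H. *)
have [K1|] := ltP 0 (gint Om F (fun x => wt x * q x)); last first.
  move=> K1; have K00 : gint Om F (fun x => wt x * q x) = 0.
    by apply/eqP; rewrite eq_le K1.
  have mwt : measurable_fun Om wt := smooth_measurable oO swt.
  have mq : measurable_fun Om q := smooth_measurable oO sq.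
  have van (g : 'rV[R]_d -> R) : measurable_fun Om g ->
      (forall x, q x = 0 -> g x = 0) -> gint Om F g = 0.
    move=> mg qg; apply: (gint_vanish mO mF _ mg _ iK K00).
    - exact: measurable_funM.
    - by move=> x Ox; rewrite mulr_ge0.
    - move=> x Ox /eqP; rewrite mulf_eq0 gt_eqF/= ?powR_gt0 ?s_gt0// => /eqP.
      exact: qg.
  have grad0 x : q x = 0 -> grad s x = 0 by move/eqP; rewrite dot_eq0 => /eqP.
  have C0 : gint Om F (fun x => wt x / s x * hf x) = 0.
    apply: van => [|x /grad0 g0]; last by rewrite /hf g0 /hess_form dotC dot0l mulr0.
    exact: (smooth_measurable oO (smoothM oO (smoothM oO (smoothW (isT : (1 <= 3)%N) swt)
      (smoothW (isT : (1 <= 3)%N) sinv)) shf)).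
  have L0 : gint Om F (fun x => wt x * z x ^+ 2) = 0.
    apply: van => [|x q0x]; last by rewrite /z q0x mul0r expr0n mulr0.
    exact: (smooth_measurable oO (smoothM oO (smoothW (isT : (2 <= 3)%N) swt) (smoothX2 oO sz))).
  have Q0 : gint Om F (fun x => wt x * hess_form F x (grad s x)) = 0.
    apply: van => [|x /grad0 g0]; last by rewrite g0 /hess_form dotC dot0l mulr0.
    exact: (smooth_measurable oO (smoothM oO (smoothW (leq0n 3) swt) sFF)).
  have H0 : 0 <= gint Om F (fun x => wt x * hess_norm2 s x).
    by apply: gint_ge0 => x _; exact: (mulr_ge0 (wt0 x) (hess_norm2_ge0 s x)).
  have fin (K H C L Q : R) : K = 0 -> C = 0 -> L = 0 -> Q = 0 -> 0 <= H ->
      lam * K <= (1 - theta) * (H + k * C + k ^+ 2 / 4 * L) + Q.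
    by move=> -> -> -> -> HH; rewrite !mulr0 !addr0; exact: mulr_ge0.
  exact: (fin _ _ _ _ _ K00 C0 L0 Q0 H0).
have iV := gintegrableD mO (gintegrableZ mO (1 - theta) iU) iQ.
have <- : gint Om F (fun x => (1 - theta) * U x + wt x * hess_form F x (grad s x)) =
    (1 - theta) * (gint Om F (fun x => wt x * hess_norm2 s x) +
    k * gint Om F (fun x => wt x / s x * hf x) +
    k ^+ 2 / 4 * gint Om F (fun x => wt x * z x ^+ 2)) +
    gint Om F (fun x => wt x * hess_form F x (grad s x)).
  rewrite (gintD mO (gintegrableZ mO (1 - theta) iU) iQ) (gintZ mO _ iU).
  rewrite (gintD mO (gintegrableD mO iH (gintegrableZ mO k iC)) (gintegrableZ mO _ iL)).
  by rewrite (gintD mO iH (gintegrableZ mO k iC)) (gintZ mO _ iC) (gintZ mO _ iL).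
set V := fun x => (1 - theta) * U x + wt x * hess_form F x (grad s x).
have w2 : gint Om F (fun x => w x ^+ 2) = gint Om F (fun x => wt x * q x).
  by apply: gint_ext => x; rewrite inE => Ox; rewrite w2E.
have num_le x : Om x -> (rayleigh_num F theta w G x <= (V x * expR (- F x))%:E)%E.
  move=> Ox; rewrite lee_fin ler_wpM2r ?expR_ge0// lerD ?ler_wpM2l ?GG_le//.
  rewrite w2E// mulrCA ler_wpM2l//; exact: Vmin_le.
have step : (lam%:E <= \int[lebesgue_rV d]_(x in Om) rayleigh_num F theta w G x *
    ((gint Om F (fun x => w x ^+ 2))^-1)%:E)%E.
  apply: le_trans lamle _; apply: ereal_inf_lbound; exists w, G; split.
  - exact: H1w.
  - by rewrite w2.
  (* The numerator lies below an integrable function, so its positive part has a finite integral;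
     nothing is claimed about the negative part. *)
  - left; apply: le_lt_trans (_ : (\int[lebesgue_rV d]_(x in Om)
        `|(V x * expR (- F x))%:E| < +oo)%E); last by case/integrableP : iV.
    apply: le_integral_pointwise => x Ox; rewrite funeposE ge_max abse_ge0 andbT.
    by apply: le_trans (num_le _ Ox) _; exact: lee_abs.
  - by [].
have numI : (\int[lebesgue_rV d]_(x in Om) rayleigh_num F theta w G x <=
    (gint Om F V)%:E)%E.
  rewrite /gint /Rintegral (fineK (integrable_fin_num mO iV)).
  exact: le_integral_pointwise.
rewrite -ler_pdivlMr//; rewrite w2 in step.
rewrite -lee_fin EFinM; apply: le_trans step _.
by rewrite lee_wpmul2r// lee_fin invr_ge0.
Qed.

End lambda_bound.

(** * Coercivity *)

Section quadratic_forms.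
Context {R : realType}.

Lemma amgm_abs4 (t a b : R) : 0 <= a -> 0 <= b -> t ^+ 2 <= 4 * (a * b) -> `|t| <= a + b.
Proof.
move=> a0 b0 tab; rewrite -(@ler_pXn2r _ 2)// ?nnegrE ?addr_ge0//.
rewrite real_normK ?num_real//; apply: le_trans tab _.
by rewrite -subr_ge0 (_ : _ - _ = (a - b) ^+ 2) ?sqr_ge0//; ring.
Qed.

(** Completing the square: theta n and b^2 y / (4 theta) together dominate b c, since c^2 <= n y. *)
Lemma quadratic_form_ge (theta b c n y : R) : 0 < theta -> 0 <= n -> 0 <= y ->
  c ^+ 2 <= n * y -> - (b ^+ 2 / (4 * theta)) * y <= theta * n + b * c.
Proof.
move=> th n0 y0 cny; have e0 : 0 <= b ^+ 2 / (4 * theta).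
  by rewrite divr_ge0 ?sqr_ge0// mulr_ge0// ltW.
have h : `|b * c| <= theta * n + b ^+ 2 / (4 * theta) * y.
  apply: (amgm_abs4 (mulr_ge0 (ltW th) n0) (mulr_ge0 e0 y0)).
  have -> : 4 * (theta * n * (b ^+ 2 / (4 * theta) * y)) = b ^+ 2 * (n * y).
    by field; rewrite gt_eqF.
  by rewrite exprMn ler_wpM2l ?sqr_ge0.
have := ler_norm (- (b * c)); rewrite normrN; move: h.
by set N := `|_|; set X := (_ / _) * y => h1 h2; rewrite mulNr -/X; lra.
Qed.

(* The left-hand side is the gap between the two sides of the inequality that
   defines E_theta, up to the factor (2 m + p - 2) ^ 2 / 4. *)
Lemma E_theta_discriminant (theta m p k alpha : R) : 0 < 2 * m + p - 2 ->
  k = (p / 2 + m - 1)^-1 * (m - 1) -> alpha = (p / 2 + m - 1)^-1 * m - 1 ->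
  E_theta theta m p ->
  (2 * (k - alpha) + theta * k) ^+ 2 <
    4 * theta * ((k - alpha) * (k - 1) - (1 - theta) * k ^+ 2 / 4).
Proof.
move=> D0 -> -> E; rewrite -subr_lt0.
have h : p / 2 + m - 1 = (2 * m + p - 2) / 2 by field.
set D := 2 * m + p - 2 in D0 h.
rewrite h [ltLHS](_ : _ = 4 / D ^+ 2 * ((p + 2 * m - 4) ^+ 2 +
  (5 * m ^+ 2 + 2 * (2 * p - 7) * m + (p - 3) ^+ 2) * theta)).
  by rewrite pmulr_rlt0// divr_gt0// exprn_gt0.
have -> : p = D + 2 - 2 * m by rewrite /D; ring.
by move: (D) D0 => D' D0; field; rewrite gt_eqF.
Qed.

(** From A + alpha B, the Bochner inequality removes A, the divergence identity taken alpha - k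
    times removes B, and the bound on lambda1 removes Q. There remain the share theta H of the
    Hessian and the terms b C and e L, whence the formulas for b and e. *)
Lemma coercive_algebra (k alpha theta b e lam A B C H L K Q : R) :
  b = 2 * (k - alpha) + theta * k ->
  e = (k - alpha) * (k - 1) - (1 - theta) * k ^+ 2 / 4 ->
  - (b ^+ 2 / (4 * theta)) * L <= theta * H + b * C ->
  lam * K <= (1 - theta) * (H + k * C + k ^+ 2 / 4 * L) + Q ->
  0 <= A - H - Q + k * (B - C) -> B + 2 * C + (k - 1) * L = 0 ->
  lam * K + (e - b ^+ 2 / (4 * theta)) * L <= A + alpha * B.
Proof.
move=> bE eE; set r := b ^+ 2 / _ => h1 h2 h3 h4.
rewrite -subr_ge0 (_ : _ - _ = (A - H - Q + k * (B - C)) +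
  ((1 - theta) * (H + k * C + k ^+ 2 / 4 * L) + Q - lam * K) +
  (theta * H + b * C - - r * L) + (alpha - k) * (B + 2 * C + (k - 1) * L)); last first.
  by rewrite eE bE; ring.
by rewrite h4 mulr0 addr0 addr_ge0 ?subr_ge0// addr_ge0 ?subr_ge0.
Qed.

End quadratic_forms.

Section coercivity.
Context {R : realType} {d : nat}.
Variables (Om : set 'rV[R]_d) (F s : 'rV[R]_d -> R) (k : R).
Hypotheses (oO : open Om) (cO : segment_convex Om)
  (F2 : smooth_upto Om (closure Om) 2 F) (green : gauss_green Om F)
  (s3 : smooth_upto Om (closure Om) 3 s) (s_gt0 : forall x, Om x -> 0 < s x)
  (tr_gt0 : forall x, closure Om x -> 0 < trace Om s x) (ns : neumann Om s).

Let mO : measurable Om := rV_open_measurable oO.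
Let mF : measurable_fun Om F := smooth_measurable oO F2.
Let wt x := s x `^ k.
Let q x := dot (grad s x) (grad s x).
Let z x := q x / s x.
Let l := lapg F s.
Let hf x := hess_form s x (grad s x).

Hypotheses (iK : gintegrable Om F (fun x => wt x * q x))
  (iH : gintegrable Om F (fun x => wt x * hess_norm2 s x))
  (iA : gintegrable Om F (fun x => wt x * l x ^+ 2))
  (iQ : gintegrable Om F (fun x => wt x * hess_form F x (grad s x)))
  (iL : gintegrable Om F (fun x => wt x * z x ^+ 2)).


Let iC := static_iC oO F2 s3 s_gt0 tr_gt0 iH iL.
Let iB := static_iB oO F2 s3 s_gt0 tr_gt0 iA iL.

Let wt0 x : 0 <= wt x. Proof. exact: powR_ge0. Qed.

Lemma static_coercive (theta lam alpha b e : R) : 0 < theta -> theta < 1 ->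
  (lam%:E <= lambda1 Om F theta)%E ->
  b = 2 * (k - alpha) + theta * k ->
  e = (k - alpha) * (k - 1) - (1 - theta) * k ^+ 2 / 4 ->
  lam * gint Om F (fun x => wt x * q x) +
  (e - b ^+ 2 / (4 * theta)) * gint Om F (fun x => wt x * z x ^+ 2) <=
  gint Om F (fun x => wt x * l x ^+ 2) + alpha * gint Om F (fun x => wt x * z x * l x).
Proof.
move=> th0 th1 lamle bE eE.
have pw : - (b ^+ 2 / (4 * theta)) * gint Om F (fun x => wt x * z x ^+ 2) <=
    theta * gint Om F (fun x => wt x * hess_norm2 s x) +
    b * gint Om F (fun x => wt x / s x * hf x).
  rewrite -(gintZ mO _ iL) -(gintZ mO _ iH) -(gintZ mO _ iC).
  rewrite -(gintD mO (gintegrableZ mO theta iH) (gintegrableZ mO b iC)).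
  apply: (gint_le mO (gintegrableZ mO _ iL)
    (gintegrableD mO (gintegrableZ mO theta iH) (gintegrableZ mO b iC))) => x Ox.
  have hh : (hf x / s x) ^+ 2 <= hess_norm2 s x * z x ^+ 2.
    rewrite exprMn /z exprMn [leRHS]mulrA; exact: (ler_wpM2r (sqr_ge0 _) (hess_form_CS _ _ _)).
  have qf := quadratic_form_ge b th0 (hess_norm2_ge0 s x) (sqr_ge0 (z x)) hh.
  have := ler_wpM2l (wt0 x) qf.
  have alg (x1 x2 x3 x4 x5 x6 : R) : x1 * (- x6 * x2) <= x1 * (theta * x3 + b * (x4 * x5)) ->
      - x6 * (x1 * x2) <= theta * (x1 * x3) + b * (x1 * x5 * x4).
    by rewrite (_ : x1 * (- x6 * x2) = - x6 * (x1 * x2)) 1?(_ : x1 * (theta * x3 + b * (x4 * x5)) =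
      theta * (x1 * x3) + b * (x1 * x5 * x4))//; ring.
  exact: alg.
have LB := lambda1_static oO F2 green s3 s_gt0 tr_gt0 iK iH iQ iL th1 lamle.
have BO := static_bochner oO cO F2 green s3 s_gt0 tr_gt0 ns iK iH iA iQ iL.
have ID := static_identity oO F2 green s3 s_gt0 tr_gt0 ns iK iH iA iL.
exact: (coercive_algebra bE eE pw LB BO ID).
Qed.

End coercivity.

(** * Evolution of the Fisher information and of the entropy *)

Section power_calculus.
Context {R : realType} {d : nat}.
Variables (Om : set 'rV[R]_d) (F : 'rV[R]_d -> R).
Hypothesis (oO : open Om).
Implicit Types (u : 'rV[R]_d -> R).

Lemma divg_ext_on X Y x : Om x -> (forall y, Om y -> X y = Y y) ->
  divg F X x = divg F Y x.
Proof.
move=> Ox XY; rewrite /divg XY//; congr (_ - _); apply: eq_bigr => i _.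
have E : {in Om, (fun y => X y 0 i) =1 (fun y => Y y 0 i)}.
  by move=> y; rewrite inE => Oy; rewrite XY.
by apply: (derive_ext_on _ oO E); rewrite inE.
Qed.

Lemma grad_ext_on f g x : {in Om, f =1 g} -> Om x -> grad f x = grad g x.
Proof.
move=> fg Ox; apply/rowP => i; rewrite !mxE.
by apply: (derive_ext_on _ oO fg); rewrite inE.
Qed.

Lemma lapg_ext_on f g x : {in Om, f =1 g} -> Om x -> lapg F f x = lapg F g x.
Proof.
move=> fg Ox; rewrite -!divg_grad; apply: divg_ext_on => // y Oy.
exact: grad_ext_on.
Qed.

Variable u : 'rV[R]_d -> R.
Hypotheses (su : smooth_upto Om (closure Om) 2 u) (u_gt0 : forall x, Om x -> 0 < u x)
  (u_tr : forall x, closure Om x -> 0 < trace Om u x).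
Let su1 : smooth_upto Om (closure Om) 1 u. Proof. exact: smoothW su. Qed.

Lemma grad_powR_on (b : R) x : Om x ->
  grad (fun y => u y `^ b) x = (b * u x `^ (b - 1)) *: grad u x.
Proof.
move=> Ox; rewrite grad_powR//; last exact: u_gt0.
by move=> i; exact: smooth_derivable su1 Ox.
Qed.

Lemma lapg_powR (b : R) x : Om x -> lapg F (fun y => u y `^ b) x =
  b * u x `^ (b - 1) * lapg F u x +
  b * (b - 1) * u x `^ (b - 2) * dot (grad u x) (grad u x).
Proof.
move=> Ox.
have sp : smooth_upto Om (closure Om) 1 (fun y => b * u y `^ (b - 1)).
  exact: (smoothZ b oO (smooth_powR (b - 1) oO su1 u_gt0 u_tr)).
have sp' := smooth_powR (b - 1) oO su1 u_gt0 u_tr.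
rewrite -divg_grad (divg_ext_on Ox (grad_powR_on b)).
rewrite (divg_scale_grad F sp su Ox); congr (_ + _).
have -> : grad (fun y => b * u y `^ (b - 1)) x =
    (b * ((b - 1) * u x `^ (b - 2))) *: grad u x.
  have -> : b - 2 = b - 1 - 1 by ring.
  rewrite -scalerA -(grad_powR_on (b - 1) Ox).
  apply/rowP => i; rewrite mxE [RHS]mxE mxE /partial.
  exact: (deriveZ b (smooth_derivable sp' Ox)).
by rewrite dotZl !mulrA.
Qed.

Lemma neumann_powR (b : R) : neumann Om u -> neumann Om (fun y => u y `^ b).
Proof.
move=> nu x nux bdx onu; have clx : closure Om x by case: bdx.
have E i : trace Om (partial i (fun y => u y `^ b)) x =
    b * trace Om u x `^ (b - 1) * trace Om (partial i u) x.
  have sp' := smooth_powR (b - 1) oO su1 u_gt0 u_tr.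
  have sp := smoothZ b oO sp'.
  have FF := within_filter Om (nbhs_filter x).
  rewrite -(trace_powR (b - 1) su1 (u_tr clx) clx).
  apply: traceE => //.
  have h : (fun y => b * u y `^ (b - 1) * partial i u y) @ within Om (nbhs x) -->
      b * trace Om (fun y => u y `^ (b - 1)) x * trace Om (partial i u) x.
    apply: cvgM; last exact: smooth_trace (smooth_partial i su) clx.
    by apply: cvgM; [exact: cvg_cst|exact: smooth_trace sp' clx].
  apply: cvg_trans h; apply: near_eq_cvg.
  rewrite near_withinE; apply: nearW => y Oy.
  have := grad_powR_on b Oy; move/rowP => /(_ i); rewrite [LHS]mxE => ->.
  by rewrite [RHS]mxE [X in _ = _ * X]mxE.
under eq_bigr do rewrite E -mulrA.
by rewrite -mulr_sumr (nu _ _ bdx onu) mulr0.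
Qed.

End power_calculus.

Section dynamics.
Context {R : realType} {d : nat}.
Variables (Om : set 'rV[R]_d) (F : 'rV[R]_d -> R) (m p : R).
Hypotheses (oO : open Om) (cO : segment_convex Om)
  (F2 : smooth_upto Om (closure Om) 2 F) (green : gauss_green Om F)
  (p1 : 1 < p) (m1 : 1 < m).
Variable v : 'rV[R]_d -> R -> R.
Hypotheses (sol : solution Om F m v) (adq : adequate Om F m p v).

Let mO : measurable Om := rV_open_measurable oO.
Let mF : measurable_fun Om F := smooth_measurable oO F2.
Let a := p / 2 + m - 1.
Let b := beta m p.
Let k := b * (m - 1).
Let alpha := b * m - 1.
Let a_gt0 : 0 < a. Proof. by move: p1 m1; rewrite /a => *; lra. Qed.
Let bE : b = a^-1. Proof. by []. Qed.
Let aE : b^-1 = a. Proof. by rewrite bE invrK. Qed.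
Let ab : a * b = 1. Proof. by rewrite bE mulfV// gt_eqF. Qed.

Let T := [set t : R | 0 < t].
Let Q := Om `*` T.
Let clQ := closure Om `*` T.
Let oT : open T. Proof. exact: open_gt. Qed.
Let oQ : open Q.
Proof.
move=> [x t] [/= Ox Tt]; exists (Om, T) => //=.
by split; apply: open_nbhs_nbhs.
Qed.
Let vv (z : 'rV[R]_d * R) := v z.1 z.2.
Let ss (z : 'rV[R]_d * R) := s_of m p v z.1 z.2.

Let svv j : smooth_upto Q clQ j vv.
Proof. exact/Ck_uptoP/(sol_smooth sol). Qed.

Let vv_gt0 z : Q z -> 0 < vv z.
Proof. by case: z => x t [/= Ox Tt]; apply: (sol_pos sol Ox); exact: ltW. Qed.

(** Positivity is known for traces of time slices; the trace in space-time has the same value, as a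
    limit along the slice. *)
Let vv_tr z : clQ z -> 0 < trace Q vv z.
Proof.
case: z => x t [/= clx Tt].
have h := slice_lim Tt (smooth_trace (svv 0) (conj clx Tt : clQ (x, t))).
rewrite -(traceE clx h); exact: (sol_pos_closure sol).
Qed.

Let sss j : smooth_upto Q clQ j ss.
Proof. by have := smooth_powR b^-1 oQ (svv j) vv_gt0 vv_tr. Qed.

Section fixed_time.
Variable t : R.
Hypothesis t0 : 0 < t.
Let s := s_of m p v ^~ t.

Lemma solution_slice j : smooth_upto Om (closure Om) j (v^~ t).
Proof. exact: (smooth_slice oO (t0 : T t) (svv j)). Qed.

Lemma solution_gt0 x : Om x -> 0 < v x t.
Proof. by move=> Ox; apply: (sol_pos sol Ox); exact: ltW. Qed.

Lemma solution_neumann : neumann Om (v^~ t).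
Proof.
move=> x nu bdx onu; rewrite -[RHS](sol_neumann sol bdx onu t0).
by rewrite /normal_trace; apply: eq_bigr => i _; rewrite gradE.
Qed.

Lemma s_smooth j : smooth_upto Om (closure Om) j s.
Proof. exact: (smooth_slice oO (t0 : T t) (sss j)). Qed.

Lemma s_gt0 x : Om x -> 0 < s x.
Proof. by move=> Ox; rewrite /s /s_of powR_gt0// solution_gt0. Qed.

Lemma s_trace x : closure Om x -> 0 < trace Om s x.
Proof.
move=> clx; have h := sol_pos_closure sol clx t0.
by rewrite (trace_powR b^-1 (solution_slice 0) h clx) powR_gt0.
Qed.

Lemma s_neumann : neumann Om s.
Proof.
apply: (neumann_powR oO (solution_slice 2) solution_gt0 _ _ solution_neumann).
by move=> x clx; exact: (sol_pos_closure sol clx t0).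
Qed.

Lemma v_powRE e x : Om x -> v x t `^ e = s x `^ (b * e).
Proof.
move=> Ox; rewrite /s /s_of -powRrM mulrA mulVf ?mul1r//.
by rewrite -/b bE invr_eq0 gt_eqF.
Qed.

Let q x := dot (grad s x) (grad s x).
Let z x := q x / s x.
Let l := lapg F s.
Let wt x := s x `^ k.

Let vwt x : Om x -> v x t `^ (m - 1) = wt x.
Proof. by move=> Ox; rewrite v_powRE. Qed.

Let ext (f : 'rV[R]_d -> R) : gintegrable Om F (fun x => v x t `^ (m - 1) * f x) ->
  gintegrable Om F (fun x => wt x * f x).
Proof. by apply: (gintegrable_ext mO) => x; rewrite inE => Ox; rewrite vwt. Qed.

Lemma s_iK : gintegrable Om F (fun x => wt x * q x).
Proof. by apply: ext; have [h _ _ _ _] := adq_second_order adq t0. Qed.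
Lemma s_iH : gintegrable Om F (fun x => wt x * hess_norm2 s x).
Proof. by apply: ext; have [_ h _ _ _] := adq_second_order adq t0. Qed.
Lemma s_iA : gintegrable Om F (fun x => wt x * l x ^+ 2).
Proof. by apply: ext; have [_ _ h _ _] := adq_second_order adq t0. Qed.
Lemma s_iQ : gintegrable Om F (fun x => wt x * hess_form F x (grad s x)).
Proof. by apply: ext; have [_ _ _ h _] := adq_second_order adq t0. Qed.
Lemma s_iL : gintegrable Om F (fun x => wt x * z x ^+ 2).
Proof. by apply: ext; have [_ _ _ _ h] := adq_second_order adq t0. Qed.

Let psi x := m * (l x + alpha * z x).

Let sd x := 'D_((0, 1) : 'rV[R]_d * R) ss (x, t).

Let v_time x : Om x -> is_derive t 1 (v x) (lapg F (fun y => v y t `^ m) x).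
Proof.
move=> Ox; have dv : derivable vv (x, t) (0, 1).
  exact: (smooth_derivable (svv 1) (conj Ox t0 : Q (x, t))).
rewrite -(sol_eq sol Ox t0) derive1E.
apply: DeriveDef; [exact: (time_derivable dv)|reflexivity].
Qed.

Lemma s_time x : Om x -> is_derive t 1 (s_of m p v x) (wt x * psi x).
Proof.
move=> Ox; have vx := solution_gt0 Ox; have sx := s_gt0 Ox.
have h : is_derive t 1 (s_of m p v x) _ :=
  is_derive_comp1 (is_derive1_powR b^-1 vx) (v_time Ox).
apply: (is_derive_eq h).
have E : {in Om, (fun y => v y t `^ m) =1 (fun y => s y `^ (b * m))}.
  by move=> y; rewrite inE => Oy; exact: v_powRE.
rewrite (lapg_ext_on F oO E Ox) (lapg_powR F oO (s_smooth 2) s_gt0 s_trace _ Ox).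
rewrite aE v_powRE// -/l -/(q x) /psi /wt /z.
(* As a b = 1, the exponents add up to b (m - 1) = k, and to k - 1 in the second product. *)
have e1 : s x `^ (b * (a - 1)) * s x `^ (b * m - 1) = s x `^ k.
  rewrite -powRD ?(gt_eqF sx) ?implybT//; congr (_ `^ _).
  by rewrite mulrBr mulr1 (mulrC b) ab /k; ring.
have e2 : s x `^ (b * (a - 1)) * s x `^ (b * m - 2) = s x `^ k / s x.
  rewrite -powR_inv1 ?(ltW sx)// -!powRD ?(gt_eqF sx) ?implybT//; congr (_ `^ _).
  by rewrite mulrBr mulr1 (mulrC b) ab /k; ring.
have -> : a * s x `^ (b * (a - 1)) * (b * m * s x `^ (b * m - 1) * l x +
    b * m * (b * m - 1) * s x `^ (b * m - 2) * q x) =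
  a * b * m * (s x `^ (b * (a - 1)) * s x `^ (b * m - 1)) * l x +
  a * b * m * (b * m - 1) * (s x `^ (b * (a - 1)) * s x `^ (b * m - 2)) * q x.
  by move: (s x `^ _) (s x `^ _) (s x `^ _) (l x) (q x) => *; ring.
rewrite e1 e2 ab -/alpha.
by move: (s x `^ k) (l x) (q x) (s x)^-1 => x1 x2 x3 x4; ring.
Qed.

Let sdE x : Om x -> sd x = wt x * psi x.
Proof.
by move=> Ox; rewrite /sd -time_derive; have [_ <-] := s_time Ox.
Qed.

(** Space and time derivatives of s commute by the symmetry of second derivatives on the space-time
    domain, so D s is differentiated in time through s_t. *)
Lemma grad_s2_time x : Om x ->
  (grad_s2 m p v x)^`()%classic t = 2 * dot (grad s x) (grad (fun y => wt y * psi y) x).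
Proof.
move=> Ox.
have sdE' : {in Om, sd =1 (fun y => wt y * psi y)}.
  by move=> y; rewrite inE; exact: sdE.
rewrite -(grad_ext_on oO sdE' Ox) mulr_sumr.
pose g i (r : R) := partial i (s_of m p v ^~ r) x.
have gE i r : g i r = 'D_((delta_mx 0 i, 0) : 'rV[R]_d * R) ss (x, r).
  exact: (slice_derive ss x r).
have dg i : is_derive t 1 (g i) (partial i sd x).
  have s2 := sss 2.
  have E := derive_sym ((0, 1) : 'rV[R]_d * R) (delta_mx 0 i, 0) oQ s2 (conj Ox t0 : Q (x, t)).
  have dd : derivable ('D_((delta_mx 0 i, 0) : 'rV[R]_d * R) ss) (x, t)
      ((0, 1) : 'rV[R]_d * R).
    exact: (smooth_derivable (smooth_derive _ s2) (conj Ox t0 : Q (x, t))).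
  have -> : g i = (fun r => 'D_((delta_mx 0 i, 0) : 'rV[R]_d * R) ss (x, r)).
    by apply/funext => r; exact: gE.
  apply: DeriveDef; first exact: (time_derivable dd).
  have -> := time_derive ('D_((delta_mx 0 i, 0) : 'rV[R]_d * R) ss) x t.
  rewrite E; exact/esym/slice_derive.
have -> : grad_s2 m p v x = (fun r => \sum_i g i r * g i r).
  by apply/funext => r; apply: eq_bigr => i _; rewrite !mxE.
have dq i : is_derive t 1 (fun r => g i r * g i r) (2 * (g i t * partial i sd x)).
  have h : is_derive t 1 (fun r => g i r * g i r) _ := is_deriveM (dg i) (dg i).
  by apply: (is_derive_eq h); rewrite mulr_natl mulr2n.
have := is_derive_sum dq; rewrite fct_sumE => -[_ E].
rewrite derive1E E.
by apply: eq_bigr => i _; rewrite !mxE.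
Qed.

Let iA := s_iA.
Let iB : gintegrable Om F (fun x => wt x * z x * l x).
Proof. exact: (static_iB oO F2 (s_smooth 3) s_gt0 s_trace s_iA s_iL). Qed.

(** Writing phi = s_t, Green's formula turns the integral of D phi . Ds into minus that of phi
    Delta_g s, and phi is m wt (Delta_g s + alpha |Ds|^2 / s). *)
Lemma fisher_time : is_derive t 1 (fisher Om F m p v)
  (- (2 * m * (4 * m * (m + p - 1) / (2 * m + p - 2) ^+ 2)) *
    (gint Om F (fun x => wt x * l x ^+ 2) + alpha * gint Om F (fun x => wt x * z x * l x))).
Proof.
have [i1 i2 h] := adq_fisher adq t0.
set c := 4 * m * _ / _.
have hc : is_derive t 1 (fisher Om F m p v) _ := is_deriveZ c h.
apply: (is_derive_eq hc).
pose phi x := wt x * psi x.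
have E : {in Om, (fun x => (grad_s2 m p v x)^`()%classic t) =1
    (fun x => 2 * dot (grad phi x) (grad s x))}.
  by move=> x; rewrite inE => Ox; rewrite grad_s2_time// dotC.
have i3 : gintegrable Om F (fun x => dot (grad phi x) (grad s x)).
  have := gintegrableZ mO 2^-1 (gintegrable_ext mO E i2).
  by apply: (gintegrable_ext mO) => x _; rewrite mulrA mulVf// mul1r.
have philE x : phi x * l x = m * (wt x * l x ^+ 2 + alpha * (wt x * z x * l x)).
  by rewrite /phi /psi; move: (wt x) (l x) (z x) => x1 x2 x3; ring.
have i4 : gintegrable Om F (fun x => phi x * l x).
  apply: (gintegrable_ext mO _ (gintegrableZ mO m (gintegrableD mO iA (gintegrableZ mO alpha iB)))).
  by move=> x _; rewrite philE.
have sinv := smooth_inv oO (s_smooth 3) s_gt0 s_trace.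
have sq : smooth_upto Om (closure Om) 2 q.
  exact: (smooth_dot oO (fun i => smooth_grad i (s_smooth 3))
    (fun i => smooth_grad i (s_smooth 3))).
have sz : smooth_upto Om (closure Om) 1 z.
  exact: (smoothM oO (smoothW (isT : (1 <= 2)%N) sq) (smoothW (isT : (1 <= 3)%N) sinv)).
have sl : smooth_upto Om (closure Om) 1 l by exact: (smooth_lapg oO F2 (s_smooth 3)).
have spsi : smooth_upto Om (closure Om) 1 psi.
  exact: (smoothZ m oO (smoothD oO sl (smoothZ alpha oO sz))).
have swt : smooth_upto Om (closure Om) 1 wt.
  exact: (smooth_powR k oO (s_smooth 1) s_gt0 s_trace).
have sphi : smooth_upto Om (closure Om) 1 phi by exact: (smoothM oO swt spsi).
have i5 : gintegrable Om F (fun x => wt x * psi x ^+ 2).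
  apply: (gintegrable_le mO mF _ _ (gintegrableD mO (gintegrableZ mO (2 * m ^+ 2) iA)
    (gintegrableZ mO (2 * m ^+ 2 * alpha ^+ 2) s_iL))).
    exact: (smooth_measurable oO (smoothM oO swt (smoothX2 oO spsi))).
  move=> x Ox; rewrite (ger0_norm (mulr_ge0 (powR_ge0 _ _) (sqr_ge0 _))).
  have alg (w y1 y2 : R) : 0 <= w -> w * (m * (y1 + alpha * y2)) ^+ 2 <=
      2 * m ^+ 2 * (w * y1 ^+ 2) + 2 * m ^+ 2 * alpha ^+ 2 * (w * y2 ^+ 2).
    move=> w0; rewrite -subr_ge0 (_ : _ - _ = w * (m * (y1 - alpha * y2)) ^+ 2); last by ring.
    by rewrite mulr_ge0// sqr_ge0.
  exact: (alg _ _ _ (powR_ge0 _ _)).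
have flux := static_flux oO F2 (s_smooth 3) s_gt0 s_trace s_iK spsi i5.
have i6 := gintegrableD mO i4 i3.
have := green_tangential oO green sphi (s_smooth 2) s_neumann flux i6.
rewrite (gintD mO i4 i3) => G0.
rewrite (gint_ext F E) (gintZ mO _ i3).
have -> : gint Om F (fun x => dot (grad phi x) (grad s x)) =
    - gint Om F (fun x => phi x * l x).
  by apply/eqP; rewrite -addr_eq0 addrC; apply/eqP.
have -> : gint Om F (fun x => phi x * l x) =
    m * (gint Om F (fun x => wt x * l x ^+ 2) + alpha * gint Om F (fun x => wt x * z x * l x)).
  rewrite -(gintZ mO _ iB) -(gintD mO iA (gintegrableZ mO alpha iB)).
  rewrite -(gintZ mO _ (gintegrableD mO iA (gintegrableZ mO alpha iB))).
  by apply: gint_ext => x _; rewrite philE.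
rewrite /GRing.scale/=; move: (gint _ _ _) (gint _ _ _) => A B; ring.
Qed.

Lemma grad_s2E x : Om x ->
  grad_s2 m p v x t = a ^+ 2 * (v x t `^ (2 * a - 2) * dot (grad (v^~ t) x) (grad (v^~ t) x)).
Proof.
move=> Ox; have vx := solution_gt0 Ox.
rewrite /grad_s2 (grad_powR_on (solution_slice 2) solution_gt0 b^-1 Ox) dotZl dotZr aE.
have -> : 2 * a - 2 = (a - 1) + (a - 1) by ring.
have pw (e f : R) : v x t `^ (e + f) = v x t `^ e * v x t `^ f.
  by rewrite powRD// (gt_eqF vx) implybT.
rewrite (pw (a - 1) (a - 1)).
have alg (x1 x2 : R) : a * x1 * (a * x1 * x2) = a ^+ 2 * (x1 * x1 * x2) by ring.
exact: alg.
Qed.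

(** The equation is tested with v^(r-1), the flux of D (v^m) being zero at the boundary. The first
    exponent yields E' = - I; the second shows that the integral of s^2 does not increase. *)
Lemma power_time r : r = m + p - 1 \/ r = 2 * m + p - 2 ->
  is_derive t 1 (fun t' => gint Om F (fun x => v x t' `^ r))
  (- r * gint Om F (fun x => (r - 1) * m *
    (v x t `^ (r + m - 3) * dot (grad (v^~ t) x) (grad (v^~ t) x)))).
Proof.
move=> hr; have [dv /(_ _ t0)/= [i1 i2]] := adq_power adq hr.
have [i3 i4 h] := dv _ t0; apply: (is_derive_eq h).
have v_tr x : closure Om x -> 0 < trace Om (v^~ t) x.
  by move=> clx; exact: (sol_pos_closure sol clx t0).
pose u x := v x t `^ m; pose phi x := v x t `^ (r - 1).
have su : smooth_upto Om (closure Om) 2 u.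
  exact: (smooth_powR m oO (solution_slice 2) solution_gt0 v_tr).
have sphi : smooth_upto Om (closure Om) 1 phi.
  exact: (smooth_powR (r - 1) oO (solution_slice 1) solution_gt0 v_tr).
have nu : neumann Om u := neumann_powR oO (solution_slice 2) solution_gt0 v_tr m solution_neumann.
have E : {in Om, divg F (fun x => phi x *: grad u x) =1
    (fun x => phi x * lapg F u x + dot (grad phi x) (grad u x))}.
  by move=> x; rewrite inE => Ox; exact: (divg_scale_grad F sphi su Ox).
have G0 := green_tangential oO green sphi su nu i1 (gintegrable_ext mO E i2).
have E2 : {in Om, (fun x => (fun t' => v x t' `^ r)^`()%classic t) =1
    (fun x => r * (phi x * lapg F u x))}.
  move=> x; rewrite inE => Ox; rewrite derive1E.
  have [_ ->] := is_derive_comp1 (is_derive1_powR r (solution_gt0 Ox)) (v_time Ox).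
  by rewrite -mulrA.
have i5 : gintegrable Om F (fun x => phi x * lapg F u x).
  have r0 : r != 0 by rewrite gt_eqF//; move: p1 m1; case: hr => -> *; lra.
  have := gintegrableZ mO r^-1 (gintegrable_ext mO E2 i4).
  by apply: (gintegrable_ext mO) => x _; rewrite mulrA mulVf// mul1r.
have E3 : {in Om, (fun x => dot (grad phi x) (grad u x)) =1 (fun x => (r - 1) * m *
    (v x t `^ (r + m - 3) * dot (grad (v^~ t) x) (grad (v^~ t) x)))}.
  move=> x; rewrite inE => Ox; have vx := solution_gt0 Ox.
  rewrite (grad_powR_on (solution_slice 2) solution_gt0 (r - 1) Ox).
  rewrite (grad_powR_on (solution_slice 2) solution_gt0 m Ox) dotZl dotZr.
  have -> : r + m - 3 = (r - 1 - 1) + (m - 1) by ring.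
  have pw (e f : R) : v x t `^ (e + f) = v x t `^ e * v x t `^ f.
    by rewrite powRD// (gt_eqF vx) implybT.
  rewrite (pw (r - 1 - 1) (m - 1)).
  have alg (x1 x2 x3 : R) : (r - 1) * x1 * (m * x2 * x3) = (r - 1) * m * (x1 * x2 * x3).
    by ring.
  exact: alg.
have i6 : gintegrable Om F (fun x => dot (grad phi x) (grad u x)).
  have := gintegrableB mO (gintegrable_ext mO E i2) i5.
  by apply: (gintegrable_ext mO) => x _; rewrite addrAC subrr add0r.
rewrite (gint_ext F E2) (gintZ mO _ i5) -(gint_ext F E3).
move: G0; rewrite (gintD mO i5 i6) => /eqP; rewrite addr_eq0 => /eqP ->.
by rewrite mulrN mulNr.
Qed.

End fixed_time.

Hypothesis gamma_prob : (\int[lebesgue_rV d]_(x in Om) (expR (- F x))%:E = 1)%E.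

Lemma gintegrable_cst (c : R) : gintegrable Om F (cst c).
Proof.
have h : gintegrable Om F (cst 1).
  apply/integrableP; split.
    by apply/measurable_EFinP; apply: measurable_funM => //; exact: measurable_gweight.
  rewrite (eq_integral (fun x => (expR (- F x))%:E)) ?gamma_prob ?ltry// => x _.
  by rewrite mul1r gee0_abs// lee_fin expR_ge0.
apply: (gintegrable_ext mO _ (gintegrableZ mO c h)) => x _; exact: mulr1.
Qed.

Lemma gint_cst (c : R) : gint Om F (cst c) = c.
Proof.
have E : {in Om, cst c =1 (fun x => c * cst 1 x)} by move=> x _; rewrite /= mulr1.
rewrite (gint_ext F E) (gintZ mO _ (gintegrable_cst 1)).
rewrite /gint /Rintegral (eq_integral (fun x => (expR (- F x))%:E)).
  by rewrite gamma_prob mulr1.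
by move=> x _; rewrite mul1r.
Qed.

Lemma entropyE (t : R) : gintegrable Om F (fun x => v x t `^ (m + p - 1)) ->
  entropy Om F m p v t =
  (m + p - 2)^-1 * (gint Om F (fun x => v x t `^ (m + p - 1)) - 1).
Proof.
by move=> i; rewrite /entropy (gintB mO i (gintegrable_cst 1)) gint_cst.
Qed.

Lemma entropy_time (t : R) : 0 < t -> is_derive t 1 (entropy Om F m p v) (- fisher Om F m p v t).
Proof.
move=> t0; have q0 : m + p - 2 != 0.
  by rewrite gt_eqF//; move: p1 m1 => *; lra.
have h := power_time t0 (or_introl erefl).
have hd := is_deriveB h (is_derive_cst (1 : R) t 1).
have he : is_derive t 1 (fun t' => (m + p - 2)^-1 *
    (gint Om F (fun x => v x t' `^ (m + p - 1)) - 1)) _ := is_deriveZ ((m + p - 2)^-1) hd.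
apply: (@near_eq_is_derive _ _ _ (fun t' => (m + p - 2)^-1 *
    (gint Om F (fun x => v x t' `^ (m + p - 1)) - 1))).
  have := lt_nbhsr t0; apply: filterS => t' t'0; rewrite entropyE//.
  have [dv _] := adq_power adq (or_introl erefl).
  by have [] := dv t' t'0.
apply: (is_derive_eq he); rewrite subr0 /fisher.
have [i1 _ _] := adq_fisher adq t0.
have E : {in Om, (fun x => (m + p - 1 - 1) * m * (v x t `^ (m + p - 1 + m - 3) *
      dot (grad (v^~ t) x) (grad (v^~ t) x))) =1
    (fun x => (m + p - 2) * m / a ^+ 2 * grad_s2 m p v x t)}.
  move=> x; rewrite inE => Ox; rewrite grad_s2E//.
  have -> : 2 * a - 2 = m + p - 1 + m - 3 by rewrite /a; field.
  have -> : m + p - 1 - 1 = m + p - 2 by ring.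
  have alg (c X : R) : c * X = c / a ^+ 2 * (a ^+ 2 * X).
    by rewrite [RHS]mulrA divfK// expf_neq0// gt_eqF.
  exact: alg.
rewrite (gint_ext F E) (gintZ mO _ i1).
move: (gint _ _ _) => J.
have -> : 2 * m + p - 2 = 2 * a by rewrite /a; field.
by move: q0 a_gt0; move: (a) => a' q0 a'0; rewrite /GRing.scale/=; field; rewrite q0 gt_eqF.
Qed.

End dynamics.

(** * Decay of the entropy to zero *)

Section exhaustion.
Context {R : realType} {d : nat}.
Variables (Om : set 'rV[R]_d).
Hypotheses (oO : open Om) (cO : segment_convex Om).
Local Notation mu := (@lebesgue_rV R d).

(** Both conditions pass to limits and to convex combinations, so these sets are compact and convex:
    F is bounded on them and the Poincare inequality applies. *)
Definition exhaust (N : nat) : set 'rV[R]_d :=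
  rV_cube d N%:R `&` [set x | forall y, `|y - x| < N.+1%:R^-1 -> Om y].

Let rad_gt0 N : 0 < N.+1%:R^-1 :> R. Proof. by rewrite invr_gt0 ltr0n. Qed.

Lemma exhaust_sub N : exhaust N `<=` Om.
Proof. by move=> x [_ /(_ x)]; rewrite subrr normr0; exact. Qed.

Lemma exhaust_closed N : closed (exhaust N).
Proof.
apply: closedI; first exact: closed_rV_cube.
move=> x clx y yx.
have e0 : 0 < N.+1%:R^-1 - `|y - x| by rewrite subr_gt0.
have [z [/= Kz xz]] := clx _ (nbhsx_ballx x _ e0).
apply: Kz; move: xz; rewrite -ball_normE/= => xz.
by rewrite -(subrKA x) (le_lt_trans (ler_normD _ _))// -ltrBrDl.
Qed.

Lemma exhaust_compact N : compact (exhaust N).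
Proof.
apply: bounded_closed_compact; last exact: exhaust_closed.
exists N%:R; split; first exact: num_real.
move=> M NM x [Kx _]; apply: rV_norm_le; last by move=> i; exact: le_trans (Kx i) (ltW NM).
by rewrite (le_trans _ (ltW NM)).
Qed.

Lemma exhaust_convex N x y (r : R) : exhaust N x -> exhaust N y -> 0 <= r <= 1 ->
  exhaust N (r *: (x - y) + y).
Proof.
move=> [cx ox] [cy oy] /andP[r0 r1].
have E (a b : 'rV[R]_d) : r *: (a - b) + b = r *: a + (1 - r) *: b.
  by rewrite scalerBr scalerBl scale1r addrAC -addrA.
split=> [i|w hw].
  rewrite E !mxE (le_trans (ler_normD _ _))// !normrM (ger0_norm r0).
  have r1' : 0 <= 1 - r by rewrite subr_ge0.
  rewrite (ger0_norm r1'); apply: le_trans (lerD (ler_wpM2l r0 (cx i)) (ler_wpM2l r1' (cy i))) _.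
  by rewrite -mulrDl addrC subrK mul1r.
set h := w - (r *: (x - y) + y) in hw.
(* A displacement h of the combination is a combination of the endpoints displaced by h, which are
   still in [Om]. *)
have -> : w = r *: ((x + h) - (y + h)) + (y + h).
  by apply/rowP => i; rewrite !mxE; ring.
apply: cO; last by rewrite r0.
  by apply: ox; rewrite addrC addKr.
by apply: oy; rewrite addrC addKr.
Qed.

Lemma exhaust_near x : Om x -> \forall N \near \oo, exhaust N x.
Proof.
move=> Ox; have [e e0 He] := near_ball_norm (open_near oO Ox).
near=> N; split=> [i|y xy].
  apply: le_trans (rV_coord_le_norm x i) _; near: N; exact: nbhs_infty_ger.
rewrite -(subrK x y); apply: He; rewrite (lt_trans xy)//; near: N.
exact: (near_infty_natSinv_lt (PosNum e0)).
Unshelve. all: by end_near. Qed.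

Lemma exhaust_measurable N : measurable (exhaust N).
Proof. by apply: rV_closed_measurable; exact: exhaust_closed. Qed.

Variable F : 'rV[R]_d -> R.
Hypotheses (mF : measurable_fun Om F) (cF : forall x, Om x -> {for x, continuous F})
  (gamma1 : gintegrable Om F (cst 1)) (gint1 : gint Om F (cst 1) = 1).

Let mO : measurable Om := rV_open_measurable oO.

Lemma gintegrable_exhaust N (f : 'rV[R]_d -> R) : gintegrable Om F f ->
  gintegrable Om F (fun x => \1_(exhaust N) x * f x).
Proof.
move=> fi; have := integrable_mkcond (EFin \o (fun x => f x * expR (- F x))) (exhaust_measurable N).
have fiK := integrableS mO (exhaust_measurable N) (@exhaust_sub N) fi.
move=> /(_ mu)/iffLR/(_ fiK) h.
have := integrableS measurableT mO (@subsetT _ _) h.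
apply: eq_integrable => // x _ /=; rewrite patchE indicE.
by case: (x \in _); rewrite /= ?mul1r ?mul0r.
Qed.

Lemma exhaust_prob (e : R) : 0 < e -> \forall N \near \oo,
  1 - e <= gint Om F (fun x => \1_(exhaust N) x).
Proof.
move=> e0.
have mw : measurable_fun Om (fun x => expR (- F x)) by exact: measurable_gweight.
have DC := @dominated_cvg _ _ _ mu Om mO
  (fun N x => (\1_(exhaust N) x * expR (- F x))%:E)
  (fun x => (1 * expR (- F x))%:E) (fun x => (1 * expR (- F x))%:E).
have {}DC : (fun N => \int[mu]_(x in Om) (\1_(exhaust N) x * expR (- F x))%:E)%E @ \oo -->
    (\int[mu]_(x in Om) (1 * expR (- F x))%:E)%E.
  apply: DC => //.
  - move=> N; apply/measurable_EFinP; apply: measurable_funM => //.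
    by apply: measurable_indic; exact: exhaust_measurable.
  - move=> x Ox; apply: cvg_near_cst; apply: filterS (exhaust_near Ox) => N Kx.
    by rewrite indicE mem_set.
  - move=> N x _; rewrite lee_fin ger0_norm ?mulr_ge0 ?expR_ge0//.
    by rewrite ler_wpM2r ?expR_ge0// indicE; case: (_ \in _).
have L : (\int[mu]_(x in Om) (1 * expR (- F x))%:E)%E = 1%:E.
  apply: etrans (esym (fineK (integrable_fin_num mO gamma1))) _.
  congr (_%:E); exact: gint1.
rewrite L in DC.
have FC : (fun N => gint Om F (fun x => \1_(exhaust N) x)) @ \oo --> (1 : R).
  exact: (fine_cvg DC).
move/cvgrPdist_le: FC => /(_ e e0); apply: filterS => N.
by move=> /(le_trans (ler_norm _)); rewrite lerBlDr addrC -lerBlDr.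
Qed.

End exhaustion.

Section scalar_bounds.
Context {R : realType}.

Lemma four_quarters (eps a b c : R) : a <= eps / 4 -> b <= eps / 4 -> c <= eps / 4 ->
  eps / 4 + (a + (b + c)) <= eps.
Proof. by move=> *; lra. Qed.

Lemma le_addl3 (t z a b : R) : z <= t + a -> 0 <= b -> z <= t + (a + b).
Proof. by move=> *; lra. Qed.

Lemma le_tail (t z sig y C w : R) : 0 < t -> z <= sig * y + C -> sig * y <= sig * (2 * w) ->
  z <= t + (2 * sig * w + C).
Proof. by move=> t0 h1; rewrite mulrA [sig * 2]mulrC => h2; lra. Qed.

(** Here a and b stand for the integrals of s^(2e) and s^e, and c for a constant value of s^e: a <=
    eps + 2 c b - c^2 <= eps + b^2 <= eps + 1. *)
Lemma square_deviation_le (eps a b c w : R) : a - 2 * c * b + c ^+ 2 <= w -> w <= eps ->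
  b <= 1 -> 0 <= b -> a <= 1 + eps.
Proof. by move=> h1 h2 b1 b0; have := sqr_ge0 (c - b); nra. Qed.

End scalar_bounds.

(** * Functions with small gradient are nearly constant in mean *)

Section small_gradient.
Context {R : realType} {d : nat}.
Variables (Om : set 'rV[R]_d) (F : 'rV[R]_d -> R).
Hypotheses (oO : open Om) (cO : segment_convex Om) (F2 : smooth_upto Om (closure Om) 2 F)
  (gamma1 : gintegrable Om F (cst 1)) (gint1 : gint Om F (cst 1) = 1).
Local Notation mu := (@lebesgue_rV R d).

Let mO : measurable Om := rV_open_measurable oO.
Let mF : measurable_fun Om F := smooth_measurable oO F2.

Lemma gintegrable_const (c : R) : gintegrable Om F (fun=> c).
Proof.
by apply: (gintegrable_ext mO _ (gintegrableZ mO c gamma1)) => x _; exact: mulr1.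
Qed.

Lemma gint_const (c : R) : gint Om F (fun=> c) = c.
Proof.
have E : {in Om, (fun=> c) =1 (fun x => c * cst 1 x)} by move=> x _; rewrite /= mulr1.
by rewrite (gint_ext F E) (gintZ mO _ gamma1) gint1 mulr1.
Qed.

Lemma le_integral_domains (K D : set 'rV[R]_d) (f g : 'rV[R]_d -> \bar R) : K `<=` D ->
  (forall x, K x -> (f x <= g x)%E) -> (forall x, D x -> (0 <= g x)%E) ->
  (\int[mu]_(x in K) f x <= \int[mu]_(x in D) g x)%E.
Proof.
move=> KD fg g0; rewrite integral_mkcond [leRHS]integral_mkcond.
apply: le_integral_pointwise => x _; rewrite !patchE.
case: ifPn => [|_]; first by rewrite inE => Kx; rewrite mem_set ?fg//; exact: KD.
by case: ifPn => //; rewrite inE => /g0.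
Qed.

Lemma integral_exhaust N (f : 'rV[R]_d -> R) : gintegrable Om F f ->
  (\int[mu]_(x in exhaust Om N) (f x * expR (- F x))%:E =
   (gint Om F (fun x => \1_(exhaust Om N) x * f x))%:E)%E.
Proof.
move=> fi; have fiK := gintegrable_exhaust oO N fi.
rewrite /gint /Rintegral (fineK (integrable_fin_num mO fiK)).
rewrite [LHS]integral_mkcond [RHS]integral_mkcond; apply: eq_integral => x _.
rewrite !patchE indicE; have [Kx|Kx] := boolP (x \in exhaust Om N).
  by rewrite mem_set ?mul1r//; apply: (@exhaust_sub _ _ _ N); rewrite -inE.
by case: ifP => // _; rewrite !mul0r.
Qed.

Lemma exhaust_weight_bound N : exists2 B : R, 0 < B &
  forall x, exhaust Om N x -> B^-1 <= expR (- F x) <= B.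
Proof.
have [M M0 HM] := continuous_compact_bound (exhaust_compact (N := N) (Om := Om))
  (@exhaust_sub _ _ Om N) (fun x Ox => smooth_cont F2 Ox).
exists (expR M) => [|x Kx]; first exact: expR_gt0.
have := HM x Kx; rewrite ler_norml => /andP[h1 h2].
by rewrite -expRN !ler_expR lerN2 h2 lerNl h1.
Qed.

(** On a large compact convex K, the Poincare inequality makes s close in mean square to one of its
    values s y0, and so s^e close to the constant (s y0)^e. Off K the second moment C and the small
    mass suffice, because 2 e < 2. The bound on the integral of s^e then limits that of its square,
    and [eta] is uniform in s. *)
Lemma small_gradient (e C eps : R) : 0 < e < 1 -> 0 <= C -> 0 < eps ->
  exists2 eta : R, 0 < eta & forall s : 'rV[R]_d -> R,
    smooth_upto Om (closure Om) 1 s -> (forall x, Om x -> 0 < s x) ->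
    gintegrable Om F (fun x => s x ^+ 2) -> gint Om F (fun x => s x ^+ 2) <= C ->
    gintegrable Om F (fun x => s x `^ (2 * e)) ->
    gintegrable Om F (fun x => s x `^ e) -> gint Om F (fun x => s x `^ e) <= 1 ->
    gintegrable Om F (fun x => dot (grad s x) (grad s x)) ->
    gint Om F (fun x => dot (grad s x) (grad s x)) <= eta ->
    gint Om F (fun x => s x `^ (2 * e)) <= 1 + eps.
Proof.
(* M0 is large enough that M0 / 2 - C > C + 1 when K has mass at least 1/2; this gives a point y0
   with s y0 ^ 2 <= M0. *)
move=> /andP[e0 e1] C0 eps0; have [M0 M0E] : exists M0, M0 = 4 * (C + 1) by eexists.
have M00 : 0 < M0 by rewrite M0E; lra.
have [E0 E2] : 0 < 2 * e /\ 2 * e < 2 by split; lra.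
have CM : 0 < C + M0 + 1 by lra.
have sig0 : 0 < eps / (16 * (C + M0 + 1)) by rewrite divr_gt0// mulr_gt0.
set sig := eps / _ in sig0.
have sigE : 2 * sig * (C + M0) <= eps / 4.
  have -> : eps / 4 = 4 * sig * (C + M0 + 1) by rewrite /sig; field; rewrite gt_eqF.
  by nra.
have tau0 : 0 < eps / 4 by rewrite divr_gt0.
have [Cs Cs0 Hs] := powR_lt2_bound E0 E2 sig0.
have [Ct Ct0 Ht] := powR_lt2_bound E0 E2 tau0.
have half0 : 0 < 2^-1 :> R by rewrite invr_gt0.
have rest0 : 0 < eps / (4 * Cs) by rewrite divr_gt0// mulr_gt0.
(* Mass one half is for the choice of y0; the second condition makes Cs times the mass outside K at
   most eps / 4. *)
have [N [KN1 KN2]] : exists N, 1 - 2^-1 <= gint Om F (fun x => \1_(exhaust Om N) x) /\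
    1 - eps / (4 * Cs) <= gint Om F (fun x => \1_(exhaust Om N) x).
  apply: (@filter_ex _ \oo); apply: filterI.
    exact: (exhaust_prob oO mF gamma1 gint1 half0).
  exact: (exhaust_prob oO mF gamma1 gint1 rest0).
set K := exhaust Om N in KN1 KN2 *.
have [B B0 HB] := exhaust_weight_bound N.
have cube_fin := lebesgue_rV_cube d (2 * N%:R : R).
set mc := mu (rV_cube d (2 * N%:R)) in cube_fin.
have mcf : mc \is a fin_num by rewrite ge0_fin_numE// measure_ge0.
have [P PE] : exists P, P = d%:R * (2 * N%:R) ^+ 2 * fine mc by eexists.
have P0 : 0 <= P by rewrite PE !mulr_ge0 ?sqr_ge0// fine_ge0// measure_ge0.
(* Chosen so that Ct B M0 / A = eps / 4, the contribution of K to the deviation; P above is the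
   Poincare constant of K. *)
have [A AE] : exists A, A = 4 * Ct * B * M0 / eps by eexists.
have A0 : 0 < A by rewrite AE divr_gt0// !mulr_gt0.
have mK : measurable K := exhaust_measurable Om N.
(* With this [eta], P B eta <= (C + 1) / (A B), strictly below the lower bound (M0 / 2 - C) / (A B)
   that the absence of y0 would entail. *)
exists ((C + 1) / (A * B ^+ 2 * (P + 1))).
  by rewrite divr_gt0 ?mulr_gt0 ?exprn_gt0//; lra.
move=> s ss s0 is2 s2C ise2 ise se1 iq J.
have KO : K `<=` Om by exact: exhaust_sub.
have iP (c : R) : gintegrable Om F (fun x => (c - s x ^+ 2) / (A * B)).
  have := gintegrableZ mO (A * B)^-1 (gintegrableB mO (gintegrable_const c) is2).
  by apply: (gintegrable_ext mO) => x _; rewrite mulrC.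
(* Averaging argument: if the inequality failed at every point of K, integrating its negation would
   contradict the Poincare inequality. As its left-hand side is nonnegative, it yields at once s y0
   ^ 2 <= M0 and a small deviation. *)
have [y0 [Ky0 gy0]] : exists y0, K y0 /\
    (\int[mu]_(x in K) ((s x - s y0) ^+ 2)%:E <=
     ((M0 - s y0 ^+ 2) / (A * B) * expR (- F y0))%:E)%E.
  apply: contrapT => /forallNP none.
  have low : (\int[mu]_(y in K) ((M0 - s y ^+ 2) / (A * B) * expR (- F y))%:E <=
      \int[mu]_(y in K) \int[mu]_(x in K) ((s x - s y) ^+ 2)%:E)%E.
    apply: le_integral_pointwise => y Ky; rewrite leNgt; apply/negP => h.
    by apply: (none y); split => //; exact: ltW.
  have up1 := poincare_convex oO ss KO mK (fun x hx => hx.1) (@exhaust_convex _ _ _ cO N).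
  have up2 : (\int[mu]_(x in K) (dot (grad s x) (grad s x))%:E <=
      (B * gint Om F (fun x => dot (grad s x) (grad s x)))%:E)%E.
    have iBq := gintegrableZ mO B iq.
    rewrite -(gintZ mO _ iq) /gint /Rintegral (fineK (integrable_fin_num mO iBq)).
    apply: le_integral_domains => // x Kx.
      rewrite lee_fin mulrAC; have /andP[h _] := HB _ Kx.
      have BF : 1 <= B * expR (- F x) by rewrite mulrC -ler_pdivrMr// mul1r.
      by rewrite ler_peMl// dot_ge0.
    by rewrite lee_fin !mulr_ge0 ?expR_ge0 ?dot_ge0 ?(ltW B0).
  have up3 : (\int[mu]_(y in K) ((M0 - s y ^+ 2) / (A * B) * expR (- F y))%:E <=
      (P * (B * gint Om F (fun x => dot (grad s x) (grad s x))))%:E)%E.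
    apply: le_trans low (le_trans up1 _).
    have PEe : ((d%:R * (2 * N%:R) ^+ 2)%:E * mc = P%:E)%E by rewrite PE [RHS]EFinM fineK.
    by rewrite -/mc PEe EFinM; apply: lee_wpmul2l => //; rewrite lee_fin.
  rewrite (integral_exhaust N (iP M0)) lee_fin in up3.
  have i1 := gintegrable_exhaust oO N (gintegrable_const (M0 / (A * B))).
  have i2 := gintegrable_exhaust oO N (gintegrableZ mO (A * B)^-1 is2).
  have lowb : (M0 / 2 - C) / (A * B) <=
      gint Om F (fun x => \1_K x * ((M0 - s x ^+ 2) / (A * B))).
    have E : {in Om, (fun x => \1_K x * ((M0 - s x ^+ 2) / (A * B))) =1
        (fun x => \1_K x * (M0 / (A * B)) - \1_K x * ((A * B)^-1 * s x ^+ 2))}.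
      by move=> x _; rewrite -mulrBr; congr (_ * _); rewrite mulrBl; congr (_ - _); rewrite mulrC.
    rewrite (gint_ext F E) (gintB mO i1 i2).
    have -> : gint Om F (fun x => \1_K x * (M0 / (A * B))) =
        M0 / (A * B) * gint Om F (fun x => \1_K x).
      have i1K : gintegrable Om F (fun x => \1_K x).
        apply: (gintegrable_ext mO _ (gintegrable_exhaust oO N gamma1)) => x _.
        exact: mulr1.
      by rewrite -(gintZ mO _ i1K); apply: gint_ext => x _; exact: mulrC.
    have h2 : gint Om F (fun x => \1_K x * ((A * B)^-1 * s x ^+ 2)) <= (A * B)^-1 * C.
      apply: (@le_trans _ _ ((A * B)^-1 * gint Om F (fun x => s x ^+ 2))).
        rewrite -(gintZ mO _ is2); apply: (gint_le mO i2 (gintegrableZ mO _ is2)) => x _.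
        rewrite indicE; case: (_ \in _); rewrite ?mul1r ?mul0r//.
        by rewrite mulr_ge0 ?sqr_ge0// invr_ge0 mulr_ge0 ?ltW.
      by rewrite ler_wpM2l// invr_ge0 mulr_ge0 ?ltW.
    have h1 : M0 / (A * B) * (1 - 2^-1) <= M0 / (A * B) * gint Om F (fun x => \1_K x).
      by rewrite ler_wpM2l// divr_ge0 ?(ltW M00)// mulr_ge0 ?ltW.
    have e3 : (M0 / 2 - C) / (A * B) = M0 / (A * B) * (1 - 2^-1) - (A * B)^-1 * C.
      by move: ((A * B)^-1) => c; field.
    by rewrite e3 lerB.
  have := le_trans lowb up3; apply/negP; rewrite -ltNge.
  have AB0 : 0 < A * B by rewrite mulr_gt0.
  apply: (@le_lt_trans _ _ ((C + 1) / (A * B))); last first.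
    by rewrite ltr_pM2r ?invr_gt0// M0E; lra.
  have PB : P * (B * gint Om F (fun x => dot (grad s x) (grad s x))) <=
      P * (B * ((C + 1) / (A * B ^+ 2 * (P + 1)))).
    by rewrite ler_wpM2l// ler_wpM2l// ltW.
  apply: le_trans PB _.
  have -> : P * (B * ((C + 1) / (A * B ^+ 2 * (P + 1)))) = (C + 1) / (A * B) * (P / (P + 1)).
    by field; rewrite !gt_eqF//; lra.
  rewrite ler_piMr//; first by rewrite divr_ge0 ?(ltW AB0)//; lra.
  by rewrite ler_pdivrMr; lra.
have [sy0 gy1] : s y0 ^+ 2 <= M0 /\
    (\int[mu]_(x in K) ((s x - s y0) ^+ 2)%:E <= (M0 / A)%:E)%E.
  have g0 : (0 <= \int[mu]_(x in K) ((s x - s y0) ^+ 2)%:E)%E.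
    by apply: integral_ge0 => x _; rewrite lee_fin sqr_ge0.
  have := le_trans g0 gy0; rewrite lee_fin pmulr_lge0 ?expR_gt0// pmulr_lge0.
    rewrite subr_ge0 => h; split=> //; apply: le_trans gy0 _; rewrite lee_fin.
    have /andP[_ hB] := HB _ Ky0.
    apply: (@le_trans _ _ (M0 / (A * B) * B)).
      apply: ler_pM; rewrite ?expR_ge0 ?divr_ge0 ?subr_ge0 ?mulr_ge0 ?(ltW A0) ?(ltW B0)//.
      rewrite ler_pM2r ?invr_gt0 ?mulr_gt0// gerBl; exact: sqr_ge0.
    by rewrite (_ : _ * B = M0 / A)//; field; rewrite !gt_eqF.
  by rewrite invr_gt0 mulr_gt0.
have ms : measurable_fun Om s := smooth_measurable oO ss.
have z2le x : (s x - s y0) ^+ 2 <= 2 * (s x ^+ 2 + M0).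
  have h := sqr_ge0 (s x + s y0); move: h sy0; move: (s x) (s y0) => a b h1 h2.
  by nra.
have iM : gintegrable Om F (fun x => (s x - s y0) ^+ 2).
  apply: (gintegrable_le mO mF _ _ (gintegrableZ mO 2
    (gintegrableD mO is2 (gintegrable_const M0)))).
    by apply: measurable_funX; apply: measurable_funB => //; exact: measurable_cst.
  by move=> x _; rewrite ger0_norm ?sqr_ge0.
have KI : gint Om F (fun x => \1_K x * (s x - s y0) ^+ 2) <= B * (M0 / A).
  rewrite -lee_fin -(integral_exhaust N iM).
  apply: (@le_trans _ _ (\int[mu]_(x in K) (B%:E * ((s x - s y0) ^+ 2)%:E))%E).
    apply: le_integral_pointwise => x Kx; rewrite -EFinM lee_fin mulrC.
    by rewrite ler_wpM2r ?sqr_ge0//; have /andP[] := HB _ Kx.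
  rewrite ge0_integralZl_EFin//; last first.
  - exact: ltW.
  - apply/measurable_EFinP; apply: measurable_funX; apply: measurable_funB => //.
    exact: measurable_funS ms.
  - by move=> x _; rewrite lee_fin sqr_ge0.
  by rewrite EFinM lee_wpmul2l// lee_fin ltW.
pose c0 := s y0 `^ e; have sy00 := s0 _ (KO _ Ky0).
have ex (b c : R) x : Om x -> s x `^ (b + c) = s x `^ b * s x `^ c.
  by move=> Ox; rewrite powRD// (gt_eqF (s0 _ Ox)) implybT.
(* On K the power 2 e of the deviation is bounded by eps / 4 plus Ct times its square; off K, by sig
   times its square plus Cs. Each of the four terms integrates to at most eps / 4. *)
pose W x := eps / 4 + (Ct * (\1_K x * (s x - s y0) ^+ 2) +
  (2 * sig * (s x ^+ 2 + M0) + Cs * (1 - \1_K x))).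
have i1K : gintegrable Om F (fun x => \1_K x).
  apply: (gintegrable_ext mO _ (gintegrable_exhaust oO N gamma1)) => x _.
  exact: mulr1.
have j1 := gintegrableZ mO Ct (gintegrable_exhaust oO N iM).
have j2' := gintegrableD mO is2 (gintegrable_const M0).
have j2 := gintegrableZ mO (2 * sig) j2'.
have j3' := gintegrableB mO (gintegrable_const 1) i1K.
have j3 := gintegrableZ mO Cs j3'.
have j23 := gintegrableD mO j2 j3.
have j123 := gintegrableD mO j1 j23.
have iW : gintegrable Om F W := gintegrableD mO (gintegrable_const (eps / 4)) j123.
have Wle : gint Om F W <= eps.
  rewrite /W (gintD mO (gintegrable_const _) j123) (gintD mO j1 j23) (gintD mO j2 j3).
  rewrite (gintZ mO _ (gintegrable_exhaust oO N iM)) (gintZ mO _ j2') (gintZ mO _ j3').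
  rewrite (gintD mO is2 (gintegrable_const _)) (gintB mO (gintegrable_const _) i1K).
  rewrite !gint_const.
  have b1 : Ct * gint Om F (fun x => \1_K x * (s x - s y0) ^+ 2) <= eps / 4.
    apply: le_trans (ler_wpM2l (ltW Ct0) KI) _.
    by rewrite le_eqVlt; apply/orP; left; apply/eqP; rewrite AE; field; rewrite !gt_eqF.
  have b2 : 2 * sig * (gint Om F (fun x => s x ^+ 2) + M0) <= eps / 4.
    apply: le_trans sigE; rewrite ler_wpM2l ?lerD2r//.
    by rewrite mulr_ge0// ltW.
  have b3 : Cs * (1 - gint Om F (fun x => \1_K x)) <= eps / 4.
    have h : 1 - gint Om F (fun x => \1_K x) <= eps / (4 * Cs).
      by move: KN2; move: (gint _ _ _) (eps / _) => a1 a2; lra.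
    apply: le_trans (ler_wpM2l (ltW Cs0) h) _.
    by rewrite le_eqVlt; apply/orP; left; apply/eqP; field; rewrite gt_eqF.
  exact: four_quarters.
have pw x : Om x -> s x `^ (2 * e) - 2 * c0 * s x `^ e + c0 ^+ 2 <= W x.
  move=> Ox.
  have -> : s x `^ (2 * e) - 2 * c0 * s x `^ e + c0 ^+ 2 = (s x `^ e - c0) ^+ 2.
    have -> : 2 * e = e + e by ring.
    by rewrite ex//; ring.
  have z0 := normr_ge0 (s x - s y0).
  have h1 : (s x `^ e - c0) ^+ 2 <= `|s x - s y0| `^ (2 * e).
    rewrite -real_normK ?num_real// mulrC powRrM powR_mulrn ?powR_ge0//.
    rewrite ler_pXn2r ?nnegrE ?powR_ge0//.
    apply: subadditive_powR; rewrite ?(ltW (s0 _ Ox)) ?(ltW sy00)//.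
    by rewrite (ltW e0) ltW.
  apply: le_trans h1 _; rewrite /W indicE.
  have nE : `|s x - s y0| ^+ 2 = (s x - s y0) ^+ 2 by rewrite real_normK ?num_real.
  have q1 : 0 <= 2 * sig * (s x ^+ 2 + M0).
    by rewrite mulr_ge0// ?addr_ge0 ?sqr_ge0 ?(ltW M00)// mulr_ge0// ltW.
  case: (x \in K); rewrite /= ?mul1r ?mul0r ?mulr0 ?subrr ?mulr0 ?addr0 ?add0r ?subr0 ?mulr1.
    have [h _] := Ht _ z0; rewrite nE in h.
    exact: le_addl3.
  have [_ h] := Hs _ z0; rewrite nE in h.
  have h2 := ler_wpM2l (ltW sig0) (z2le x).
  exact: (le_tail tau0 h h2).
have j4 := gintegrableZ mO (2 * c0) ise.
have j5 := gintegrableB mO ise2 j4.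
have := gint_le mO (gintegrableD mO j5 (gintegrable_const (c0 ^+ 2))) iW pw.
rewrite (gintD mO j5 (gintegrable_const _)) (gintB mO ise2 j4) (gintZ mO _ ise) gint_const.
move=> dev; apply: (square_deviation_le dev Wle se1).
by apply: gint_ge0 => x _; exact: powR_ge0.
Qed.

End small_gradient.

(** * Conclusion *)

Section decay_scalar.
Context {R : realType}.

Lemma powR_third_cube (x : R) : 0 <= x -> (x `^ 3^-1) ^+ 3 = x.
Proof.
move=> x0; rewrite -powR_mulrn ?powR_ge0// -powRrM mulVf ?powRr1//.
Qed.

(** The choice mu = (2 M / J)^(1/3) makes the last term equal to J / 2, which the left-hand side
    absorbs. *)
Lemma optimize_cube (J X M : R) : 0 < M -> 0 <= X -> 0 <= J ->
  (forall mu, 0 < mu -> J <= mu * X + mu ^- 3 * M) ->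
  J `^ (4 / 3) <= 2 * (2 * M) `^ 3^-1 * X.
Proof.
move=> M0 X0 J0 H; have [->|Jn0] := eqVneq J 0.
  rewrite powR0 ?mulf_neq0 ?invr_eq0// !mulr_ge0 ?powR_ge0//.
have Jp : 0 < J by rewrite lt_neqAle eq_sym Jn0.
pose j := J `^ 3^-1; pose c := (2 * M) `^ 3^-1.
have j0 : 0 < j by exact: powR_gt0.
have c0 : 0 < c by rewrite powR_gt0// mulr_gt0.
have j3 : j ^+ 3 = J by exact: powR_third_cube.
have c3 : c ^+ 3 = 2 * M by apply: powR_third_cube; rewrite mulr_ge0// ltW.
have -> : J `^ (4 / 3) = J * j.
  have -> : 4 / 3 = 1 + 3^-1 :> R by field.
  by rewrite powRD ?(gt_eqF Jp) ?implybT// powRr1.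
have := H (c / j) (divr_gt0 c0 j0); rewrite -/c.
have -> : (c / j) ^- 3 * M = J / 2.
  rewrite exprMn exprVn j3 c3; field; rewrite !gt_eqF//.
move=> h; have {}h : J / 2 <= c / j * X by move: h; move: (c / j * X) => y; lra.
have := ler_wpM2r (ltW j0) h.
have -> : c / j * X * j = c * X by field; rewrite gt_eqF.
rewrite -/c -(mulrA 2) mulrAC; move: (c * X) (J * j) => y y'; lra.
Qed.

(** For I0 > 0, the integral from t to infinity of the bound I0 / (1 + k / 3 I0^(1/3) t)^3 on the
    Fisher information. *)
Definition profile (I0 k t : R) : R :=
  3 * I0 `^ (2 / 3) / (2 * k * (1 + k / 3 * I0 `^ 3^-1 * t) ^+ 2).

Lemma profile_den (I0 k t : R) : 0 < k -> 0 <= t -> 1 <= 1 + k / 3 * I0 `^ 3^-1 * t.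
Proof. by move=> k0 t0; rewrite lerDl !mulr_ge0 ?powR_ge0// ltW. Qed.

Lemma profile_time (I0 k t : R) : 0 <= I0 -> 0 < k -> 0 < t ->
  is_derive t 1 (profile I0 k) (- (I0 / (1 + k / 3 * I0 `^ 3^-1 * t) ^+ 3)).
Proof.
move=> I00 k0 t0; have D1 := profile_den I0 k0 (ltW t0).
set y := k / 3 * I0 `^ 3^-1 in D1 *; set D := 1 + y * t in D1 *.
have D0 : 0 < D by exact: lt_le_trans D1.
have dD : is_derive t 1 (fun r => 1 + y * r) y.
  have H := is_deriveD (is_derive_cst (1 : R) t 1)
    (@is_deriveZ R R R (@id R) y t 1 1 (is_derive_id _ _)).
  by apply: (is_derive_eq H); rewrite /GRing.scale/= mulr1 add0r.
have dD2 : is_derive t 1 (fun r => (1 + y * r) * (1 + y * r)) (2 * y * D).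
  have H : is_derive t 1 (fun r => (1 + y * r) * (1 + y * r)) _ := is_deriveM dD dD.
  by apply: (is_derive_eq H); rewrite /GRing.scale/= -/D; ring.
have D20 : D * D != 0 by rewrite mulf_neq0// gt_eqF.
have dV : is_derive t 1 (fun r => ((1 + y * r) * (1 + y * r))^-1) (- (D * D) ^- 2 * (2 * y * D)).
  have H : is_derive t 1 (fun r => ((1 + y * r) * (1 + y * r))^-1) _ :=
    @is_deriveV R (fun r => (1 + y * r) * (1 + y * r)) t _ 1 D20 dD2.
  by apply: (is_derive_eq H).
have E : profile I0 k = (fun r => 3 * I0 `^ (2 / 3) / (2 * k) * ((1 + y * r) * (1 + y * r))^-1).
  by apply/funext => r; rewrite /profile -/y expr2 [in LHS]invfM mulrA.
rewrite E.
have H : is_derive t 1 (fun r => 3 * I0 `^ (2 / 3) / (2 * k) *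
  ((1 + y * r) * (1 + y * r))^-1) _ := is_deriveZ (3 * I0 `^ (2 / 3) / (2 * k)) dV.
apply: (is_derive_eq H); rewrite /GRing.scale/=.
have I23 : I0 `^ (2 / 3) * I0 `^ 3^-1 = I0.
  have [->|In0] := eqVneq I0 0; first by rewrite (powR0 (x := 3^-1)) ?mulr0// invr_eq0.
  rewrite -powRD ?(negbTE In0) ?implybT//.
  have -> : 2 / 3 + 3^-1 = 1 :> R by field.
  exact: powRr1.
have -> : I0 / D ^+ 3 = I0 `^ (2 / 3) * I0 `^ 3^-1 / D ^+ 3 by rewrite I23.
have alg (a b D' : R) : 0 < D' -> 3 * a / (2 * k) * (- (D' * D') ^- 2 * (2 * (k / 3 * b) * D')) =
    - (a * b / D' ^+ 3).
  by move=> D'0; field; rewrite !gt_eqF.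
exact: alg.
Qed.

Lemma profile_ge0 (I0 k t : R) : 0 < k -> 0 <= t -> 0 <= profile I0 k t.
Proof.
move=> k0 t0; have D1 := profile_den I0 k0 t0.
have D0 : 0 <= 1 + k / 3 * I0 `^ 3^-1 * t by exact: le_trans D1.
by rewrite divr_ge0 ?mulr_ge0 ?powR_ge0 ?exprn_ge0// ltW.
Qed.

Lemma profile_le0 (I0 k t : R) : 0 < k -> 0 <= t -> profile I0 k t <= 3 * I0 `^ (2 / 3) / (2 * k).
Proof.
move=> k0 t0; have D1 := profile_den I0 k0 t0.
rewrite /profile invfM mulrA ler_piMr//; first by rewrite divr_ge0 ?mulr_ge0 ?powR_ge0// ltW.
by rewrite invf_le1 ?exprn_ege1// exprn_gt0// (lt_le_trans ltr01 D1).
Qed.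

(* The exponent 8/3 comes from I0 ^ 2 >= (2 k E0 / 3) ^ 3, itself a consequence
   of the bound E0 <= profile I0 k 0. *)
Lemma profile_kappa (I0 E0 k kap t : R) : 0 <= I0 -> 0 < k -> 0 < kap -> 0 <= t ->
  kap <= k -> kap <= k * (2 * k * E0 / 3) ^+ 3 -> 0 <= E0 ->
  E0 <= 3 * I0 `^ (2 / 3) / (2 * k) ->
  profile I0 k t <= 3 * I0 `^ (8 / 3) / (2 * kap * (1 + kap / 3 * I0 `^ 3^-1 * t) ^+ 2).
Proof.
move=> I00 k0 kap0 t0 kk kE E00 hE.
have D1 := profile_den I0 kap0 t0; have D2 := profile_den I0 k0 t0.
pose u := I0 `^ (2 / 3); have u0 : 0 <= u by exact: powR_ge0.
have u3 : u ^+ 3 = I0 ^+ 2.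
  rewrite /u -(powR_mulrn 3 (powR_ge0 _ _)) -powRrM -(powR_mulrn 2 I00).
  by congr (_ `^ _); field.
have uu : I0 `^ (8 / 3) = u * I0 ^+ 2.
  have [->|In0] := eqVneq I0 0.
    by rewrite powR0 ?mulf_neq0 ?invr_eq0// expr0n/= mulr0.
  have -> : 8 / 3 = 2 / 3 + 2 :> R by field.
  by rewrite powRD ?(negbTE In0) ?implybT// [X in _ * X]powR_mulrn.
have h1 : kap <= k * I0 ^+ 2.
  have B0 : 0 <= 2 * k * E0 / 3 by rewrite divr_ge0 ?mulr_ge0// ltW.
  apply: le_trans kE _; rewrite ler_pM2l// -u3 ler_pXn2r ?nnegrE//.
  move: hE; rewrite -/u ler_pdivlMr ?mulr_gt0// => hE.
  by rewrite ler_pdivrMr//; move: hE; rewrite mulrC; lra.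
set Dk := 1 + k / 3 * _ * t in D2; set Da := 1 + kap / 3 * _ * t in D1 *.
have DD : Da <= Dk.
  by rewrite /Da /Dk lerD2l ler_wpM2r// ler_wpM2r ?powR_ge0// ler_wpM2r.
have Da0 : 0 < Da by exact: lt_le_trans D1.
have Dk0 : 0 < Dk by exact: lt_le_trans D2.
rewrite /profile uu -/u -/Dk.
rewrite ler_pdivlMr ?mulr_gt0 ?exprn_gt0// mulrAC ler_pdivrMr ?mulr_gt0 ?exprn_gt0//.
have h2 : kap * Da ^+ 2 <= k * I0 ^+ 2 * Dk ^+ 2.
  by rewrite ler_pM ?exprn_ge0 ?(ltW kap0) ?(ltW Da0)// ler_pXn2r ?nnegrE ?(ltW Da0) ?(ltW Dk0).
have h3 := ler_wpM2l (mulr_ge0 (ler0n _ 6) u0) h2.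
have -> : 3 * u * (2 * kap * Da ^+ 2) = 6 * u * (kap * Da ^+ 2) by ring.
by have -> : 3 * (u * I0 ^+ 2) * (2 * k * Dk ^+ 2) = 6 * u * (k * I0 ^+ 2 * Dk ^+ 2) by ring.
Qed.

End decay_scalar.

(** * Differential inequality for the Fisher information and decay of both functionals *)

Section entropy_method.
Context {R : realType} {d : nat}.
Variables (Om : set 'rV[R]_d) (F : 'rV[R]_d -> R) (theta m p : R).
Hypotheses (oO : open Om) (cO : segment_convex Om)
  (F2 : smooth_upto Om (closure Om) 2 F) (green : gauss_green Om F)
  (gamma_prob : (\int[lebesgue_rV d]_(x in Om) (expR (- F x))%:E = 1)%E)
  (th0 : 0 < theta) (th1 : theta < 1) (mpE : E_theta theta m p)
  (p1 : 1 < p) (m1 : 1 < m) (mp1 : m < p + 1).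

Let mO : measurable Om := rV_open_measurable oO.
Let mF : measurable_fun Om F := smooth_measurable oO F2.
Let r := m + p - 1.
Let a := p / 2 + m - 1.
Let b := beta m p.
Let k := b * (m - 1).
Let alpha := b * m - 1.
Let c := 4 * m * (m + p - 1) / (2 * m + p - 2) ^+ 2.
Let gap := (k - alpha) * (k - 1) - (1 - theta) * k ^+ 2 / 4 -
  (2 * (k - alpha) + theta * k) ^+ 2 / (4 * theta).

Let a0 : 0 < a. Proof. by move: p1 m1; rewrite /a => *; lra. Qed.
Let D0 : 0 < 2 * m + p - 2. Proof. by move: p1 m1 => *; lra. Qed.
Let r0 : 0 < r. Proof. by move: p1 m1; rewrite /r => *; lra. Qed.
Let r20 : 0 < m + p - 2. Proof. by move: p1 m1 => *; lra. Qed.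
Let m0 : 0 < m. Proof. by move: m1 => *; lra. Qed.
Let c0 : 0 < c.
Proof. by rewrite /c divr_gt0 ?exprn_gt0// !mulr_gt0. Qed.
Let ba : b * a = 1. Proof. by rewrite /b /beta mulVf// gt_eqF. Qed.

Lemma gap_gt0 : 0 < gap.
Proof.
have h := E_theta_discriminant D0 (erefl k) (erefl alpha) mpE.
by rewrite subr_gt0 ltr_pdivrMr ?mulr_gt0// [ltRHS]mulrC.
Qed.

(** For m + p > 3 the bracket in E_theta is a sum of nonnegative terms, so the defining expression
    could not be negative. The bound makes v |-> v^((m+p-1)/2) concave, which is how the mass
    enters. *)
Lemma E_theta_le3 : m + p <= 3.
Proof.
rewrite leNgt; apply/negP => h3; move: mpE; rewrite /E_theta => /lt_geF/negbT/negP; apply.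
rewrite addr_ge0 ?sqr_ge0// mulr_ge0 ?(ltW th0)//.
have -> : 5 * m ^+ 2 + 2 * (2 * p - 7) * m + (p - 3) ^+ 2 =
  2 * m * (m - 1) + 2 * m * (m + p - 3) + (m + p - 3) ^+ 2 by ring.
have h : 0 <= m + p - 3 by rewrite subr_ge0 ltW.
have h1 : 0 <= m - 1 by rewrite subr_ge0 ltW.
by rewrite !addr_ge0 ?sqr_ge0// !mulr_ge0 ?(ltW m0).
Qed.

Variable v : 'rV[R]_d -> R -> R.
Hypotheses (sol : solution Om F m v) (adq : adequate Om F m p v)
  (mass : forall t, 0 <= t -> gint Om F (v ^~ t) = 1).

Let E := entropy Om F m p v.
Let I := fisher Om F m p v.

Let gamma1 : gintegrable Om F (cst 1) := gintegrable_cst oO F2 gamma_prob 1.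
Let gint1 : gint Om F (cst 1) = 1 := gint_cst oO F2 gamma_prob 1.

Let ivr t : 0 < t -> gintegrable Om F (fun x => v x t `^ r).
Proof. by move=> t0; have [h _] := adq_power adq (or_introl erefl); have [] := h t t0. Qed.

Let entropy_power t : 0 < t -> gint Om F (fun x => v x t `^ r) = 1 + (m + p - 2) * E t.
Proof.
move=> t0; rewrite /E (entropyE oO F2 gamma_prob (ivr t0)) mulrA divff ?gt_eqF//.
by rewrite mul1r addrC subrK.
Qed.

Let I_ge0 t : 0 <= I t.
Proof.
rewrite mulr_ge0 ?(ltW c0)//; apply: gint_ge0 => x _; exact: dot_ge0.
Qed.

Lemma entropy_nincr s t : 0 < s -> s <= t -> E t <= E s.
Proof.
move=> s0 st; apply: (derive_le0_nincr (df := fun t => - I t) st) => u /andP[su _].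
  exact: (entropy_time oO F2 green p1 m1 sol adq gamma_prob (lt_le_trans s0 su)).
by rewrite oppr_le0.
Qed.

Lemma entropy_le_init t : 0 < t -> E t <= E 0.
Proof.
move=> t0; apply: (cvgr_to_ge (adq_entropy_cvg0 adq)); apply: (near_at_right0 t0) => s /andP[s0 st].
by apply: entropy_nincr => //; exact: ltW.
Qed.

Variables (lam M : R).
Hypotheses (lam0 : 0 < lam) (lamle : (lam%:E <= lambda1 Om F theta)%E)
  (M0 : 0 < M) (EM : 2 + (m + p - 2) * E 0 <= M).

(** I' <= - 2 m c min(lam, gap) (K + L); Young's inequality gives K + L >= J^(4/3) / (2 (2
    M)^(1/3)); and I = c J accounts for the last factor. *)
Definition rate (lam' M' : R) : R :=
  2 * m * c * Num.min lam' gap / (2 * (2 * M') `^ 3^-1) * c `^ (- (4 / 3)).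

Lemma rate_gt0 : 0 < rate lam M.
Proof.
have min0 : 0 < Num.min lam gap by rewrite lt_min lam0 gap_gt0.
have X0 : 0 < 2 * (2 * M) `^ 3^-1 by rewrite mulr_gt0// powR_gt0// mulr_gt0.
have Y0 := mulr_gt0 (mulr_gt0 (mulr_gt0 (ltr0Sn R 1) m0) c0) min0.
exact: (mulr_gt0 (divr_gt0 Y0 X0) (powR_gt0 _ c0)).
Qed.

Let J t := gint Om F (fun x => grad_s2 m p v x t).

Lemma fisher_dissipation (t : R) : 0 < t ->
  exists2 dI : R, is_derive t 1 I dI & dI <= - rate lam M * I t `^ (4 / 3).
Proof.
move=> t0; set s := s_of m p v ^~ t.
have s3 : smooth_upto Om (closure Om) 3 s := s_smooth p oO sol t0 3.
have sp x : Om x -> 0 < s x by exact: (s_gt0 p sol t0).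
have iK := s_iK oO p1 m1 adq t0; have iH := s_iH oO p1 m1 adq t0.
have iA := s_iA oO p1 m1 adq t0; have iQ := s_iQ oO p1 m1 adq t0.
have iL := s_iL oO p1 m1 adq t0.
have SC := static_coercive oO cO F2 green s3 sp (fun x h => s_trace p oO sol t0 h)
  (s_neumann p oO sol t0) iK iH iA iQ iL th0 th1 lamle (erefl _)
  (erefl ((k - alpha) * (k - 1) - (1 - theta) * k ^+ 2 / 4)).
have DF := fisher_time oO F2 green p1 m1 sol adq t0.
eexists; first exact: DF.
pose wt x := s x `^ k; pose q x := dot (grad s x) (grad s x); pose z x := q x / s x.
pose Kt := gint Om F (fun x => wt x * q x).
pose Lt := gint Om F (fun x => wt x * z x ^+ 2).
pose At := gint Om F (fun x => wt x * lapg F s x ^+ 2) +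
  alpha * gint Om F (fun x => wt x * z x * lapg F s x).
have {}SC : lam * Kt + gap * Lt <= At by exact: SC.
have Kt0 : 0 <= Kt by apply: gint_ge0 => x _; rewrite mulr_ge0 ?powR_ge0 ?dot_ge0.
have Lt0 : 0 <= Lt by apply: gint_ge0 => x _; rewrite mulr_ge0 ?powR_ge0 ?sqr_ge0.
have minle : Num.min lam gap * (Kt + Lt) <= At.
  by apply: le_trans SC; rewrite mulrDr lerD// ler_wpM2r// ge_min lexx ?orbT.
have [iJ _ _] := adq_fisher adq t0.
(* [young244] is taken at mu wt and |Ds|^2 / s^2 and multiplied by s^2. The parameter mu is kept
   free, to be optimised after integration. *)
have Jle (mu : R) : 0 < mu -> J t <= mu * (Kt + Lt) + mu ^- 3 * M.
  move=> mu0; have j1 := gintegrableD mO iK iL.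
  have j2 := gintegrableD mO gamma1 (ivr t0).
  have j12 := gintegrableD mO (gintegrableZ mO mu j1) (gintegrableZ mO (mu ^- 3) j2).
  apply: (@le_trans _ _ (mu * (Kt + Lt) + mu ^- 3 * (1 + (1 + (m + p - 2) * E t)))); last first.
    rewrite lerD2l ler_wpM2l ?invr_ge0 ?exprn_ge0 ?(ltW mu0)//.
    have two (y : R) : 1 + (1 + y) = 2 + y by ring.
    apply: le_trans EM; rewrite two lerD2l.
    exact: (ler_wpM2l (ltW r20) (entropy_le_init t0)).
  rewrite -(entropy_power t0) -{1}gint1 -(gintD mO iK iL) -(gintD mO gamma1 (ivr t0)).
  rewrite -(gintZ mO mu j1) -(gintZ mO _ j2).
  rewrite -(gintD mO (gintegrableZ mO mu j1) (gintegrableZ mO _ j2)).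
  apply: (gint_le mO iJ j12) => x Ox.
  have sx := sp x Ox; have wx : 0 < wt x by exact: powR_gt0.
  have q0 : 0 <= q x by exact: dot_ge0.
  have h0 : 0 <= q x / s x ^+ 2 by rewrite divr_ge0// sqr_ge0.
  have Y := young244 (mulr_gt0 mu0 wx) h0.
  have vle : s x ^+ 2 * wt x ^- 3 <= 1 + v x t `^ r.
    (* In powers of s the exponent is b (p + 1 - m) = 2 - 3 k. It lies between 0 and that of the
       entropy since m < p + 1 and m > 1. *)
    have vE : v x t `^ (p + 1 - m) = s x ^+ 2 * wt x ^- 3.
      rewrite (v_powRE p1 m1 v t _ Ox) -/s -(powR_mulrn 2 (ltW sx)).
      rewrite /wt -(powR_mulrn 3 (powR_ge0 _ _)) -powRrM -powRN -powRD.
        congr (_ `^ _); have -> : p + 1 - m = 2 * a - 3 * (m - 1) by rewrite /a; field.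
        by rewrite mulrBr (mulrCA b 2) ba mulr1 (mulrCA b 3) -/k [k * _]mulrC.
      by rewrite (gt_eqF sx) implybT.
    rewrite -vE; apply: powR_sub_bound; last exact: (solution_gt0 sol t0 Ox).
    by move: m1 mp1; rewrite /r => h1 h2; apply/andP; split; lra.
  have alg (w sx' q' u : R) : 0 < w -> 0 < sx' -> sx' ^+ 2 * w ^- 3 <= u ->
      q' / sx' ^+ 2 <= mu * w * (q' / sx' ^+ 2) + mu * w * (q' / sx' ^+ 2) ^+ 2 + (mu * w) ^- 3 ->
      q' <= mu * (w * q' + w * (q' / sx') ^+ 2) + mu ^- 3 * u.
    move=> w0 s0' hu hY; have s20 : 0 < sx' ^+ 2 by exact: exprn_gt0.
    have := ler_wpM2l (ltW s20) hY; rewrite mulrCA divff ?gt_eqF// mulr1 => hq.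
    apply: (le_trans hq).
    have -> : sx' ^+ 2 * (mu * w * (q' / sx' ^+ 2) + mu * w * (q' / sx' ^+ 2) ^+ 2 +
        (mu * w) ^- 3) =
      mu * (w * q' + w * (q' / sx') ^+ 2) + mu ^- 3 * (sx' ^+ 2 * w ^- 3).
      by field; rewrite !gt_eqF.
    by rewrite lerD2l ler_wpM2l// invr_ge0 exprn_ge0// ltW.
  exact: (alg _ _ _ _ wx sx vle Y).
have J0 : 0 <= J t by apply: gint_ge0 => x _; exact: dot_ge0.
have OC := optimize_cube M0 (addr_ge0 Kt0 Lt0) J0 Jle.
have X0 : 0 < 2 * (2 * M) `^ 3^-1 by rewrite mulr_gt0// powR_gt0// mulr_gt0.
have IE : I t `^ (4 / 3) = c `^ (4 / 3) * J t `^ (4 / 3).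
  by rewrite /I /fisher powRM// ltW.
have min0 : 0 < Num.min lam gap by rewrite lt_min lam0 gap_gt0.
rewrite mulNr mulNr lerN2 IE /rate -/c powRN.
have -> : 2 * m * c * Num.min lam gap / (2 * (2 * M) `^ 3^-1) / c `^ (4 / 3) *
    (c `^ (4 / 3) * J t `^ (4 / 3)) =
    2 * m * c * (Num.min lam gap * (J t `^ (4 / 3) / (2 * (2 * M) `^ 3^-1))).
  have := powR_gt0 (4 / 3) c0; move: X0; move: (2 * (2 * M) `^ 3^-1) (c `^ (4 / 3)) (J t `^ _).
  by move=> x1 x2 x3 x10 x20; field; rewrite !gt_eqF.
apply: (ler_wpM2l (ltW (mulr_gt0 (mulr_gt0 (ltr0Sn R 1) m0) c0))).
apply: le_trans minle; rewrite ler_wpM2l ?(ltW min0)//.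
by rewrite ler_pdivrMr// [leRHS]mulrC.
Qed.

Let k0 := rate lam M.

Lemma fisher_decay : 0 <= I 0 /\ forall t, 0 < t ->
  I t <= I 0 / (1 + k0 / 3 * I 0 `^ 3^-1 * t) ^+ 3.
Proof.
apply: (ode_decay (dI := fun t => 'D_1 I t) rate_gt0 _ _ _ (adq_fisher_cvg0 adq)) => t t0.
- have [dI hI _] := fisher_dissipation t0; have [h1 h2] := hI.
  by apply: DeriveDef.
- exact: I_ge0.
- by have [dI [_ ->]] := fisher_dissipation t0.
Qed.

Lemma fisher_small (t eta : R) : 0 < t -> 0 < eta -> exists2 T : R, t <= T & I T <= eta.
Proof.
move=> t0 eta0; have [I00 dec] := fisher_decay.
have [Iz|In0] := eqVneq (I 0) 0.
  by exists t => //; apply: le_trans (dec _ t0) _; rewrite Iz mul0r ltW.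
have Ip : 0 < I 0 by rewrite lt_neqAle eq_sym In0.
pose y := k0 / 3 * I 0 `^ 3^-1.
have y0 : 0 < y by rewrite mulr_gt0 ?powR_gt0// divr_gt0// rate_gt0.
(* Linear growth of the denominator is enough: y T >= I 0 / eta. *)
pose T := t + I 0 / (y * eta).
have tT : t <= T by rewrite lerDl (divr_ge0 (ltW Ip) (ltW (mulr_gt0 y0 eta0))).
have T0 : 0 < T by exact: lt_le_trans tT.
exists T => //; apply: le_trans (dec _ T0) _; rewrite -/y.
have D1 : 1 <= 1 + y * T by rewrite lerDl (mulr_ge0 (ltW y0) (ltW T0)).
have Dp : 0 < 1 + y * T by exact: lt_le_trans D1.
rewrite ler_pdivrMr ?exprn_gt0//.
have D3 : 1 + y * T <= (1 + y * T) ^+ 3 by rewrite exprS ler_peMr ?(ltW Dp)// exprn_ege1.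
apply: le_trans (ler_wpM2l (ltW eta0) D3).
apply: (@le_trans _ _ (eta * (y * (I 0 / (y * eta))))).
  by rewrite le_eqVlt; apply/orP; left; apply/eqP; field; rewrite !gt_eqF.
rewrite ler_pM2l// /T; have h : 0 <= y * t := mulr_ge0 (ltW y0) (ltW t0).
by rewrite mulrDr addrA lerDr addr_ge0.
Qed.

Let e := r / (2 * a).
Let be2 : b * r = 2 * e.
Proof.
have -> : b = a^-1 by [].
by rewrite /e; move: (a) a0 => a' a0'; field; rewrite gt_eqF.
Qed.

(** [small_gradient] is applied to s at a late time T with e = r / (2 a), so that s^(2e) = v^r and
    s^e = v^(r/2). Its constant C is the second moment at time t, which no later time exceeds; hence
    the gradient threshold is fixed before T is chosen. *)
Lemma entropy_small (t eps : R) : 0 < t -> 0 < eps -> exists2 T : R, t <= T & E T <= eps.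
Proof.
move=> t0 eps0.
pose C := gint Om F (fun x => v x t `^ (2 * m + p - 2)).
have C0 : 0 <= C by apply: gint_ge0 => x _; exact: powR_ge0.
have e01 : 0 < e < 1.
  rewrite /e divr_gt0 ?mulr_gt0//= ltr_pdivrMr ?mulr_gt0// mul1r /r /a.
  by move: m1 => *; lra.
have eps1 : 0 < (m + p - 2) * eps by rewrite mulr_gt0.
have [eta eta0 H] := small_gradient oO cO F2 gamma1 gint1 e01 C0 eps1.
have [T tT IT] := fisher_small t0 (mulr_gt0 c0 eta0).
have T0 : 0 < T by exact: lt_le_trans tT.
exists T => //.
pose s := s_of m p v ^~ T.
have vs (x : 'rV[R]_d) (h : R) : Om x -> v x T `^ h = s x `^ (b * h) by exact: v_powRE.
have vp x : Om x -> 0 < v x T by exact: (solution_gt0 sol T0).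
have sp x : Om x -> 0 < s x by exact: (s_gt0 p sol T0).
have [pow _] := adq_power adq (or_intror erefl).
have [iC _ _] := pow T T0.
have E2 : {in Om, (fun x => v x T `^ (2 * m + p - 2)) =1 (fun x => s x ^+ 2)}.
  move=> x; rewrite inE => Ox; rewrite vs//.
  have -> : 2 * m + p - 2 = 2 * a by rewrite /a; field.
  by rewrite mulrCA ba mulr1 powR_mulrn// ltW// sp.
have Er : {in Om, (fun x => v x T `^ r) =1 (fun x => s x `^ (2 * e))}.
  by move=> x; rewrite inE => Ox; rewrite vs// be2.
have Eh : {in Om, (fun x => v x T `^ (r / 2)) =1 (fun x => s x `^ e)}.
  by move=> x; rewrite inE => Ox; rewrite vs// mulrA be2 mulrC mulKf.
have mv : measurable_fun Om (v^~ T) := smooth_measurable oO (solution_slice oO sol T0 0).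
have v_tr x : closure Om x -> 0 < trace Om (v^~ T) x.
  by move=> clx; exact: (sol_pos_closure sol clx T0).
have r2 : r <= 2 by rewrite /r; move: E_theta_le3 => *; lra.
have bound (h : R) : 0 <= h <= r -> gintegrable Om F (fun x => v x T `^ h).
  move=> hr; apply: (gintegrable_le mO mF _ _ (gintegrableD mO gamma1 (ivr T0))).
    exact: (smooth_measurable oO (smooth_powR h oO (solution_slice oO sol T0 0) vp v_tr)).
  by move=> x Ox; rewrite ger0_norm ?powR_ge0//; apply: powR_sub_bound => //; exact: vp.
have r1 : 1 <= r by rewrite /r; move: p1 m1 => *; lra.
have ih : gintegrable Om F (fun x => v x T `^ (r / 2)) by apply: bound; apply/andP; split; lra.
have iv : gintegrable Om F (v^~ T).
  have := bound 1; rewrite ler01 r1 => /(_ isT); apply: (gintegrable_ext mO) => x.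
  by rewrite inE => Ox; rewrite powRr1// ltW// vp.
(* Since r / 2 <= 1, the tangent inequality at 1 and the mass 1 give this form of Jensen's
   inequality. *)
have h1 : gint Om F (fun x => v x T `^ (r / 2)) <= 1.
  have iv1 := gintegrableB mO iv gamma1.
  have ib := gintegrableD mO gamma1 (gintegrableZ mO (r / 2) iv1).
  apply: le_trans (gint_le mO ih ib _) _ => [x Ox|].
    by apply: bernoulli_powR_le1; [apply/andP; split; lra|exact: vp].
  rewrite (gintD mO gamma1 (gintegrableZ mO _ iv1)) (gintZ mO _ iv1) (gintB mO iv gamma1).
  by rewrite gint1 (mass (ltW T0)) subrr mulr0 addr0.
have Cle : gint Om F (fun x => v x T `^ (2 * m + p - 2)) <= C.
  apply: (derive_le0_nincr (f := fun t' => gint Om F (fun x => v x t' `^ (2 * m + p - 2)))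
    (df := fun t' => - (2 * m + p - 2) * gint Om F (fun x => (2 * m + p - 2 - 1) * m *
    (v x t' `^ (2 * m + p - 2 + m - 3) * dot (grad (v^~ t') x) (grad (v^~ t') x)))) tT).
    move=> u /andP[tu _].
    exact: (power_time oO green p1 m1 sol adq (lt_le_trans t0 tu) (or_intror erefl)).
  move=> u _; rewrite mulNr oppr_le0 mulr_ge0 ?(ltW D0)//; apply: gint_ge0 => x _.
  rewrite mulr_ge0 ?mulr_ge0 ?powR_ge0 ?dot_ge0 ?(ltW m0)//.
  by move: p1 m1 => *; lra.
have [iJ _ _] := adq_fisher adq T0.
have Jeta : gint Om F (fun x => dot (grad s x) (grad s x)) <= eta.
  by move: IT; rewrite /I /fisher -/c ler_pM2l.
have := H s (s_smooth p oO sol T0 1) sp (gintegrable_ext mO E2 iC)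
  _ (gintegrable_ext mO Er (ivr T0)) (gintegrable_ext mO Eh ih) _ iJ Jeta.
rewrite -(gint_ext F E2) -(gint_ext F Eh) -(gint_ext F Er) (entropy_power T0).
by move=> /(_ Cle h1); rewrite lerD2l ler_pM2l.
Qed.

(** [profile] - E is nonincreasing by the bound on I. It is compared at t and at a time T where E is
    at most eps, the profile being nonnegative there. *)
Lemma entropy_decay (t : R) : 0 < t -> E t <= profile (I 0) k0 t.
Proof.
move=> t0; have [I00 dec] := fisher_decay; have kp : 0 < k0 := rate_gt0.
apply/ler_addgt0Pl => eps eps0; have [T tT ET] := entropy_small t0 eps0.
have : profile (I 0) k0 T - E T <= profile (I 0) k0 t - E t.
  apply: (derive_le0_nincr (f := fun u => profile (I 0) k0 u - E u)
    (df := fun u => - (I 0 / (1 + k0 / 3 * I 0 `^ 3^-1 * u) ^+ 3) - - I u) tT) => u /andP[tu _].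
    have u0 := lt_le_trans t0 tu.
    exact: (is_deriveB (profile_time I00 kp u0)
      (entropy_time oO F2 green p1 m1 sol adq gamma_prob u0)).
  by rewrite opprK addrC subr_le0; apply: dec; exact: lt_le_trans tu.
have := profile_ge0 (I 0) kp (le_trans (ltW t0) tT).
by move: ET; move: (profile _ _ _) (profile _ _ _) (E T) (E t) => x1 x2 x3 x4 *; lra.
Qed.

Lemma entropy_init_le : E 0 <= 3 * I 0 `^ (2 / 3) / (2 * k0).
Proof.
apply: (cvgr_to_le (adq_entropy_cvg0 adq)); apply: (near_at_right0 ltr01) => t /andP[t0 _].
by apply: le_trans (entropy_decay t0) (profile_le0 _ rate_gt0 (ltW t0)).
Qed.

End entropy_method.

Theorem theorem2p2 (R : realType) (d : nat) (Om : set 'rV[R]_d)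
    (F : 'rV[R]_d -> R) (theta m p : R)
    (d_gt0 : (0 < d)%N)
    (Om_open : open Om) (Om_neq0 : Om !=set0)
    (Om_convex : convex_set (Om : set (convex_lmodType 'rV[R]_d)))
    (Om_C1 : C1_boundary Om)
    (F_C2 : Ck_upto Om (closure Om) 2 F)
    (gamma_prob : (\int[lebesgue_rV d]_(x in Om) (expR (- F x))%:E = 1)%E)
    (Om_green : gauss_green Om F)
    (theta_gt0 : 0 < theta) (theta_lt1 : theta < 1)
    (lambda1_gt0 : (0 < lambda1 Om F theta)%E)
    (mpE : E_theta theta m p)
    (p_gt1 : 1 < p) (p_lt2 : p < 2) (m_gt1 : 1 < m) (m_ltp1 : m < p + 1) :
  forall E0 : R, exists2 kappa : R, 0 < kappa &
    forall v : 'rV[R]_d -> R -> R,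
      solution Om F m v -> adequate Om F m p v ->
      (forall t, 0 <= t -> gint Om F (v ^~ t) = 1) ->
      entropy Om F m p v 0 = E0 ->
      let I0 := fisher Om F m p v 0 in
      forall t : R, 0 < t ->
        fisher Om F m p v t <=
          I0 / (1 + kappa / 3 * I0 `^ 3^-1 * t) ^+ 3 /\
        entropy Om F m p v t <=
          3 * I0 `^ (8 / 3) /
          (2 * kappa * (1 + kappa / 3 * I0 `^ 3^-1 * t) ^+ 2).
Proof.
move=> E0.
have cO := convex_set_segment Om_convex.
have F2 : smooth_upto Om (closure Om) 2 F by exact/Ck_uptoP.
(* [lambda1] is an extended real and may be infinite; any finite positive lower bound will do. *)
have [lam lam0 lamle] : exists2 lam : R, 0 < lam & (lam%:E <= lambda1 Om F theta)%E.
  move: lambda1_gt0; case: (lambda1 Om F theta) => [l||] //= l0.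
    by exists l.
  by exists 1 => //; exact: leey.
(* The absolute value keeps M positive for every real E0, before any solution is given. *)
pose M := 2 + (m + p - 2) * `|E0|.
have mp2 : 0 < m + p - 2 by move: p_gt1 m_gt1; clear; lra.
have M0 : 0 < M by rewrite ltr_pwDl// mulr_ge0// ltW.
pose k0 := rate theta m p lam M.
have k00 : 0 < k0 := rate_gt0 theta_gt0 mpE p_gt1 m_gt1 lam0 M0.
(* The second entry of the minimum trades the power 2/3 of I0 for 8/3 and would not be positive for
   E0 <= 0, where the rate needs no reduction. *)
pose kap := if 0 < E0 then Num.min k0 (k0 * (2 * k0 * E0 / 3) ^+ 3) else k0.
have kap0 : 0 < kap.
  rewrite /kap; case: ifPn => // E00; rewrite lt_min k00/= mulr_gt0// exprn_gt0//.
  exact: (divr_gt0 (mulr_gt0 (mulr_gt0 (ltr0Sn R 1) k00) E00) (ltr0Sn R 2)).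
have kapk : kap <= k0 by rewrite /kap; case: ifPn => // _; rewrite ge_min lexx.
exists kap => // v sol adq mass vE0 I0 t t0.
have EM : 2 + (m + p - 2) * entropy Om F m p v 0 <= M.
  by rewrite vE0 lerD2l ler_wpM2l ?(ltW mp2)// ler_norm.
have [I00 dec] := fisher_decay Om_open cO F2 Om_green gamma_prob theta_gt0 theta_lt1 mpE
  p_gt1 m_gt1 m_ltp1 sol adq lam0 lamle M0 EM.
have D1 := profile_den I0 kap0 (ltW t0).
have Dp : 0 < 1 + kap / 3 * I0 `^ 3^-1 * t by exact: lt_le_trans D1.
split.
  apply: le_trans (dec t t0) _; rewrite ler_wpM2l// lef_pV2 ?posrE ?exprn_gt0//.
    rewrite ler_pXn2r ?nnegrE ?(ltW Dp)//; last exact: le_trans ler01 (profile_den I0 k00 (ltW t0)).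
    by rewrite lerD2l !ler_wpM2r ?powR_ge0 ?(ltW t0)//.
  exact: lt_le_trans ltr01 (profile_den I0 k00 (ltW t0)).
(* If E0 <= 0, monotonicity keeps the entropy at most 0, below the nonnegative right-hand side. *)
have [E00|E00] := ltP 0 E0.
  apply: le_trans (entropy_decay Om_open cO F2 Om_green gamma_prob theta_gt0 theta_lt1 mpE
    p_gt1 m_gt1 m_ltp1 sol adq mass lam0 lamle M0 EM t0) _.
  apply: (profile_kappa (E0 := E0)) => //; rewrite ?(ltW t0) ?(ltW E00)//.
    by rewrite /kap E00 ge_min lexx orbT.
  by rewrite -vE0; exact: (entropy_init_le Om_open cO F2 Om_green gamma_prob theta_gt0 theta_lt1 mpE
    p_gt1 m_gt1 m_ltp1 sol adq mass lam0 lamle M0 EM).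
apply: le_trans (entropy_le_init Om_open F2 Om_green gamma_prob p_gt1 m_gt1 sol adq t0) _.
rewrite vE0; apply: le_trans E00 _.
by rewrite divr_ge0 ?mulr_ge0 ?powR_ge0 ?exprn_ge0 ?(ltW kap0) ?(ltW Dp).
Qed.
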